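(* Let $f:\mathbb{R}^n\to\mathbb{R}$ and $c:\mathbb{R}^n\to\mathbb{R}^m$ be twice continuously differentiable, such that the problem $\min\{f(x):c(x)=0\}$ has at least one optimal solution, and let $\epsilon_1,\epsilon_2\in(0,1)$. Assume: (a) a point $z_{\epsilon_1}$ with $\|c(z_{\epsilon_1})\|\le\epsilon_1/2$ is known; (b) there exist constants $f_{\rm hi},f_{\rm low}$ and $\gamma>0$, independent of $\epsilon_1$ and $\epsilon_2$, such that $f(z_{\epsilon_1})\le f_{\rm hi}$ and $f(x)+\gamma\|c(x)\|^2/2\ge f_{\rm low}$ for all $x\in\mathbb{R}^n$; (c) there exist $\delta_f,\delta_c>0$ such that the set $\mathcal{S}(\delta_f,\delta_c):=\{x:f(x)\le f_{\rm hi}+\delta_f,\ \|c(x)\|\le1+\delta_c\}$ is compact, and $\nabla^2f$ and $\nabla^2c_i$, $i=1,\ldots,m$, are Lipschitz continuous in a convex open neighborhood $\Omega(\delta_f,\delta_c)$ of $\mathcal{S}(\delta_f,\delta_c)$; (d) (GLICQ) $\nabla c(x)=[\nabla c_1(x)\ \cdots\ \nabla c_m(x)]$ has full column rank for all $x\in\mathcal{S}(\delta_f,\delta_c)$. Consider the Newton-CG based AL method (defined in the context) with inputs $\epsilon_1,\epsilon_2$, $\Lambda>0$, $x^0\in\mathbb{R}^n$, $\lambda^0\in\mathcal{B}_\Lambda$, $\rho_0>2\gamma$, $\alpha\in(0,1)$, $r>1$, $\delta\in(0,1)$, $z_{\epsilon_1}$. Suppose that $\rho_0$ is sufficiently large such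 that $\delta_{f,1}\le\delta_f$ and $\delta_{c,1}\le\delta_c$, where $$\delta_{f,1}:=\frac{\Lambda^2}{2\rho_0},\qquad \delta_{c,1}:=\sqrt{\frac{2(f_{\rm hi}-f_{\rm low}+\gamma)}{\rho_0-2\gamma}+\frac{\Lambda^2}{(\rho_0-2\gamma)^2}}+\frac{\Lambda}{\rho_0-2\gamma}.$$ Then the following statements hold. (i) The total number of iterations of the Newton-CG method performed in the AL method is at most $\widetilde{\mathcal{O}}(\epsilon_1^{-2}\max\{\epsilon_1^{-2}\epsilon_2,\epsilon_2^{-3}\})$. If $c$ is further assumed to be affine, then it is at most $\widetilde{\mathcal{O}}(\max\{\epsilon_1^{-2}\epsilon_2,\epsilon_2^{-3}\})$. (ii) The total number of matrix-vector products performed by the Newton-CG method in the AL method is at most $\widetilde{\mathcal{O}}(\epsilon_1^{-2}\max\{\epsilon_1^{-2}\epsilon_2,\epsilon_2^{-3}\}\min\{n,\epsilon_1^{-1/2}\epsilon_2^{-1/2}\})$. If $c$ is further assumed to be affine, then it is at most $\widetilde{\mathcal{O}}(\max\{\epsilon_1^{-2}\epsilon_2,\epsilon_2^{-3}\}\min\{n,\epsilon_1^{-1/2}\epsilon_2^{-1/2}\})$.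
   Context: Notation. $\|\cdot\|$ is the Euclidean norm of a vector or the spectral norm of a matrix; $\lambda_{\min}(H)$ is the minimum eigenvalue of a real symmetric matrix; $\mathcal{B}_R=\{x:\|x\|\le R\}$ and $\Pi_{\mathcal{B}_R}$ is Euclidean projection onto it; ${\rm sgn}(s)=1$ if $s\ge0$ and $-1$ otherwise. $\widetilde{\mathcal{O}}(\cdot)$ is $\mathcal{O}(\cdot)$ with logarithmic terms omitted; the order notation records the dependence on $\epsilon_1,\epsilon_2$ (and $n$ where displayed), with $f$, $c$, $f_{\rm hi},f_{\rm low},\gamma,\delta_f,\delta_c$ and the algorithm parameters $\Lambda,\rho_0,\alpha,r,\delta,\theta,\zeta,\eta$ treated as fixed. Capped CG method. Inputs: symmetric $H\in\mathbb{R}^{n\times n}$, vector $g\ne0$, damping parameter $\varepsilon\in(0,1)$, accuracy $\zeta\in(0,1)$, scalar $U\ge0$ (default $0$). Outputs: a type d_type in {SOL, NC} and a vector $d$. Set $\bar H=H+2\varepsilon I$ and, as functions of the current $U$, $\kappa=(U+2\varepsilon)/\varepsilon$, $\widehat\zeta=\zeta/(3\kappa)$, $\tau=\sqrt\kappa/(\sqrt\kappa+1)$, $T=4\kappa^4/(1-\sqrt\tau)^2$. ''Update $U$ with $v$'' means: if $\|Hv\|>U\|v\|$, set $U=\|Hv\|/\|v\|$ and recompute $\kappa,\widehat\zeta,\tau,T$. Start with $y^0=0$, $r^0=g$, $p^0=-g$, $j=0$. If $(p^0)^T\bar Hp^0<\varepsilon\|p^0\|^2$, return $d=p^0$ with type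 NC; otherwise update $U$ with $p^0$. Then loop: set $\alpha_j=(r^j)^Tr^j/((p^j)^T\bar Hp^j)$, $y^{j+1}=y^j+\alpha_jp^j$, $r^{j+1}=r^j+\alpha_j\bar Hp^j$, $\beta_{j+1}=\|r^{j+1}\|^2/\|r^j\|^2$, $p^{j+1}=-r^{j+1}+\beta_{j+1}p^j$, $j\leftarrow j+1$; update $U$ with $p^j$, then $y^j$, then $r^j$; then apply the first of the following that is applicable (if none is, continue the loop): if $(y^j)^T\bar Hy^j<\varepsilon\|y^j\|^2$, return $d=y^j$, type NC; else if $\|r^j\|\le\widehat\zeta\|r^0\|$, return $d=y^j$, type SOL; else if $(p^j)^T\bar Hp^j<\varepsilon\|p^j\|^2$, return $d=p^j$, type NC; else if $\|r^j\|>\sqrt T\tau^{j/2}\|r^0\|$, compute $\alpha_j,y^{j+1}$ as in the loop, find $i\in\{0,\ldots,j-1\}$ with $(y^{j+1}-y^i)^T\bar H(y^{j+1}-y^i)<\varepsilon\|y^{j+1}-y^i\|^2$, and return $d=y^{j+1}-y^i$, type NC. Minimum eigenvalue oracle. Inputs: symmetric $H\in\mathbb{R}^{n\times n}$, $\varepsilon>0$, $\delta\in(0,1)$. Apply the Lanczos method to estimate $\lambda_{\min}(H)$ starting with a random vector uniformly generated on the unit sphere, for at most $N(\varepsilon,\delta):=\min\{n,1+\lceil\frac{\ln(2.75n/\delta^2)}{2}\sqrt{\|H\|/\varepsilon}\rceil\}$ iterations. If a unit vector $v$ with $v^THv\le-\varepsilon/2$ is found at some iteration, terminate and return $v$; otherwise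 certify that $\lambda_{\min}(H)\ge-\varepsilon$ (a certificate valid with probability at least $1-\delta$). Newton-CG method for $\min F$. Inputs: $\epsilon_g,\epsilon_H\in(0,1)$ (or the tolerances given), backtracking ratio $\theta\in(0,1)$, starting point $u^0$, CG accuracy $\zeta\in(0,1)$, line-search parameter $\eta\in(0,1)$, probability parameter $\delta\in(0,1)$. Set $x^0=u^0$. For $t=0,1,2,\ldots$: - If $\|\nabla F(x^t)\|>\epsilon_g$: call the capped CG method with $H=\nabla^2F(x^t)$, $\varepsilon=\epsilon_H$, $g=\nabla F(x^t)$, accuracy $\zeta$, $U=0$, obtaining $d$ and d_type. If d_type = NC, set $d^t=-{\rm sgn}(d^T\nabla F(x^t))\frac{|d^T\nabla^2F(x^t)d|}{\|d\|^3}d$; if d_type = SOL, set $d^t=d$. - Otherwise: call the minimum eigenvalue oracle with $H=\nabla^2F(x^t)$, $\varepsilon=\epsilon_H$ and $\delta$. If it certifies $\lambda_{\min}(\nabla^2F(x^t))\ge-\epsilon_H$, output $x^t$ and terminate. Otherwise it returns $v$; set d_type = NC and $d^t=-{\rm sgn}(v^T\nabla F(x^t))|v^T\nabla^2F(x^t)v|v$. - Line search: $\alpha_t=\theta^{j_t}$, where $j_t$ is the smallest nonnegative integer $j$ such that $F(x^t+\theta^jd^t)<F(x^t)-\eta\epsilon_H\theta^{2j}\|d^t\|^2$ if d_type = SOL, or $F(x^t+\theta^jd^t)<F(x^t)-\eta\theta^{2j}\|d^t\|^3/2$ if d_type = NC. Set $x^{t+1}=x^t+\alpha_td^t$. Newton-CG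 based AL method. Let $\tilde c(x):=c(x)-c(z_{\epsilon_1})$ and $\widetilde{\mathcal{L}}(x,\lambda;\rho):=f(x)+\lambda^T\tilde c(x)+\rho\|\tilde c(x)\|^2/2$. Starting with $k=0$, repeat: 1. Set $\tau_k^g=\max\{\epsilon_1,r^{k\log\epsilon_1/\log2}\}$ and $\tau_k^H=\max\{\epsilon_2,r^{k\log\epsilon_2/\log2}\}$. 2. Set $x^k_{\rm init}=z_{\epsilon_1}$ if $\widetilde{\mathcal{L}}(x^k,\lambda^k;\rho_k)>f(z_{\epsilon_1})$ and $x^k_{\rm init}=x^k$ otherwise. Call the Newton-CG method with $F=\widetilde{\mathcal{L}}(\cdot,\lambda^k;\rho_k)$, $\epsilon_g=\tau_k^g$, $\epsilon_H=\tau_k^H$, $u^0=x^k_{\rm init}$, probability parameter $\delta$ (and fixed $\theta,\zeta,\eta\in(0,1)$) to find $x^{k+1}$ such that $\widetilde{\mathcal{L}}(x^{k+1},\lambda^k;\rho_k)\le f(z_{\epsilon_1})$, $\|\nabla_x\widetilde{\mathcal{L}}(x^{k+1},\lambda^k;\rho_k)\|\le\tau_k^g$, and $\lambda_{\min}(\nabla^2_{xx}\widetilde{\mathcal{L}}(x^{k+1},\lambda^k;\rho_k))\ge-\tau_k^H$ with probability at least $1-\delta$. 3. Set $\tilde\lambda^{k+1}=\lambda^k+\rho_k\tilde c(x^{k+1})$. 4. If $\tau_k^g\le\epsilon_1$, $\tau_k^H\le\epsilon_2$ and $\|c(x^{k+1})\|\le\epsilon_1$, output $(x^{k+1},\tilde\lambda^{k+1})$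 and terminate. 5. Set $\lambda^{k+1}=\Pi_{\mathcal{B}_\Lambda}(\tilde\lambda^{k+1})$. 6. If $k=0$ or $\|\tilde c(x^{k+1})\|>\alpha\|\tilde c(x^k)\|$, set $\rho_{k+1}=r\rho_k$; otherwise $\rho_{k+1}=\rho_k$. Set $k\leftarrow k+1$. ''Total number of iterations'' and ''total number of matrix-vector products'' are summed over all calls of the Newton-CG method until the AL method terminates; matrix-vector products are those involving Hessians of $\widetilde{\mathcal{L}}(\cdot,\lambda^k;\rho_k)$. *)

(* Defs.v *)
From HB Require Import structures.
From mathcomp Require Export all_boot all_order all_algebra.
From mathcomp Require Export all_classical all_reals all_analysis.

Set Implicit Arguments.
Unset Strict Implicit.
Unset Printing Implicit Defensive.

Import Order.TTheory GRing.Theory Num.Theory.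
Import numFieldNormedType.Exports.

Local Open Scope classical_set_scope.
Local Open Scope ring_scope.

(* The library norm on matrices is the sup norm; it is used below only through
   the topology it induces.  All quantitative statements use [l2norm] and
   [specnorm]. *)
Section Euclidean.
Context {R : realType}.

Definition dotp n (u v : 'cV[R]_n) : R := (u^T *m v) 0 0.

Definition l2norm n (v : 'cV[R]_n) : R := Num.sqrt (dotp v v).

Definition qform n (H : 'M[R]_n) (v : 'cV[R]_n) : R := dotp v (H *m v).

Definition specnorm p n (A : 'M[R]_(p, n)) : R :=
  sup [set l2norm (A *m v) | v in [set v : 'cV[R]_n | l2norm v <= 1]].

Definition is_proj n (D : set 'cV[R]_n) (v w : 'cV[R]_n) : Prop :=
  D w /\ forall u, D u -> l2norm (v - w) <= l2norm (v - u).

Definition l2ball n (rad : R) : set 'cV[R]_n := [set v | l2norm v <= rad].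

Definition sgn (s : R) : R := if 0 <= s then 1 else -1.

End Euclidean.

Section Calculus.
Context {R : realType} {n : nat}.

Definition grad (F : 'cV[R]_n -> R) (x : 'cV[R]_n) : 'cV[R]_n :=
  \col_i 'D_(delta_mx i 0) F x.

Definition hess (F : 'cV[R]_n -> R) (x : 'cV[R]_n) : 'M[R]_n :=
  \matrix_(i, j) 'D_(delta_mx j 0) (fun y => grad F y i 0) x.

Definition C2 (F : 'cV[R]_n -> R) : Prop :=
  [/\ forall x, differentiable F x,
      forall x, differentiable (grad F) x
    & continuous (hess F)].

Definition lipschitz_hess (L : R) (Omega : set 'cV[R]_n)
    (F : 'cV[R]_n -> R) : Prop :=
  forall x y, Omega x -> Omega y ->
    specnorm (hess F x - hess F y) <= L * l2norm (x - y).

Definition coordf m (c : 'cV[R]_n -> 'cV[R]_m) (i : 'I_m) : 'cV[R]_n -> R :=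
  fun x => c x i 0.

(* [∇c_1(x) ... ∇c_m(x)], the transpose of the Jacobian matrix. *)
Definition gradc m (c : 'cV[R]_n -> 'cV[R]_m) (x : 'cV[R]_n) : 'M[R]_(n, m) :=
  \matrix_(i, j) grad (coordf c j) x i 0.

Definition affine m (c : 'cV[R]_n -> 'cV[R]_m) : Prop :=
  exists (A : 'M[R]_(m, n)) (b : 'cV[R]_m), forall x, c x = A *m x + b.

End Calculus.

Variant dtype := SOL | NC.

Section CappedCG.
Context {R : realType} {n : nat}.
Variables (H : 'M[R]_n) (g : 'cV[R]_n) (eps zeta U0 : R).

Definition Hbar : 'M[R]_n := H + (2 * eps)%:M.

(* The triple (y^j, r^j, p^j). *)
Fixpoint cg (j : nat) : 'cV[R]_n * 'cV[R]_n * 'cV[R]_n :=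
  match j with
  | 0 => (0, g, - g)
  | j'.+1 =>
      let: (y, r, p) := cg j' in
      let a := dotp r r / qform Hbar p in
      let y' := y + a *: p in
      let r' := r + a *: (Hbar *m p) in
      let b := l2norm r' ^+ 2 / l2norm r ^+ 2 in
      (y', r', - r' + b *: p)
  end.

Definition cgy j := (cg j).1.1.
Definition cgr j := (cg j).1.2.
Definition cgp j := (cg j).2.

Definition updU (U : R) (v : 'cV[R]_n) : R :=
  if U * l2norm v < l2norm (H *m v) then l2norm (H *m v) / l2norm v else U.

(* The value of U when the tests of iteration j are performed. *)
Fixpoint cgU (j : nat) : R :=
  match j with
  | 0 => updU U0 (cgp 0)
  | j'.+1 => updU (updU (updU (cgU j') (cgp j)) (cgy j)) (cgr j)
  end.

Definition cg_kappa (U : R) : R := (U + 2 * eps) / eps.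
Definition cg_zetahat (U : R) : R := zeta / (3 * cg_kappa U).
Definition cg_tau (U : R) : R :=
  Num.sqrt (cg_kappa U) / (Num.sqrt (cg_kappa U) + 1).
Definition cg_T (U : R) : R :=
  4 * cg_kappa U ^+ 4 / (1 - Num.sqrt (cg_tau U)) ^+ 2.

Definition lowcurv (v : 'cV[R]_n) : bool :=
  qform Hbar v < eps * l2norm v ^+ 2.

Definition cg_smallres (j : nat) : bool :=
  l2norm (cgr j) <= cg_zetahat (cgU j) * l2norm (cgr 0).

Definition cg_slow (j : nat) : bool :=
  Num.sqrt (cg_T (cgU j)) * cg_tau (cgU j) `^ (j%:R / 2) * l2norm (cgr 0)
    < l2norm (cgr j).

Definition cg_stops (j : nat) : bool :=
  [|| lowcurv (cgy j), cg_smallres j, lowcurv (cgp j) | cg_slow j].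

(* Iteration j >= 1 of the loop takes place. *)
Definition cg_reached (j : nat) : Prop :=
  [/\ (0 < j)%N, ~~ lowcurv (cgp 0)
    & forall i, (0 < i < j)%N -> ~~ cg_stops i].

(* [capped_cg t d k]: the call returns d with type t, and H has been multiplied
   with k vectors.  The products are counted without exploiting the linear
   relations between them: H p^0, then H p^l, H y^l, H r^l for 1 <= l <= j,
   and in the last case H y^(j+1).  An implementation that does exploit them
   needs fewer. *)
Variant capped_cg : dtype -> 'cV[R]_n -> nat -> Prop :=
| CG_start of lowcurv (cgp 0) : capped_cg NC (cgp 0) 1
| CG_y j of cg_reached j & lowcurv (cgy j) :
    capped_cg NC (cgy j) (3 * j + 1)
| CG_sol j of cg_reached j & ~~ lowcurv (cgy j) & cg_smallres j :
    capped_cg SOL (cgy j) (3 * j + 1)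
| CG_p j of cg_reached j & ~~ lowcurv (cgy j) & ~~ cg_smallres j
    & lowcurv (cgp j) :
    capped_cg NC (cgp j) (3 * j + 1)
| CG_slow j i of cg_reached j & ~~ lowcurv (cgy j) & ~~ cg_smallres j
    & ~~ lowcurv (cgp j) & cg_slow j
    & (i < j)%N & lowcurv (cgy j.+1 - cgy i) :
    capped_cg NC (cgy j.+1 - cgy i) (3 * j + 2).

End CappedCG.

Section Oracle.
Context {R : realType} {n : nat}.
Variables (H : 'M[R]_n) (eps delta : R) (q : 'cV[R]_n).

(* The triple (q_(k-1), b_(k-1), q_k) of the Lanczos recurrence
   b_k q_(k+1) = H q_k - a_k q_k - b_(k-1) q_(k-1), started at q_0 = q.
   When b_k = 0 the convention 0^-1 = 0 makes q_(k+1) vanish, which is how a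
   breakdown (the Krylov space has become invariant) shows up. *)
Fixpoint lanczos (k : nat) : 'cV[R]_n * R * 'cV[R]_n :=
  match k with
  | 0 => (0, 0, q)
  | k'.+1 =>
      let: (u, b, v) := lanczos k' in
      let w := H *m v - qform H v *: v - b *: u in
      (v, l2norm w, (l2norm w)^-1 *: w)
  end.

Definition lanczos_vec k := (lanczos k).2.

Definition lanczos_T (k : nat) : 'M[R]_k :=
  \matrix_(i, j)
    if i == j then qform H (lanczos_vec i)
    else if i.+1 == j :> nat then (lanczos i.+1).1.2
    else if j.+1 == i :> nat then (lanczos j.+1).1.2
    else 0.

(* v is a Ritz vector for the least eigenvalue of the k x k tridiagonal matrix
   of iteration k. *)
Definition ritz (k : nat) (v : 'cV[R]_n) : Prop :=
  exists (s : 'cV[R]_k) (a : R),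
    [/\ l2norm s = 1, lanczos_T k *m s = a *: s,
        forall (b : R) (t : 'cV[R]_k), t != 0 -> lanczos_T k *m t = b *: t ->
          a <= b
      & v = \sum_i s i 0 *: lanczos_vec i].

Definition lanczos_found (k : nat) (v : 'cV[R]_n) : Prop :=
  [/\ ritz k v, l2norm v = 1 & qform H v <= - eps / 2].

Definition lanczos_N : nat :=
  minn n (1 + `|Num.ceil (ln (11 / 4 * n%:R / delta ^+ 2) / 2
                          * Num.sqrt (specnorm H / eps))|)%N.

(* Lanczos iterations 1, ..., k take place. *)
Definition lanczos_reached (k : nat) : Prop :=
  [/\ (0 < k <= lanczos_N)%N, lanczos_vec k.-1 != 0
    & forall l v, (0 < l < k)%N -> ~ lanczos_found l v].

(* [min_eig_oracle o k]: after k Lanczos iterations, hence k products with H,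
   the oracle returns v (o = Some v) or certifies (o = None).  The certificate
   is the outcome of the computation: depending on the start vector q it may be
   wrong. *)
Variant min_eig_oracle : option 'cV[R]_n -> nat -> Prop :=
| Oracle_found k v of lanczos_reached k & lanczos_found k v :
    min_eig_oracle (Some v) k
| Oracle_certify k of lanczos_reached k
    & (forall v, ~ lanczos_found k v)
    & (k = lanczos_N \/ lanczos_vec k = 0) :
    min_eig_oracle None k.

End Oracle.

Section NewtonCG.
Context {R : realType} {n : nat}.
Variables (F : 'cV[R]_n -> R) (epsg epsH theta zeta eta delta : R).

Definition cg_direction (x : 'cV[R]_n) (t : dtype) (d : 'cV[R]_n) : 'cV[R]_n :=
  match t with
  | SOL => d
  | NC => - (sgn (dotp d (grad F x)) * (`|qform (hess F x) d| / l2norm d ^+ 3))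
            *: d
  end.

Definition eig_direction (x v : 'cV[R]_n) : 'cV[R]_n :=
  - (sgn (dotp v (grad F x)) * `|qform (hess F x) v|) *: v.

Definition suff_decrease (x : 'cV[R]_n) (t : dtype) (d : 'cV[R]_n) (j : nat) :
    bool :=
  match t with
  | SOL => F (x + theta ^+ j *: d)
             < F x - eta * epsH * theta ^+ (2 * j) * l2norm d ^+ 2
  | NC => F (x + theta ^+ j *: d)
             < F x - eta * theta ^+ (2 * j) * l2norm d ^+ 3 / 2
  end.

Definition line_search (x : 'cV[R]_n) (t : dtype) (d x' : 'cV[R]_n) : Prop :=
  exists j : nat,
    [/\ suff_decrease x t d j,
        forall i, (i < j)%N -> ~~ suff_decrease x t d i
      & x' = x + theta ^+ j *: d].

(* [newton_cg_iter q x o k]: one iteration at the iterate x, where q is the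
   start vector drawn for the Lanczos method should the oracle be called.  The
   next iterate is x' if o = Some x'; if o = None the method outputs x.  The
   number k of products with the Hessian includes the one used to scale a
   negative curvature direction. *)
Variant newton_cg_iter (q x : 'cV[R]_n) : option 'cV[R]_n -> nat -> Prop :=
| Newton_cg t d k x' of epsg < l2norm (grad F x)
    & capped_cg (hess F x) (grad F x) epsH zeta 0 t d k
    & line_search x t (cg_direction x t d) x' :
    newton_cg_iter q x (Some x') (if t is NC then k + 1 else k)
| Newton_eig v k x' of l2norm (grad F x) <= epsg
    & min_eig_oracle (hess F x) epsH delta q (Some v) k
    & line_search x NC (eig_direction x v) x' :
    newton_cg_iter q x (Some x') (k + 1)
| Newton_stop k of l2norm (grad F x) <= epsg
    & min_eig_oracle (hess F x) epsH delta q None k :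
    newton_cg_iter q x None k.

End NewtonCG.

Record al_params (R : realType) := ALParams {
  Lambda : R; rho0 : R; alpha : R; ratio : R;
  delta : R; theta : R; zeta : R; eta : R
}.

(* A configuration is [Running k x lam rho u iters mvs], in outer iteration k
   with x^k = x, lambda^k = lam, rho_k = rho, the current inner Newton-CG
   iterate being u, or [Done x lam iters mvs], with output (x, lam).  In both,
   iters and mvs are the numbers of Newton-CG iterations and of Hessian-vector
   products performed so far. *)
Variant al_config (R : realType) (n m : nat) :=
| Running of nat & 'cV[R]_n & 'cV[R]_m & R & 'cV[R]_n & nat & nat
| Done of 'cV[R]_n & 'cV[R]_m & nat & nat.

Definition iters R n m (s : al_config R n m) : nat :=
  match s with Running _ _ _ _ _ it _ => it | Done _ _ it _ => it end.

Definition mvs R n m (s : al_config R n m) : nat :=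
  match s with Running _ _ _ _ _ _ mv => mv | Done _ _ _ mv => mv end.

Definition is_done R n m (s : al_config R n m) : Prop :=
  if s is Done _ _ _ _ then True else False.

Section ALMethod.
Context {R : realType} {n m : nat}.
Variables (P : al_params R) (f : 'cV[R]_n -> R) (c : 'cV[R]_n -> 'cV[R]_m).
Variables (eps1 eps2 : R) (z x0 : 'cV[R]_n) (lam0 : 'cV[R]_m).

Definition ctilde (x : 'cV[R]_n) : 'cV[R]_m := c x - c z.

Definition auglag (lam : 'cV[R]_m) (rho : R) (x : 'cV[R]_n) : R :=
  f x + dotp lam (ctilde x) + rho * l2norm (ctilde x) ^+ 2 / 2.

Definition tol (eps : R) (k : nat) : R :=
  Num.max eps (ratio P `^ (k%:R * ln eps / ln 2)).

Definition x_init (x : 'cV[R]_n) (lam : 'cV[R]_m) (rho : R) : 'cV[R]_n :=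
  if f z < auglag lam rho x then z else x.

Definition inner_iter (k : nat) (lam : 'cV[R]_m) (rho : R) :=
  newton_cg_iter (auglag lam rho) (tol eps1 k) (tol eps2 k)
    (theta P) (zeta P) (eta P) (delta P).

Definition al_stop (k : nat) (x : 'cV[R]_n) : bool :=
  [&& tol eps1 k <= eps1, tol eps2 k <= eps2 & l2norm (c x) <= eps1].

Definition next_rho (k : nat) (x x' : 'cV[R]_n) (rho : R) : R :=
  if (k == 0%N) || (alpha P * l2norm (ctilde x) < l2norm (ctilde x'))
  then ratio P * rho else rho.

Definition al_start : al_config R n m :=
  Running 0 x0 lam0 (rho0 P) (x_init x0 lam0 (rho0 P)) 0 0.

(* One step is one iteration of the Newton-CG method; when that iteration ends
   the inner call, the outer updates are part of the step. *)
Variant al_step (q : 'cV[R]_n) : al_config R n m -> al_config R n m -> Prop :=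
| AL_inner k x lam rho u it mv u' cost
    of inner_iter k lam rho q u (Some u') cost :
    al_step q (Running k x lam rho u it mv)
              (Running k x lam rho u' it.+1 (mv + cost))
| AL_output k x lam rho u it mv cost
    of inner_iter k lam rho q u None cost & al_stop k u :
    al_step q (Running k x lam rho u it mv)
              (Done u (lam + rho *: ctilde u) it.+1 (mv + cost))
| AL_outer k x lam rho u it mv cost lam'
    of inner_iter k lam rho q u None cost & ~~ al_stop k u
    & is_proj (l2ball (Lambda P)) (lam + rho *: ctilde u) lam' :
    al_step q (Running k x lam rho u it mv)
              (Running k.+1 u lam' (next_rho k x u rho)
                 (x_init u lam' (next_rho k x u rho)) it.+1 (mv + cost)).

(* The configurations that occur in some execution, whatever unit vectors are
   drawn as start vectors for the Lanczos method. *)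
Inductive al_reachable : al_config R n m -> Prop :=
| al_reach0 : al_reachable al_start
| al_reachS q s s' of al_reachable s & l2norm q = 1 & al_step q s s' :
    al_reachable s'.

End ALMethod.

Section Problem.
Context {R : realType} {n m : nat}.
Variables (f : 'cV[R]_n -> R) (c : 'cV[R]_n -> 'cV[R]_m).

Definition Sset (fhi deltaf deltac : R) : set 'cV[R]_n :=
  [set x | f x <= fhi + deltaf /\ l2norm (c x) <= 1 + deltac].

Definition segments (S : set 'cV[R]_n) : set 'cV[R]_n :=
  [set w | exists x y (t : R),
     [/\ S x, S y, 0 <= t <= 1 & w = x + t *: (y - x)]].

(* The quantities of f and c that constants hidden in an order notation may
   depend on, all dominated by M: bounds for first and second derivatives on
   the segments joining points of S (where the Newton-CG steps lie), Lipschitz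
   constants of the Hessians on Omega, and the inverse of the least singular
   value of ∇c on S.  The dimension n is not among them, so that a bound whose
   constant depends on M alone displays all of its dependence on n. *)
Definition problem_constant (S Omega : set 'cV[R]_n) (M : R) : Prop :=
  [/\ 0 < M,
      forall w, segments S w ->
        l2norm (grad f w) <= M /\ specnorm (hess f w) <= M,
      forall i w, segments S w ->
        l2norm (grad (coordf c i) w) <= M /\
        specnorm (hess (coordf c i) w) <= M,
      lipschitz_hess M Omega f /\
      forall i, lipschitz_hess M Omega (coordf c i)
    & forall x (u : 'cV[R]_m), S x ->
        l2norm u <= M * l2norm (gradc c x *m u)].

End Problem.

Definition delta_f1 (R : realType) (P : al_params R) : R :=
  Lambda P ^+ 2 / (2 * rho0 P).

Definition delta_c1 (R : realType) (P : al_params R) (fhi flow gamma : R) : R :=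
  Num.sqrt (2 * (fhi - flow + gamma) / (rho0 P - 2 * gamma)
            + Lambda P ^+ 2 / (rho0 P - 2 * gamma) ^+ 2)
  + Lambda P / (rho0 P - 2 * gamma).

(* Main.v *)
(* Along the method every iterate stays in the level set {auglag <= f z}, which
   lies in the compact set S.  There the Hessian of the augmented Lagrangian is
   bounded by a multiple of rho, and on segments of length at most 1 it is
   Lipschitz with such a constant (for affine c, with a constant independent of
   rho).

   A Newton-CG iteration either decreases the augmented Lagrangian by a constant
   times min(eps_g^2 / eps_H, eps_H^3) / L^2, or is a full SOL step to a point
   with a small gradient, and then the next iteration calls the oracle.  Since
   the augmented Lagrangian is bounded below on the level set, this bounds the
   length of a call.  The capped CG method never gets stuck: if no difference
   y^(j+1) - y^i had small curvature, then q(y) = y^T Hbar y / 2 + g^T y would be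
   strongly convex along all of them, and the estimate-sequence argument of
   accelerated gradient descent would force the residual to decrease at the rate
   that the test for slow progress declares violated.

   By GLICQ the multiplier estimates lam + rho (c(x) - c(z)) are bounded, so rho
   is O(1 / eps1).  Hence rho increases O(log(1 / eps1)) times, and between two
   increases |c(x) - c(z)| decreases geometrically, so O(log(1 / eps1)^2) outer
   iterations suffice once the tolerances have reached eps1 and eps2, which takes
   O(1) outer iterations. *)

(* The count has to hold for every draw of the Lanczos start vectors. It therefore never uses that a
   certificate of the oracle is correct: when a call ends, only the gradient test and the stopping
   test of the outer loop are exploited.

   Only the level set of the augmented Lagrangian is under control, and a rejected trial point of a
   line search may lie outside it. Taylor estimates are therefore applied at an earlier point of the
   same ray, where the acceptance threshold is met with equality. That point lies in the level set,
   and it still yields a lower bound for the rejected step.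

   Early calls run with coarser tolerances. Both tolerances are powers of eps1 and eps2 with a
   common exponent, which keeps min(eps_g^2 / eps_H, eps_H^3) from being smaller than its final
   value. One guaranteed decrease thus serves all calls.

   Of the three logarithmic factors one comes from the increases of rho, one from the iterations
   between two increases, and one from the cost of a single Newton-CG iteration. Only the last
   contains ln n, which stems from the iteration limit of the Lanczos method. *)
Require Import Defs.
From mathcomp Require Import ring lra zify.
Import Order.TTheory GRing.Theory Num.Theory.
Set Implicit Arguments.
Unset Strict Implicit.
Unset Printing Implicit Defensive.
Import numFieldNormedType.Exports.
Local Open Scope classical_set_scope.
Local Open Scope ring_scope.

(** * Euclidean norms *)

Section EuclideanTheory.
Context {R : realType}.

Section Dotp.
Context {n : nat}.
Implicit Types u v w : 'cV[R]_n.

Lemma dotpE u v : dotp u v = \sum_i u i 0 * v i 0.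
Proof. by rewrite /dotp mxE; apply: eq_bigr => i _; rewrite mxE. Qed.

Lemma dotpC u v : dotp u v = dotp v u.
Proof. by rewrite !dotpE; apply: eq_bigr => i _; rewrite mulrC. Qed.

Lemma dotpDl u v w : dotp (u + v) w = dotp u w + dotp v w.
Proof. by rewrite /dotp linearD mulmxDl mxE. Qed.

Lemma dotpDr u v w : dotp w (u + v) = dotp w u + dotp w v.
Proof. by rewrite /dotp mulmxDr mxE. Qed.

Lemma dotpZl a u w : dotp (a *: u) w = a * dotp u w.
Proof. by rewrite /dotp linearZ -scalemxAl mxE. Qed.

Lemma dotpZr a u w : dotp w (a *: u) = a * dotp w u.
Proof. by rewrite /dotp -scalemxAr mxE. Qed.

Lemma dotpNl u w : dotp (- u) w = - dotp u w.
Proof. by rewrite -scaleN1r dotpZl mulN1r. Qed.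

Lemma dotpNr u w : dotp w (- u) = - dotp w u.
Proof. by rewrite -scaleN1r dotpZr mulN1r. Qed.

Lemma dotpBl u v w : dotp (u - v) w = dotp u w - dotp v w.
Proof. by rewrite dotpDl dotpNl. Qed.

Lemma dotpBr u v w : dotp w (u - v) = dotp w u - dotp w v.
Proof. by rewrite dotpDr dotpNr. Qed.

Lemma dotp0l u : dotp 0 u = 0.
Proof. by rewrite -(scale0r u) dotpZl mul0r. Qed.

Lemma dotp0r u : dotp u 0 = 0.
Proof. by rewrite dotpC dotp0l. Qed.

Lemma dotp_delta i u : dotp (delta_mx i 0) u = u i 0.
Proof.
rewrite dotpE (bigD1 i) //= big1 ?addr0 ?mxE ?eqxx ?mul1r //.
by move=> j /negPf ji; rewrite mxE ji mul0r.
Qed.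

Lemma dotpp_ge0 u : 0 <= dotp u u.
Proof. by rewrite dotpE sumr_ge0 // => i _; rewrite -expr2 sqr_ge0. Qed.

Lemma dotpp_eq0 u : (dotp u u == 0) = (u == 0).
Proof.
apply/eqP/eqP => [|->]; last exact: dotp0l.
rewrite dotpE => /eqP; rewrite psumr_eq0; last by move=> i _; rewrite -expr2 sqr_ge0.
move=> /allP h; apply/matrixP => i j; rewrite ord1 mxE.
by have := h i (mem_index_enum _); rewrite mulf_eq0 orbb => /eqP.
Qed.

Lemma sqr_l2norm u : l2norm u ^+ 2 = dotp u u.
Proof. by rewrite sqr_sqrtr // dotpp_ge0. Qed.

Lemma l2norm_ge0 u : 0 <= l2norm u.
Proof. exact: sqrtr_ge0. Qed.

Lemma l2norm_eq0 u : (l2norm u == 0) = (u == 0).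
Proof. by rewrite -dotpp_eq0 -sqr_l2norm sqrf_eq0. Qed.

Lemma l2norm_gt0 u : (0 < l2norm u) = (u != 0).
Proof. by rewrite lt_def l2norm_eq0 l2norm_ge0 andbT. Qed.

Lemma l2norm0 : l2norm (0 : 'cV[R]_n) = 0.
Proof. by apply/eqP; rewrite l2norm_eq0. Qed.

Lemma l2normZ a u : l2norm (a *: u) = `|a| * l2norm u.
Proof.
by rewrite /l2norm dotpZl dotpZr mulrA -expr2 sqrtrM ?sqr_ge0// sqrtr_sqr.
Qed.

Lemma l2normN u : l2norm (- u) = l2norm u.
Proof. by rewrite /l2norm dotpNl dotpNr opprK. Qed.

Lemma l2norm_distC u v : l2norm (u - v) = l2norm (v - u).
Proof. by rewrite -l2normN opprB. Qed.

Lemma CauchySchwarz u v : `|dotp u v| <= l2norm u * l2norm v.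
Proof.
have [->|v0] := eqVneq v 0; first by rewrite dotp0r normr0 mulr_ge0 ?l2norm_ge0.
have vv : 0 < dotp v v by rewrite lt_def dotpp_ge0 dotpp_eq0 v0.
rewrite -ler_sqr ?nnegrE ?mulr_ge0 ?l2norm_ge0// exprMn !sqr_l2norm real_normK ?num_real//.
have tv : dotp u v / dotp v v * dotp v v = dotp u v by rewrite divfK ?gt_eqF.
have := dotpp_ge0 (u - (dotp u v / dotp v v) *: v).
rewrite !(dotpBl, dotpBr, dotpZl, dotpZr) tv => h.
have := mulr_ge0 h (ltW vv); move: tv; rewrite (dotpC v u); set t := _ / _; nra.
Qed.

Lemma dotp_le u v : dotp u v <= l2norm u * l2norm v.
Proof. exact: le_trans (ler_norm _) (CauchySchwarz u v). Qed.

Lemma dotp_ge u v : - (l2norm u * l2norm v) <= dotp u v.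
Proof. by have := CauchySchwarz u v; rewrite ler_norml => /andP[]. Qed.

Lemma l2normD u v : l2norm (u + v) <= l2norm u + l2norm v.
Proof.
rewrite -ler_sqr ?nnegrE ?addr_ge0 ?l2norm_ge0// sqrrD !sqr_l2norm.
rewrite dotpDl !dotpDr (dotpC v u).
have := dotp_le u v; lra.
Qed.

Lemma l2normB u v : l2norm (u - v) <= l2norm u + l2norm v.
Proof. by rewrite -(l2normN v) l2normD. Qed.

Lemma l2norm_coord u i : `|u i 0| <= l2norm u.
Proof.
rewrite -ler_sqr ?nnegrE ?l2norm_ge0// sqr_l2norm dotpE (bigD1 i)//= real_normK ?num_real//.
by rewrite expr2 lerDl sumr_ge0 // => j _; rewrite -expr2 sqr_ge0.
Qed.

Lemma l2norm_le_sum u : l2norm u <= \sum_i `|u i 0|.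
Proof.
have {1}-> : u = \sum_i u i 0 *: delta_mx i 0.
  apply/matrixP => i j; rewrite ord1 summxE (bigD1 i)//= big1 ?addr0; last first.
    by move=> k /negPf ki; rewrite !mxE eq_sym ki mulr0.
  by rewrite !mxE !eqxx mulr1.
apply: (big_ind2 (fun v (a : R) => l2norm v <= a)).
- by rewrite l2norm0.
- move=> v a w b va wb; apply: le_trans (l2normD _ _) _; exact: lerD.
- move=> i _; rewrite l2normZ /l2norm dotp_delta mxE !eqxx.
  by rewrite sqrtr1 mulr1.
Qed.

End Dotp.

Lemma dotp_mull p n (A : 'M[R]_(p, n)) u v : dotp (A *m u) v = dotp u (A^T *m v).
Proof. by rewrite /dotp trmx_mul mulmxA. Qed.

Section Specnorm.
Context {p n : nat}.
Implicit Types A B : 'M[R]_(p, n).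

(** A crude bound by the sum of the entries. It makes the supremum in [specnorm] finite and later
    turns entrywise continuity into spectral bounds. *)
Lemma l2norm_mul_frob A (v : 'cV[R]_n) :
  l2norm (A *m v) <= (\sum_i \sum_j `|A i j|) * l2norm v.
Proof.
apply: le_trans (l2norm_le_sum _) _; rewrite mulr_suml; apply: ler_sum => i _.
rewrite mxE mulr_suml; apply: le_trans (ler_norm_sum _ _ _) _.
apply: ler_sum => j _; rewrite normrM ler_wpM2l //; exact: l2norm_coord.
Qed.

Lemma specnorm_has_sup A :
  has_sup [set l2norm (A *m v) | v in [set v : 'cV[R]_n | l2norm v <= 1]].
Proof.
split; first by exists (l2norm (A *m 0)), 0 => //=; rewrite l2norm0 ler01.
exists (\sum_i \sum_j `|A i j|) => _ [v /= v1 <-].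
apply: le_trans (l2norm_mul_frob _ _) _.
rewrite -[leRHS]mulr1 ler_wpM2l //.
by apply: sumr_ge0 => i _; apply: sumr_ge0.
Qed.

Lemma specnorm_ge A (v : 'cV[R]_n) : l2norm v <= 1 -> l2norm (A *m v) <= specnorm A.
Proof.
move=> v1; apply: ub_le_sup; first by case: (specnorm_has_sup A).
by exists v.
Qed.

Lemma specnorm_ge0 A : 0 <= specnorm A.
Proof.
apply: le_trans (l2norm_ge0 (A *m 0)) (specnorm_ge _ _).
by rewrite l2norm0 ler01.
Qed.

Lemma l2norm_mul A (v : 'cV[R]_n) : l2norm (A *m v) <= specnorm A * l2norm v.
Proof.
have [->|v0] := eqVneq v 0; first by rewrite mulmx0 !l2norm0 mulr0.
have vp : 0 < l2norm v by rewrite l2norm_gt0.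
have := @specnorm_ge A ((l2norm v)^-1 *: v).
rewrite -scalemxAr !l2normZ ger0_norm ?invr_ge0 ?l2norm_ge0//.
rewrite mulVf ?gt_eqF// => /(_ (lexx _)).
by rewrite mulrC ler_pdivrMr.
Qed.

Lemma specnorm_le A (a : R) : 0 <= a ->
  (forall v : 'cV[R]_n, l2norm (A *m v) <= a * l2norm v) -> specnorm A <= a.
Proof.
move=> a0 h; apply: ge_sup; first by case: (specnorm_has_sup A).
move=> _ [v /= v1 <-]; apply: le_trans (h v) _.
by rewrite -[leRHS]mulr1 ler_wpM2l.
Qed.

Lemma specnormD A B : specnorm (A + B) <= specnorm A + specnorm B.
Proof.
apply: specnorm_le => [|v]; first by rewrite addr_ge0 ?specnorm_ge0.
rewrite mulmxDl mulrDl; apply: le_trans (l2normD _ _) _.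
by apply: lerD; apply: l2norm_mul.
Qed.

Lemma specnormZ a A : specnorm (a *: A) <= `|a| * specnorm A.
Proof.
apply: specnorm_le => [|v]; first by rewrite mulr_ge0 ?specnorm_ge0.
by rewrite -scalemxAl l2normZ -mulrA ler_wpM2l// l2norm_mul.
Qed.

Lemma specnorm0 : specnorm (0 : 'M[R]_(p, n)) = 0.
Proof.
apply/le_anti; rewrite specnorm_ge0 andbT; apply: specnorm_le => // v.
by rewrite mul0mx l2norm0 mul0r.
Qed.

Lemma specnorm_sum (I : Type) (r : seq I) (P : pred I) (F : I -> 'M[R]_(p, n)) :
  specnorm (\sum_(i <- r | P i) F i) <= \sum_(i <- r | P i) specnorm (F i).
Proof.
apply: (big_ind2 (fun v (a : R) => specnorm v <= a)) => //.
- by rewrite specnorm0.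
- move=> v a w b va wb; apply: le_trans (specnormD _ _) _; exact: lerD.
Qed.

Lemma specnorm_frob A : specnorm A <= \sum_i \sum_j `|A i j|.
Proof.
apply: specnorm_le => [|v]; last exact: l2norm_mul_frob.
by apply: sumr_ge0 => i _; apply: sumr_ge0.
Qed.

End Specnorm.

Lemma specnorm_outer n (u v : 'cV[R]_n) : specnorm (u *m v^T) <= l2norm u * l2norm v.
Proof.
apply: specnorm_le => [|w]; first by rewrite mulr_ge0 ?l2norm_ge0.
have -> : u *m v^T *m w = dotp v w *: u.
  by rewrite -mulmxA [v^T *m w]mx11_scalar mul_mx_scalar.
rewrite l2normZ mulrC -mulrA ler_wpM2l ?l2norm_ge0//; exact: CauchySchwarz.
Qed.

Section Qform.
Context {n : nat}.
Implicit Types (H : 'M[R]_n) (u v : 'cV[R]_n).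

Lemma qformZ H a v : qform H (a *: v) = a ^+ 2 * qform H v.
Proof. by rewrite /qform -scalemxAr dotpZl dotpZr mulrA expr2. Qed.

Lemma qform_norm H v : `|qform H v| <= specnorm H * l2norm v ^+ 2.
Proof.
apply: le_trans (CauchySchwarz _ _) _; rewrite expr2 mulrCA.
by rewrite ler_wpM2l ?l2norm_ge0 ?l2norm_mul.
Qed.

Lemma qformDmx H K v : qform (H + K) v = qform H v + qform K v.
Proof. by rewrite /qform mulmxDl dotpDr. Qed.

Lemma qform_scalar a v : qform a%:M v = a * l2norm v ^+ 2.
Proof. by rewrite /qform mul_scalar_mx dotpZr sqr_l2norm. Qed.

Lemma qform_Hbar H eps v : qform (Hbar H eps) v = qform H v + 2 * eps * l2norm v ^+ 2.
Proof. by rewrite /Hbar qformDmx qform_scalar. Qed.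

Lemma dotp_sym_mul H u v : H^T = H -> dotp (H *m u) v = dotp u (H *m v).
Proof. by move=> sH; rewrite dotp_mull sH. Qed.

End Qform.
End EuclideanTheory.

(** * Capped conjugate gradients *)

(** Convexity of the squared norm, plus an exact expansion of the step along r. The cross term sees
    only u because r has the same product with w and u; for CG this follows from orthogonality. *)
Lemma sqr_l2norm_estimate_step (R : realType) n (r w u : 'cV[R]_n) (a b : R) :
  0 <= a <= 1 -> dotp r w = dotp r u ->
  l2norm ((1 - a) *: w + a *: u - b *: r) ^+ 2 <=
    (1 - a) * l2norm w ^+ 2 + a * l2norm u ^+ 2 - 2 * b * dotp r u
    + b ^+ 2 * dotp r r.
Proof.
move=> /andP[a0 a1] rw.
have h := dotpp_ge0 (w - u).
have aa : 0 <= a * (1 - a) by rewrite mulr_ge0// subr_ge0.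
have {h} := mulr_ge0 aa h.
rewrite !sqr_l2norm !(dotpBl, dotpBr, dotpDl, dotpDr, dotpZl, dotpZr).
by rewrite !(dotpC _ r) rw (dotpC u w); nra.
Qed.

Section UpdU.
Context {R : realType} {n : nat} (H : 'M[R]_n).
Implicit Types (U : R) (v : 'cV[R]_n).

Lemma updU_ge U v : U <= updU H U v.
Proof.
rewrite /updU; case: ifP => // h.
have v0 : 0 < l2norm v.
  rewrite l2norm_gt0; apply: contraTneq h => ->.
  by rewrite mulmx0 !l2norm0 mulr0 ltxx.
by rewrite ler_pdivlMr// ltW.
Qed.

Lemma updU_bound U v : l2norm (H *m v) <= updU H U v * l2norm v.
Proof.
rewrite /updU; case: ltP => // h.
have v0 : l2norm v != 0.
  apply: contraTneq h => /eqP; rewrite l2norm_eq0 => /eqP ->.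
  by rewrite mulmx0 !l2norm0 mulr0 ltxx.
by rewrite divfK.
Qed.

Lemma updU_le U v : U <= specnorm H -> updU H U v <= specnorm H.
Proof.
rewrite /updU; case: ifP => // h _.
have v0 : 0 < l2norm v.
  rewrite l2norm_gt0; apply: contraTneq h => ->.
  by rewrite mulmx0 !l2norm0 mulr0 ltxx.
by rewrite ler_pdivrMr// l2norm_mul.
Qed.

Lemma mulbound_updU U U' v : l2norm (H *m v) <= U * l2norm v -> U <= U' ->
  l2norm (H *m v) <= U' * l2norm v.
Proof. by move=> h UU'; apply: le_trans h _; rewrite ler_wpM2r ?l2norm_ge0. Qed.

End UpdU.

Section CGTheory.
Context {R : realType} {n : nat}.
Variables (H : 'M[R]_n) (g : 'cV[R]_n) (eps : R).
Hypothesis symH : H^T = H.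
Hypothesis eps_gt0 : 0 < eps.

Local Notation B := (Hbar H eps).
Local Notation y := (cgy H g eps).
Local Notation r := (cgr H g eps).
Local Notation p := (cgp H g eps).
Local Notation U := (cgU H g eps 0).
Local Notation cga j := (dotp (r j) (r j) / qform B (p j)).
Local Notation cgb j := (l2norm (r j.+1) ^+ 2 / l2norm (r j) ^+ 2).

Lemma cgyS j : y j.+1 = y j + cga j *: p j.
Proof. by rewrite /cgy /cgr /cgp /=; case: (cg _ _ _ j) => [[? ?] ?]. Qed.

Lemma cgrS j : r j.+1 = r j + cga j *: (B *m p j).
Proof. by rewrite /cgr /cgp /=; case: (cg _ _ _ j) => [[? ?] ?]. Qed.

Lemma cgpS j : p j.+1 = - r j.+1 + cgb j *: p j.
Proof. by rewrite /cgr /cgp /=; case: (cg _ _ _ j) => [[? ?] ?]. Qed.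

Lemma symHbar : B^T = B.
Proof. by rewrite /Hbar linearD /= symH tr_scalar_mx. Qed.

Lemma cgr_residual j : r j = g + B *m y j.
Proof.
elim: j => [|j IH]; first by rewrite mulmx0 addr0.
by rewrite cgrS cgyS mulmxDr -scalemxAr IH addrA.
Qed.

Lemma lowcurv_neq0 v : lowcurv H eps v -> v != 0.
Proof.
apply: contraTneq => ->.
by rewrite /lowcurv /qform mulmx0 dotp0r l2norm0 expr0n mulr0 ltxx.
Qed.

Lemma not_lowcurv_gt0 v : v != 0 -> ~~ lowcurv H eps v -> 0 < qform B v.
Proof.
move=> v0; rewrite /lowcurv -leNgt; apply: lt_le_trans.
by rewrite mulr_gt0// exprn_gt0// l2norm_gt0.
Qed.

(** Exactly what keeps the divisions in the first k steps legitimate; nothing is asked of the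
    iterates y. *)
Definition cg_good k := forall i, (i < k)%N -> r i != 0 /\ ~~ lowcurv H eps (p i).

Lemma cg_good_le k l : (k <= l)%N -> cg_good l -> cg_good k.
Proof. by move=> kl h i ik; apply: h; apply: leq_trans kl. Qed.

(** The step length makes [r k.+1] orthogonal to [p k], and the coefficient of [p k] makes [p k.+1]
    conjugate to it. Earlier indices follow by induction, since [B *m p i] is a multiple of
    [r i.+1 - r i]. *)
Lemma cg_invariant k : cg_good k ->
  [/\ forall i, (i < k)%N -> dotp (r k) (r i) = 0,
      forall i, (i < k)%N -> dotp (p k) (B *m p i) = 0,
      forall i, (i < k)%N -> dotp (r k) (p i) = 0
    & dotp (r k) (p k) = - dotp (r k) (r k)].
Proof.
elim/ltn_ind: k => -[_ _|k IH gk]; first by split => //; rewrite dotpNr.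
have inv j : (j <= k)%N ->
  [/\ forall i, (i < j)%N -> dotp (r j) (r i) = 0,
      forall i, (i < j)%N -> dotp (p j) (B *m p i) = 0,
      forall i, (i < j)%N -> dotp (r j) (p i) = 0
    & dotp (r j) (p j) = - dotp (r j) (r j)].
  by move=> jk; apply: IH => //; apply: cg_good_le gk; apply: leqW.
have rr j : (j <= k)%N -> 0 < dotp (r j) (r j).
  by move=> jk; rewrite lt_def dotpp_ge0 dotpp_eq0 andbT; case: (gk j jk).
have pp j : (j <= k)%N -> 0 < qform B (p j).
  move=> jk; apply: not_lowcurv_gt0; last by case: (gk j jk).
  apply/eqP => p0; have [_ _ _] := inv j jk; rewrite p0 dotp0r => /eqP.
  by rewrite eq_sym oppr_eq0 gt_eqF// rr.
have rp i : (i < k.+1)%N -> dotp (r k.+1) (p i) = 0.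
  rewrite ltnS leq_eqVlt => /predU1P[->|ik]; rewrite cgrS dotpDl dotpZl.
    have [_ _ _ ->] := inv k (leqnn k).
    rewrite [dotp (B *m _) _]dotpC -/(qform B (p k)) divfK ?gt_eqF ?pp//.
    by rewrite addNr.
  have [_ h2 h3 _] := inv k (leqnn k); rewrite h3//.
  by rewrite (dotp_sym_mul _ _ symHbar) h2// mulr0 addr0.
have rri i : (i < k.+1)%N -> dotp (r k.+1) (r i) = 0.
  case: i => [_|i ik].
    have -> : r 0 = - p 0 by rewrite opprK.
    by rewrite dotpNr rp// oppr0.
  have -> : r i.+1 = cgb i *: p i - p i.+1 by rewrite cgpS opprD opprK addrC addrNK.
  rewrite dotpBr dotpZr !rp ?mulr0 ?subrr//; exact: ltn_trans ik.
split => //; last by rewrite cgpS dotpDr dotpNr dotpZr rp// mulr0 addr0.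
move=> i ik; rewrite {1}cgpS dotpDl dotpNl dotpZl.
have a0 : cga i != 0 by rewrite gt_eqF// divr_gt0 ?rr ?pp.
have -> : B *m p i = (cga i)^-1 *: (r i.+1 - r i).
  by rewrite (cgrS i) [_ + _ - _]addrC addKr scalerA mulVf// scale1r.
rewrite dotpZr dotpBr (rri i)// subr0.
move: ik; rewrite ltnS leq_eqVlt => /predU1P[ik|ik].
  subst i; have -> : (cga k)^-1 *: (r k.+1 - r k) = B *m p k.
    by rewrite (cgrS k) [_ + _ - _]addrC addKr scalerA mulVf// scale1r.
  rewrite -/(qform B (p k)) !sqr_l2norm; field.
  by rewrite !gt_eqF ?rr ?pp.
rewrite (rri i.+1)// mulr0 oppr0 add0r.
have -> : (cga i)^-1 *: (r i.+1 - r i) = B *m p i.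
  by rewrite (cgrS i) [_ + _ - _]addrC addKr scalerA mulVf// scale1r.
by have [_ -> //] := inv k (leqnn k); rewrite mulr0.
Qed.

Lemma cg_good_rr k i : cg_good k -> (i < k)%N -> 0 < dotp (r i) (r i).
Proof. by move=> gk ik; rewrite lt_def dotpp_ge0 dotpp_eq0 andbT; case: (gk i ik). Qed.

Lemma cg_good_pp k i : cg_good k -> (i < k)%N -> 0 < qform B (p i).
Proof.
move=> gk ik; apply: not_lowcurv_gt0; last by case: (gk i ik).
apply/eqP => p0; have [_ _ _] := cg_invariant (cg_good_le (ltnW ik) gk).
by rewrite p0 dotp0r => /eqP; rewrite eq_sym oppr_eq0 gt_eqF// (cg_good_rr gk).
Qed.

Lemma cg_ry k j i : cg_good k -> (j <= k)%N -> (i <= j)%N -> dotp (r j) (y i) = 0.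
Proof.
move=> gk jk; elim: i => [|i IH] ij; first by rewrite dotp0r.
have [_ _ h _] := cg_invariant (cg_good_le jk gk).
by rewrite cgyS dotpDr dotpZr h// IH ?mulr0 ?addr0// ltnW.
Qed.

(** The Gram matrix of k nonzero orthogonal residuals is an invertible diagonal matrix, which forces
    its rank k to be at most n. *)
Lemma cg_good_leq k : cg_good k -> (k <= n)%N.
Proof.
move=> gk; pose M : 'M[R]_(k, n) := \matrix_(i, j) r i j 0.
have MM i j : (M *m M^T) i j = dotp (r i) (r j).
  by rewrite mxE dotpE; apply: eq_bigr => l _; rewrite !mxE.
have MMd : M *m M^T = diag_mx (\row_i dotp (r i) (r i)).
  apply/matrixP => i j; rewrite MM !mxE.
  have [->|ij] := eqVneq i j; first by rewrite mulr1n.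
  rewrite mulr0n; have [lij|] := ltnP i j.
    by have [h _ _ _] := cg_invariant (cg_good_le (ltnW (ltn_ord j)) gk); rewrite dotpC h.
  rewrite leq_eqVlt => /predU1P[/val_inj ji|lji]; first by rewrite ji eqxx in ij.
  by have [h _ _ _] := cg_invariant (cg_good_le (ltnW (ltn_ord i)) gk); rewrite h.
have u : M *m M^T \in unitmx.
  rewrite MMd unitmxE det_diag unitfE; apply/prodf_neq0 => i _.
  by rewrite mxE gt_eqF// (cg_good_rr gk).
apply: leq_trans (rank_leq_col M); rewrite -{1}(mxrank_unit u).
exact: mxrankM_maxl.
Qed.

Lemma cgU_nondecreasing i j : (i <= j)%N -> U i <= U j.
Proof.
move=> /subnK <-; elim: (j - i)%N => // k IH; apply: le_trans IH _.
by rewrite addSn /=; do 2 (apply: le_trans (updU_ge _ _ _)); exact: updU_ge.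
Qed.

Lemma cgU_ge0 j : 0 <= U j.
Proof. exact: le_trans (updU_ge _ _ _) (cgU_nondecreasing (leq0n j)). Qed.

Lemma cgU_specnorm j : U j <= specnorm H.
Proof.
by elim: j => [|j IH] /=; do ?apply: updU_le => //; exact: specnorm_ge0.
Qed.

Lemma cgU_r i j : (i <= j)%N -> l2norm (H *m r i) <= U j * l2norm (r i).
Proof.
move=> ij; apply: mulbound_updU (cgU_nondecreasing ij).
case: i ij => [_|i _]; last exact: updU_bound.
have := updU_bound H 0 (p 0).
by rewrite [p 0]/(- g) mulmxN !l2normN.
Qed.

Lemma cgU_y i j : (i <= j)%N -> l2norm (H *m y i) <= U j * l2norm (y i).
Proof.
move=> ij; apply: mulbound_updU (cgU_nondecreasing ij).
case: i ij => [_|i _]; first by rewrite mulmx0 !l2norm0 mulr0.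
by apply: mulbound_updU (updU_ge _ _ _); exact: updU_bound.
Qed.

Local Notation kappa u := (cg_kappa eps u).

Lemma cg_kappaE u : kappa u * eps = u + 2 * eps.
Proof. by rewrite /cg_kappa divfK// gt_eqF. Qed.

Lemma cg_kappa_ge2 u : 0 <= u -> 2 <= kappa u.
Proof. by move=> u0; rewrite /cg_kappa ler_pdivlMr//; lra. Qed.

Lemma Hbar_bound u v : l2norm (H *m v) <= u * l2norm v ->
  l2norm (B *m v) <= kappa u * eps * l2norm v.
Proof.
move=> h; rewrite cg_kappaE mulmxDl mul_scalar_mx [(u + _) * _]mulrDl.
apply: le_trans (l2normD _ _) _; apply: lerD => //.
by rewrite l2normZ ger0_norm// mulr_ge0// ltW.
Qed.

(** * Linear convergence of CG in the absence of small curvature *)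

Section Slow.

Let q v := qform B v / 2 + dotp g v.

Let q_shift u v : q (u + v) = q u + dotp (g + B *m u) v + qform B v / 2.
Proof.
rewrite /q /qform mulmxDr !dotpDl !dotpDr (dotp_sym_mul _ _ symHbar).
by rewrite (dotpC v (B *m u)) (dotp_sym_mul _ _ symHbar); field.
Qed.

(** The step length is at least [1 / (kappa * eps)]: by conjugacy the curvature along [p i] is at
    most that along [r i], and the current U bounds H on [r i]. No bound on the full norm of H is
    needed here. *)
Lemma cg_decrease j i : cg_good j.+1 -> (i <= j)%N ->
  qform B (y i.+1) / 2 + dotp g (y i.+1) <=
  qform B (y i) / 2 + dotp g (y i) - dotp (r i) (r i) / (2 * (kappa (U j) * eps)).
Proof.
move=> gj ij; have rr := @cg_good_rr _ i gj ij; have pp := @cg_good_pp _ i gj ij.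
have k2 := cg_kappa_ge2 (cgU_ge0 j).
have ke : 0 < kappa (U j) * eps by rewrite mulr_gt0//; lra.
have [_ h2 _ h4] := cg_invariant (cg_good_le (leqW ij) gj).
have rBr : qform B (r i) <= kappa (U j) * eps * dotp (r i) (r i).
  apply: le_trans (dotp_le _ _) _; rewrite -sqr_l2norm expr2 mulrCA.
  by rewrite ler_wpM2l ?l2norm_ge0// Hbar_bound// cgU_r.
have pBp : qform B (p i) <= qform B (r i).
  case: i ij {rr pp h4 rBr} h2 => [_ _|i ij h2].
    by rewrite /qform [p 0]/(- g) mulmxN dotpNl dotpNr opprK.
  have -> : r i.+1 = cgb i *: p i - p i.+1 by rewrite cgpS opprD opprK addrC addrNK.
  rewrite {2}/qform mulmxBr -scalemxAr !dotpBl !dotpBr !dotpZl !dotpZr.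
  have c1 : dotp (p i.+1) (B *m p i) = 0 by rewrite h2.
  have c2 : dotp (p i) (B *m p i.+1) = 0.
    by rewrite -(dotp_sym_mul _ _ symHbar) dotpC.
  rewrite c1 c2.
  rewrite -/(qform B (p i)) -/(qform B (p i.+1)).
  have : 0 <= cgb i ^+ 2 * qform B (p i).
    by rewrite mulr_ge0 ?sqr_ge0// ltW// (cg_good_pp gj)// ltnW.
  lra.
have := q_shift (y i) (cga i *: p i); rewrite -cgyS -cgr_residual /q => ->.
rewrite dotpZr h4 qformZ -addrA lerD2l.
have -> : cga i * - dotp (r i) (r i) + cga i ^+ 2 * qform B (p i) / 2
  = - (dotp (r i) (r i) * cga i / 2) by field; rewrite gt_eqF.
have h : (kappa (U j) * eps)^-1 <= cga i.
  rewrite ler_pdivlMr// mulrC ler_pdivrMr// mulrC; exact: le_trans pBp rBr.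
by have := ler_wpM2l (ltW rr) h; rewrite lerN2 [(2 * _)^-1]invfM; lra.
Qed.

(** The centres of the estimate sequence of accelerated gradient descent for strong convexity
    modulus eps, built along the CG iterates. CG itself never computes them. *)
Fixpoint cg_estimate (a : R) (i : nat) : 'cV[R]_n :=
  if i is i'.+1
  then (1 - a) *: cg_estimate a i' + a *: y i' - (a / eps) *: r i' else 0.

Lemma cg_r_estimate k j i a : cg_good k -> (j <= k)%N -> (i <= j)%N ->
  dotp (r j) (cg_estimate a i) = 0.
Proof.
move=> gk jk; elim: i => [|i IH] ij /=; first by rewrite dotp0r.
rewrite dotpBr dotpDr !dotpZr IH ?(cg_ry gk) ?(ltnW ij)//.
have [h _ _ _] := cg_invariant (cg_good_le jk gk).
by rewrite h// !mulr0 addr0 subr0.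
Qed.

(* The potential [q (y i) - q (y j.+1) + eps / 2 * |cg_estimate a i - y j.+1|^2]
   of accelerated gradient descent contracts by [1 - 1 / sqrt kappa] as long
   as q is strongly convex between y i and y j.+1. *)
Lemma cg_linear_rate j : cg_good j.+1 ->
  (forall i, (i < j)%N -> ~~ lowcurv H eps (y j.+1 - y i)) -> (0 < j)%N ->
  l2norm (r j) ^+ 2 <=
    2 * kappa (U j) * (1 - (Num.sqrt (kappa (U j)))^-1) ^+ j * l2norm g ^+ 2.
Proof.
move=> gj hc j0; set k := kappa (U j); set sk := Num.sqrt k.
have k2 : 2 <= k := cg_kappa_ge2 (cgU_ge0 j).
have sk2 : sk ^+ 2 = k by rewrite sqr_sqrtr//; lra.
have sk1 : 1 < sk by rewrite -sqrtr1 ltr_sqrt; lra.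
set a := sk^-1.
have a0 : 0 < a by rewrite invr_gt0; lra.
have a1 : a < 1 by rewrite invf_lt1//; lra.
have ka : k * a ^+ 2 = 1 by rewrite /a exprVn sk2 mulfV// gt_eqF//; lra.
pose ys := y j.+1.
have strong i : (i < j)%N ->
    q (y i) + dotp (r i) (ys - y i) + eps / 2 * l2norm (ys - y i) ^+ 2 <= q ys.
  move=> ij; have /= := hc i ij; rewrite /lowcurv -leNgt -/ys => h.
  have -> : q ys = q (y i + (ys - y i)) by rewrite addrC subrK.
  rewrite q_shift -cgr_residual; lra.
pose Psi i := q (y i) - q ys + eps / 2 * l2norm (cg_estimate a i - ys) ^+ 2.
have dec i : (i < j)%N -> Psi i.+1 <= (1 - a) * Psi i.
  move=> ij; have st := strong i ij.
  have de := cg_decrease gj (ltnW ij); rewrite -/k -/(q _) -/(q _) in de.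
  set v := cg_estimate a i.
  have rv : dotp (r i) v = 0 by rewrite (cg_r_estimate _ gj)//; lia.
  have ry : dotp (r i) (y i) = 0 by rewrite (cg_ry gj)//; lia.
  (* The choice [a = 1 / sqrt k] makes the guaranteed decrease of q cancel the squared gradient term
     of the estimate step. *)
  have e1 : dotp (r i) (r i) / (2 * (k * eps)) = eps / 2 * (a / eps) ^+ 2 * dotp (r i) (r i).
    have -> : a / eps = sk^-1 / eps by [].
    by rewrite -sk2; field; rewrite !gt_eqF//; lra.
  rewrite /Psi /= -/v.
  have -> : (1 - a) *: v + a *: y i - (a / eps) *: r i - ys
     = ((1 - a) *: (v - ys) + a *: (y i - ys)) - (a / eps) *: r i.
    apply/matrixP => l l'; rewrite !mxE; ring.
  set w := v - ys; set u := y i - ys.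
  have dru : dotp (r i) u = - dotp (r i) ys by rewrite /u dotpBr ry sub0r.
  have drw : dotp (r i) w = dotp (r i) u by rewrite dru /w dotpBr rv sub0r.
  have ea : eps * (a / eps) = a by rewrite mulrC divfK// gt_eqF.
  have a01 : 0 <= a <= 1 by rewrite !ltW.
  have := sqr_l2norm_estimate_step (a / eps) a01 drw.
  move: st; rewrite dotpBr ry subr0 [l2norm (ys - _)]l2norm_distC -/u => st.
  move: de; rewrite e1 => de; rewrite dru.
  move: st de ea; move: (q (y i.+1)) (q (y i)) (q ys) (dotp (r i) ys) (dotp (r i) (r i)).
  move=> q1 q0 qs d rr st de ea nn.
  have h2 : a * (q0 + d + eps / 2 * l2norm u ^+ 2) <= a * qs by rewrite ler_pM2l.
  have := ler_wpM2l (ltW eps_gt0) nn.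
  have ead : eps * (a / eps) * d = a * d by rewrite ea.
  nra.
have Psi_le i : (i <= j)%N -> Psi i <= (1 - a) ^+ i * Psi 0.
  elim: i => [|i IH] ij; first by rewrite expr0 mul1r.
  apply: le_trans (dec i ij) _; rewrite exprS -mulrA ler_wpM2l ?IH//; first lra.
  exact: ltnW.
have q0 : q (y 0) = 0 by rewrite /q /qform mulmx0 !dotp0r mul0r addr0.
have qys : q ys = - (qform B ys / 2).
  have : dotp (r j.+1) ys = 0 by rewrite (cg_ry gj).
  rewrite cgr_residual -/ys dotpDl (dotp_sym_mul _ _ symHbar) -/(qform B ys) /q; lra.
have cys : eps * l2norm ys ^+ 2 <= qform B ys.
  by have := hc 0 j0; rewrite /lowcurv -leNgt subr0.
(* Orthogonality of [r j.+1] and [ys] gives [qform B ys = - dotp g ys], and the curvature hypothesis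
   at [y 0 = 0] bounds the length of [ys] in terms of g. *)
have e0 : qform B ys <= l2norm g ^+ 2 / eps.
  have gys : qform B ys <= l2norm g * l2norm ys.
    have : dotp (r j.+1) ys = 0 by rewrite (cg_ry gj).
    rewrite cgr_residual -/ys dotpDl (dotp_sym_mul _ _ symHbar) -/(qform B ys).
    have := dotp_ge g ys; lra.
  rewrite ler_pdivlMr//.
  have := l2norm_ge0 ys; have := l2norm_ge0 g.
  move: gys cys; move: (l2norm g) (l2norm ys) (qform B ys) => G Y Q h1 h2 G0 Y0.
  have [Y00|Yp] : Y = 0 \/ 0 < Y by move: Y0; rewrite le_eqVlt => /predU1P[->|]; [left|right].
    rewrite Y00 mulr0 in h1; apply: le_trans (sqr_ge0 G).
    by rewrite mulr_le0_ge0// ltW.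
  have : eps * Y <= G by rewrite -(ler_pM2r Yp); nra.
  move=> h3; apply: (@le_trans _ _ (G * Y * eps)); first by rewrite ler_pM2r.
  by rewrite -mulrA (mulrC Y) expr2 ler_wpM2l.
have Psi0 : Psi 0 <= l2norm g ^+ 2 / eps.
  rewrite /Psi q0 qys /= !sub0r l2normN; lra.
have ej : q (y j) - q ys <= (1 - a) ^+ j * (l2norm g ^+ 2 / eps).
  apply: (@le_trans _ _ (Psi j)).
    by rewrite /Psi lerDl mulr_ge0 ?sqr_ge0// divr_ge0// ltW.
  apply: le_trans (Psi_le j (leqnn j)) _; rewrite ler_wpM2l// exprn_ge0//; lra.
(* The last step, from [y j] to [ys], converts the gap in q into a bound for the residual. *)
have de := cg_decrease gj (leqnn j); rewrite -/k -/(q _) -/(q _) -/ys in de.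
have {de} : dotp (r j) (r j) / (2 * (k * eps)) <= (1 - a) ^+ j * (l2norm g ^+ 2 / eps) by lra.
have ke : 0 < 2 * (k * eps) by rewrite mulr_gt0// mulr_gt0//; lra.
rewrite -sqr_l2norm (ler_pdivrMr _ _ ke).
move/le_trans; apply; rewrite le_eqVlt; apply/orP; left; apply/eqP.
by field; rewrite gt_eqF.
Qed.

End Slow.

Variable zeta : R.
Hypothesis zeta01 : 0 < zeta < 1.
Hypothesis g_neq0 : g != 0.

Lemma cg_zetahat_gt0 u : 0 <= u -> 0 < cg_zetahat eps zeta u.
Proof.
move=> u0; have := cg_kappa_ge2 u0; case/andP: zeta01 => z0 _ k2.
by rewrite divr_gt0// mulr_gt0//; lra.
Qed.

Lemma cg_reached_good j : cg_reached H g eps zeta 0 j -> cg_good j.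
Proof.
move=> [j0 lp0 ns] [|i] ij; first by [].
have := ns i.+1; rewrite /= ij => /(_ isT).
rewrite /cg_stops !negb_or => /and4P[_ sr lp _]; split => //.
rewrite -l2norm_gt0; apply: le_lt_trans _ (_ : cg_zetahat eps zeta (U i.+1) * l2norm (r 0) < _).
  by rewrite mulr_ge0 ?l2norm_ge0// ltW// cg_zetahat_gt0// cgU_ge0.
by rewrite ltNge.
Qed.

Lemma cg_reached_leq j : cg_reached H g eps zeta 0 j -> (j <= n)%N.
Proof. by move=> /cg_reached_good/cg_good_leq. Qed.

End CGTheory.

(** * Estimates for the parameters of the capped CG method *)

Section CGConstants.
Context {R : realType}.
Variables (eps zeta u : R).
Hypothesis eps_gt0 : 0 < eps.
Hypothesis u_ge0 : 0 <= u.

Local Notation k := (cg_kappa eps u).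
Local Notation tau := (cg_tau eps u).

Let k2 : 2 <= k := cg_kappa_ge2 eps_gt0 u_ge0.
Let sk1 : 1 < Num.sqrt k.
Proof. by rewrite -sqrtr1 ltr_sqrt; move: k2; lra. Qed.
Let sk2 : Num.sqrt k ^+ 2 = k.
Proof. by rewrite sqr_sqrtr//; move: k2; lra. Qed.

Lemma cg_tauE : 1 - tau = (Num.sqrt k + 1)^-1.
Proof. by rewrite /cg_tau; move: sk1 => h; field; rewrite gt_eqF//; lra. Qed.

Lemma cg_tau01 : 0 < tau < 1.
Proof.
have h := sk1; rewrite /cg_tau divr_gt0 ?ltr_pdivrMr//; lra.
Qed.

Lemma cg_tau_ge : 1 - (Num.sqrt k)^-1 <= tau.
Proof.
have h := sk1; have := cg_tauE; move: tau => t te.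
have : (Num.sqrt k + 1)^-1 <= (Num.sqrt k)^-1 by rewrite lef_pV2 ?posrE; lra.
lra.
Qed.

(** Factor [1 - tau] as [(1 - sqrt tau) * (1 + sqrt tau)], where the second factor is at most 2. *)
Lemma cg_sqrt_tau : (Num.sqrt k + 1)^-1 / 2 <= 1 - Num.sqrt tau < 1.
Proof.
have /andP[t0 t1] := cg_tau01.
have s0 : 0 < Num.sqrt tau by rewrite sqrtr_gt0.
have s1 : Num.sqrt tau < 1 by rewrite -sqrtr1 ltr_sqrt.
have : Num.sqrt tau ^+ 2 = tau by rewrite sqr_sqrtr// ltW.
rewrite -cg_tauE; move: tau (Num.sqrt tau) s0 s1 => t s s0 s1 st.
by rewrite -st; apply/andP; split; nra.
Qed.

(** With [cg_tau_ge] this puts the threshold of the test for slow progress above the rate of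
    [cg_linear_rate]. *)
Lemma cg_T_ge : 2 * k <= cg_T eps u.
Proof.
have /andP[s0 s1] := cg_sqrt_tau; have h := sk1; have h2 := k2.
have p0 : 0 < (Num.sqrt k + 1)^-1 by rewrite invr_gt0; lra.
rewrite /cg_T ler_pdivlMr; last by rewrite exprn_gt0//; lra.
move: (Num.sqrt tau) s0 s1 => s s0 s1.
have sq : (1 - s) ^+ 2 <= 1 by rewrite expr_le1//; lra.
apply: (@le_trans _ _ (2 * k)); first by nra.
rewrite (exprS k 3).
have : 1 <= k ^+ 3 by rewrite exprn_ege1//; lra.
nra.
Qed.

(** As [1 - sqrt tau] is at least [1 / (4 * k)], T is at most 64 k^6. Any polynomial bound would do,
    since only its logarithm enters the iteration count. *)
Lemma cg_sqrtT_le : Num.sqrt (cg_T eps u) <= 8 * k ^+ 3.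
Proof.
have /andP[s0 s1] := cg_sqrt_tau; have h := sk1; have h2 := k2.
have p0 : 0 < (Num.sqrt k + 1)^-1 by rewrite invr_gt0; lra.
have k3 : 0 <= 8 * k ^+ 3 by rewrite mulr_ge0// exprn_ge0//; lra.
rewrite -[leRHS]ger0_norm// -sqrtr_sqr; apply: ler_wsqrtr.
have p1 : 0 < (1 - Num.sqrt tau) ^+ 2 by rewrite exprn_gt0//; lra.
rewrite /cg_T ler_pdivrMr//.
have : (4 * k)^-1 <= 1 - Num.sqrt tau.
  apply: le_trans s0; rewrite -invfM lef_pV2 ?posrE; [|lra|lra].
  have := sk2; nra.
move: (1 - Num.sqrt tau) p1 => s p1 hs.
have : 1 <= s * (4 * k) by rewrite -ler_pdivrMr ?mul1r//; lra.
move=> ss; have : 1 <= (s * (4 * k)) ^+ 2 by rewrite exprn_ege1.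
move=> h3; have k4 : 0 <= k ^+ 4 by rewrite exprn_ge0//; lra.
have -> : (8 * k ^+ 3) ^+ 2 * s ^+ 2 = 4 * k ^+ 4 * (s * (4 * k)) ^+ 2 by ring.
by rewrite ler_peMr// mulr_ge0.
Qed.

Lemma ln_cg_tau_le : ln tau <= - (2 * Num.sqrt k)^-1.
Proof.
have /andP[t0 t1] := cg_tau01; have h := sk1.
have : ln (1 + (tau - 1)) <= tau - 1 by apply: le_ln1Dx; lra.
rewrite addrC subrK => /le_trans; apply.
rewrite -opprB cg_tauE lerN2 lef_pV2 ?posrE; lra.
Qed.

Lemma cg_T_gt0 : 0 < cg_T eps u.
Proof. by apply: lt_le_trans cg_T_ge; have := k2; lra. Qed.

(** The hypothesis holds at an iteration where the residual is neither small nor slow. Taking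
    logarithms, [- ln tau >= 1 / (2 * sqrt k)] bounds i. *)
Lemma cg_iteration_bound i : 0 < zeta < 1 ->
  cg_zetahat eps zeta u <= Num.sqrt (cg_T eps u) * tau `^ (i%:R / 2) ->
  i%:R <= 4 * Num.sqrt k * ln (24 * k ^+ 4 / zeta).
Proof.
move=> /andP[z0 z1] hz; have /andP[t0 t1] := cg_tau01.
have h := sk1; have h2 := k2; have kp : 0 < k by lra.
have sT : 0 < Num.sqrt (cg_T eps u) by rewrite sqrtr_gt0 cg_T_gt0.
have zh : 0 < cg_zetahat eps zeta u by rewrite divr_gt0// mulr_gt0.
have pw : 0 < tau `^ (i%:R / 2) by rewrite powR_gt0.
have : ln (cg_zetahat eps zeta u) <= ln (Num.sqrt (cg_T eps u)) + i%:R / 2 * ln tau.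
  rewrite -ln_powR -lnM ?posrE// ler_ln ?posrE// mulr_gt0//.
have l1 : ln (Num.sqrt (cg_T eps u)) <= ln (8 * k ^+ 3).
  by rewrite ler_ln ?posrE ?cg_sqrtT_le// mulr_gt0// exprn_gt0.
have -> : 24 * k ^+ 4 / zeta = 8 * k ^+ 3 / cg_zetahat eps zeta u.
  by rewrite /cg_zetahat; field; rewrite !gt_eqF.
have k8 : 0 < 8 * k ^+ 3 by rewrite mulr_gt0// exprn_gt0.
rewrite ln_div ?posrE//.
have l2 := ln_cg_tau_le.
have il : i%:R / 2 * ln tau <= - (i%:R * (4 * Num.sqrt k)^-1).
  apply: (@le_trans _ _ (i%:R / 2 * - (2 * Num.sqrt k)^-1)).
    by rewrite ler_wpM2l.
  by rewrite mulrN lerN2 le_eqVlt; apply/orP; left; apply/eqP; field; rewrite gt_eqF//; lra.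
move=> l3; rewrite mulrC -ler_pdivrMr; last by lra.
lra.
Qed.

End CGConstants.

Lemma cg_kappa_le {R : realType} (eps u v : R) : 0 < eps -> u <= v ->
  cg_kappa eps u <= cg_kappa eps v.
Proof. by move=> e0 uv; rewrite /cg_kappa ler_pM2r ?invr_gt0// lerD2r. Qed.

(** * Outcome and cost of a capped CG call *)

Section CGOutcome.
Context {R : realType} {n : nat}.
Variables (H : 'M[R]_n) (g : 'cV[R]_n) (eps zeta : R).
Hypothesis symH : H^T = H.
Hypothesis eps_gt0 : 0 < eps.
Hypothesis zeta01 : 0 < zeta < 1.
Hypothesis g_neq0 : g != 0.

Local Notation B := (Hbar H eps).
Local Notation y := (cgy H g eps).
Local Notation r := (cgr H g eps).
Local Notation p := (cgp H g eps).
Local Notation U := (cgU H g eps 0).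

Lemma cg_not_smallres_neq0 j : ~~ cg_smallres H g eps zeta 0 j -> r j != 0.
Proof.
rewrite /cg_smallres -ltNge -l2norm_gt0; apply: le_lt_trans.
by rewrite mulr_ge0 ?l2norm_ge0// ltW// cg_zetahat_gt0// cgU_ge0.
Qed.

(** By contraposition: without such an i, [cg_linear_rate] applies and its bound lies below the
    threshold that the residual was found to exceed. *)
Lemma cg_slow_witness j : cg_reached H g eps zeta 0 j ->
  ~~ cg_smallres H g eps zeta 0 j -> ~~ lowcurv H eps (p j) ->
  cg_slow H g eps 0 j ->
  exists2 i, (i < j)%N & lowcurv H eps (y j.+1 - y i).
Proof.
(* The tests of iteration j that failed show that one more step can be computed. *)
move=> rj sr lp slow; have gj : cg_good H g eps j.+1.
  move=> i; rewrite ltnS leq_eqVlt => /predU1P[->|].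
    by split=> //; exact: cg_not_smallres_neq0.
  exact: (cg_reached_good eps_gt0 zeta01 g_neq0 rj).
apply: contrapT => ne.
have hc i : (i < j)%N -> ~~ lowcurv H eps (y j.+1 - y i).
  by move=> ij; apply/negP => li; apply: ne; exists i.
have j0 : (0 < j)%N by case: rj.
have := cg_linear_rate symH eps_gt0 gj hc j0.
have u0 := cgU_ge0 H g eps j; move: slow; rewrite /cg_slow -[r 0]/g.
move: (U j) u0 => u u0 slow.
have k2 := cg_kappa_ge2 eps_gt0 u0.
have T0 := cg_T_gt0 eps_gt0 u0.
have /andP[t0 t1] := cg_tau01 eps_gt0 u0.
have sk : 1 < Num.sqrt (cg_kappa eps u) by rewrite -sqrtr1 ltr_sqrt; lra.
apply/negP; rewrite -ltNge.
apply: le_lt_trans (_ : cg_T eps u * cg_tau eps u ^+ j * l2norm g ^+ 2 < _).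
  rewrite ler_wpM2r ?sqr_ge0//; apply: ler_pM.
  - by lra.
  - by rewrite exprn_ge0// subr_ge0 invf_le1//; lra.
  - exact: cg_T_ge.
  - apply: lerXn2r; rewrite ?nnegrE; last exact: cg_tau_ge.
    + by rewrite subr_ge0 invf_le1//; lra.
    + exact: ltW.
have tj : (cg_tau eps u `^ (j%:R / 2)) ^+ 2 = cg_tau eps u ^+ j.
  by rewrite -powR_mulrn ?powR_ge0// -powRrM divfK// powR_mulrn// ltW.
have -> : cg_T eps u * cg_tau eps u ^+ j * l2norm g ^+ 2 =
    (Num.sqrt (cg_T eps u) * cg_tau eps u `^ (j%:R / 2) * l2norm g) ^+ 2.
  by rewrite -tj -{1}(sqr_sqrtr (ltW T0)); ring.
rewrite ltr_sqr ?nnegrE ?l2norm_ge0//.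
by rewrite !mulr_ge0 ?sqrtr_ge0 ?powR_ge0 ?l2norm_ge0.
Qed.

Lemma capped_cg_exists : exists t d k, capped_cg H g eps zeta 0 t d k.
Proof.
have [lp0|lp0] := boolP (lowcurv H eps (p 0)).
  by exists NC, (p 0), 1%N; exact: CG_start.
(* A loop that never stops would produce n + 1 nonzero orthogonal residuals. *)
have ex : exists j, (0 < j)%N && cg_stops H g eps zeta 0 j.
  apply: contrapT => ne.
  have : cg_reached H g eps zeta 0 n.+1.
    by split=> // i /andP[i0 _]; apply/negP => si; apply: ne; exists i; rewrite i0.
  by move/(cg_reached_leq symH eps_gt0 zeta01 g_neq0); rewrite ltnn.
case: (ex_minnP ex) => j /andP[j0 sj] mj.
have rj : cg_reached H g eps zeta 0 j.
  split=> // i /andP[i0 ij]; apply/negP => si.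
  by have := mj i; rewrite i0 si => /(_ isT); rewrite leqNgt ij.
have [ly|ly] := boolP (lowcurv H eps (y j)).
  by do 3 eexists; exact: CG_y rj ly.
have [sr|sr] := boolP (cg_smallres H g eps zeta 0 j).
  by do 3 eexists; exact: CG_sol rj ly sr.
have [lp|lp] := boolP (lowcurv H eps (p j)).
  by do 3 eexists; exact: CG_p rj ly sr lp.
have sl : cg_slow H g eps 0 j.
  by move: sj; rewrite /cg_stops (negbTE ly) (negbTE sr) (negbTE lp).
have [i ij li] := cg_slow_witness rj sr lp sl.
by do 3 eexists; exact: (CG_slow rj ly sr lp sl ij li).
Qed.

Lemma capped_cg_NC d k : capped_cg H g eps zeta 0 NC d k -> lowcurv H eps d.
Proof. by move=> h; inversion h. Qed.

Lemma capped_cg_SOL d k : capped_cg H g eps zeta 0 SOL d k ->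
  [/\ 0 < l2norm d, eps * l2norm d ^+ 2 <= qform B d,
      dotp d g = - qform B d & l2norm (g + B *m d) <= eps / 2 * l2norm d].
Proof.
move=> h; inversion h as [| |j rj ly sr| |]; subst.
have gj := cg_reached_good eps_gt0 zeta01 g_neq0 rj.
have u0 := cgU_ge0 H g eps j.
have k2 := cg_kappa_ge2 eps_gt0 u0.
have cur : eps * l2norm (y j) ^+ 2 <= qform B (y j) by move: ly; rewrite /lowcurv -leNgt.
have ry : dotp (r j) (y j) = 0 by exact: (cg_ry symH eps_gt0 gj (leqnn j) (leqnn j)).
have rE := cgr_residual H g eps j.
have By := Hbar_bound eps_gt0 (cgU_y H g eps (leqnn j)).
have gp : 0 < l2norm g by rewrite l2norm_gt0.
(* From [g = r j - B *m y j] and the test, [3 * kappa * |r|] is at most [|g|], hence at most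
   [|r| + kappa * eps * |y|]. Since kappa is at least 1, the term [|r|] can be absorbed at the price
   of one kappa. *)
have rle : l2norm (r j) <= eps / 2 * l2norm (y j).
  have gle : l2norm g <= l2norm (r j) + cg_kappa eps (U j) * eps * l2norm (y j).
    have {1}-> : g = r j - B *m y j by rewrite rE addrK.
    by apply: le_trans (l2normB _ _) _; rewrite lerD2l.
  case/andP: zeta01 => z0 z1.
  have rg : l2norm (r j) * (3 * cg_kappa eps (U j)) <= zeta * l2norm g.
    rewrite -ler_pdivlMr; last by lra.
    by move: sr; rewrite /cg_smallres -[r 0]/g /cg_zetahat mulrAC.
  have zg : zeta * l2norm g <= l2norm g by rewrite ler_piMl// ltW.
  move: (cg_kappa eps (U j)) (l2norm (r j)) (l2norm_ge0 (r j)) k2 gle rg.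
  move=> k r0 r00 k2 gle rg.
  rewrite -(@ler_pM2r _ k); last by lra.
  have : 0 <= r0 * (k - 1) by rewrite mulr_ge0//; lra.
  lra.
have y0 : 0 < l2norm (y j).
  rewrite lt_def l2norm_ge0 andbT; apply/eqP => y0.
  have yz : y j = 0 by apply/eqP; rewrite -l2norm_eq0 y0.
  move: rle; rewrite rE yz mulmx0 addr0 l2norm0 mulr0; lra.
split=> //; last by rewrite -rE.
move: ry; rewrite rE dotpDl (dotp_sym_mul _ _ (symHbar eps symH)) -/(qform B (y j)).
by rewrite dotpC; lra.
Qed.

(** The inequality for k is strict in order to leave room for the product that scales a negative
    curvature direction. U is replaced by its upper bound [specnorm H]. *)
Lemma capped_cg_cost t d k : capped_cg H g eps zeta 0 t d k ->
  exists j : nat, [/\ (k < 3 * j.+1)%N, (j <= n)%N &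
    j%:R <= 1 + 4 * Num.sqrt (cg_kappa eps (specnorm H))
                * ln (24 * cg_kappa eps (specnorm H) ^+ 4 / zeta)].
Proof.
have K2 := cg_kappa_ge2 eps_gt0 (specnorm_ge0 H).
case/andP: (zeta01) => z0 z1.
have K4 : 1 <= cg_kappa eps (specnorm H) ^+ 4 by rewrite exprn_ege1//; lra.
have ln0 : 0 <= ln (24 * cg_kappa eps (specnorm H) ^+ 4 / zeta).
  by rewrite ln_ge0// ler_pdivlMr//; lra.
have b0 : 0 <= 4 * Num.sqrt (cg_kappa eps (specnorm H))
                * ln (24 * cg_kappa eps (specnorm H) ^+ 4 / zeta).
  by rewrite mulr_ge0// mulr_ge0// sqrtr_ge0.
suff main j : cg_reached H g eps zeta 0 j ->
    (j <= n)%N /\ j%:R <= 1 + 4 * Num.sqrt (cg_kappa eps (specnorm H))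
                * ln (24 * cg_kappa eps (specnorm H) ^+ 4 / zeta).
  move=> h; inversion h; subst; first by exists 0%N; split => //; rewrite addr_ge0.
  1-4: by exists j; case: (main j) => //; split=> //; rewrite mulnS addnC ltn_add2r.
move=> rj; split; first exact: (cg_reached_leq symH eps_gt0 zeta01 g_neq0 rj).
(* An iteration j >= 2 is entered only if the tests of iteration j - 1 failed; this accounts for the
   leading 1 of the bound. *)
case: j rj => [|[|i]] rj; first by rewrite addr_ge0.
  by rewrite lerDl.
have [_ _ ns] := rj; have := ns i.+1; rewrite ltnSn => /(_ isT).
rewrite /cg_stops !negb_or => /and4P[_ sr _ sl].
have u0 := cgU_ge0 H g eps i.+1; have uH := cgU_specnorm H g eps i.+1.
rewrite -[i.+2%:R]natr1 addrC lerD2l.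
have gp : 0 < l2norm g by rewrite l2norm_gt0.
have : cg_zetahat eps zeta (U i.+1)
    <= Num.sqrt (cg_T eps (U i.+1)) * cg_tau eps (U i.+1) `^ (i.+1%:R / 2).
  rewrite -(ler_pM2r gp); move: sr sl; rewrite /cg_smallres /cg_slow -ltNge -leNgt.
  by move=> /ltW; exact: le_trans.
move/(cg_iteration_bound eps_gt0 u0 zeta01) => /le_trans; apply.
have k2 := cg_kappa_ge2 eps_gt0 u0.
have kK := cg_kappa_le eps_gt0 uH.
have k4 : 1 <= cg_kappa eps (U i.+1) ^+ 4 by rewrite exprn_ege1//; lra.
apply: ler_pM.
- by rewrite mulr_ge0 ?sqrtr_ge0.
- by rewrite ln_ge0// ler_pdivlMr//; lra.
- by rewrite ler_wpM2l// ler_wsqrtr.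
- rewrite ler_ln ?posrE ?divr_gt0//; try lra.
  rewrite ler_pM2r ?invr_gt0// ler_wpM2l// lerXn2r ?nnegrE//; lra.
Qed.

End CGOutcome.

(** * Gradients, Hessians and Taylor bounds *)

Lemma MVT_everywhere {R : realType} (phi dphi : R -> R) (a b : R) : a < b ->
  (forall t : R, is_derive t 1 phi (dphi t)) ->
  exists c, a < c < b /\ phi b - phi a = dphi c * (b - a).
Proof.
move=> ab h; have hc : {within `[a, b], continuous phi}.
  by apply: derivable_within_continuous => x _; exact: ex_derive.
have [c cab e] := MVT ab (fun x _ => h x) hc.
by exists c; split=> //; move: cab; rewrite in_itv.
Qed.

Lemma is_derive_quadratic {R : realType} (c q t : R) :
  is_derive t (1 : R) (fun s => s * c + s ^+ 2 / 2 * q) (c + t * q).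
Proof.
have i1 := is_derive_id t (1 : R).
have := @is_deriveD _ _ _ _ _ _ _ _ _ (is_deriveZ c i1) (is_deriveZ (q / 2) (is_deriveM i1 i1)).
congr is_derive; last by rewrite /GRing.scale /=; field.
apply/funext => s; change (c * s + q / 2 * (s * s) = s * c + s ^+ 2 / 2 * q); ring.
Qed.

Section Gradients.
Context {R : realType} {n : nat}.
Implicit Types (F : 'cV[R]_n -> R) (G : 'cV[R]_n -> 'cV[R]_n)
  (K : 'cV[R]_n -> 'M[R]_n) (x a v d : 'cV[R]_n).

(** Directional derivatives suffice: every estimate below restricts F to a line. In this form the
    calculus rules carry explicit gradients. *)
Definition has_grad F G := forall a v, is_derive a v F (dotp (G a) v).

Definition has_hess F G K :=
  has_grad F G /\ forall i, has_grad (fun a => G a i 0) (fun a => (row i (K a))^T).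

Lemma dotp_row (A : 'M[R]_n) i v : dotp (row i A)^T v = (A *m v) i 0.
Proof. by rewrite dotpE mxE; apply: eq_bigr => j _; rewrite !mxE. Qed.

Lemma has_gradE F G : has_grad F G -> grad F = G.
Proof.
move=> h; apply/funext => a; apply/matrixP => i j; rewrite ord1 mxE.
by rewrite (@derive_val _ _ _ _ _ _ _ (h a _)) dotpC dotp_delta.
Qed.

Lemma has_hessE F G K : has_hess F G K -> hess F = K.
Proof.
move=> [hG hK]; apply/funext => a; apply/matrixP => i j; rewrite mxE (has_gradE hG).
by rewrite (@derive_val _ _ _ _ _ _ _ (hK i a _)) dotpC dotp_delta !mxE.
Qed.

Lemma is_derive_line F x d (t : R) l :
  is_derive (x + t *: d) d F l -> is_derive t (1 : R) (fun s => F (x + s *: d)) l.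
Proof.
have e : (fun h : R => h^-1 *: ((F \o shift (x + t *: d)) (h *: d) - F (x + t *: d)))
  = (fun h : R => h^-1 *: (((fun s => F (x + s *: d)) \o shift t) (h *: (1 : R)) -
      F (x + t *: d))).
  apply/funext => h /=; congr (_ *: (F _ - _)).
  by rewrite [h%:A]mulr1 addrCA -scalerDl.
by case=> h1 h2; split; rewrite /derivable /derive -e.
Qed.

Lemma has_grad_line F G x d (t : R) : has_grad F G ->
  is_derive t (1 : R) (fun s => F (x + s *: d)) (dotp (G (x + t *: d)) d).
Proof. by move=> h; exact: is_derive_line. Qed.

Lemma has_hess_line F G K x d w (t : R) : has_hess F G K ->
  is_derive t (1 : R) (fun s => dotp w (G (x + s *: d)))
    (dotp w (K (x + t *: d) *m d)).
Proof.
move=> [_ h].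
have -> : (fun s : R => dotp w (G (x + s *: d))) =
    \sum_(i < n) (w i 0 \*: (fun s => G (x + s *: d) i 0)).
  by apply/funext => s; rewrite dotpE fct_sumE.
have -> : dotp w (K (x + t *: d) *m d) =
    \sum_(i < n) w i 0 *: (K (x + t *: d) *m d) i 0.
  by rewrite dotpE.
apply: is_derive_sum => i; apply: is_deriveZ.
have := has_grad_line x d t (h i).
by rewrite dotp_row.
Qed.

Lemma differentiable_has_grad F : (forall x, differentiable F x) -> has_grad F (grad F).
Proof.
move=> dF a v; apply: DeriveDef; first exact: diff_derivable.
rewrite deriveE// {1}(_ : v = \sum_i v i 0 *: delta_mx i 0); last first.
  apply/matrixP => i j; rewrite ord1 summxE (bigD1 i)//= big1 ?addr0; last first.
    by move=> k /negPf ki; rewrite !mxE eq_sym ki mulr0.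
  by rewrite !mxE !eqxx mulr1.
rewrite linear_sum /= dotpE; apply: eq_bigr => i _.
by rewrite linearZ /= mxE deriveE// mulrC.
Qed.

Lemma C2_has_hess F : C2 F -> has_hess F (grad F) (hess F).
Proof.
move=> [dF dG _]; split; first exact: differentiable_has_grad.
move=> i a v; apply: DeriveDef.
  by apply: (derivable_mxP _ _ _).1; exact: diff_derivable.
have dE w : 'D_w (fun y => grad F y i 0) a = ('d (grad F) a w) i 0.
  by rewrite -deriveE// derive_mx ?mxE//; exact: diff_derivable.
rewrite dE {1}(_ : v = \sum_j v j 0 *: delta_mx j 0); last first.
  apply/matrixP => k j; rewrite ord1 summxE (bigD1 k)//= big1 ?addr0; last first.
    by move=> l /negPf ki; rewrite !mxE eq_sym ki mulr0.
  by rewrite !mxE !eqxx mulr1.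
rewrite linear_sum /= summxE dotpE; apply: eq_bigr => j _.
by rewrite linearZ /= !mxE dE mulrC.
Qed.

Lemma has_gradD F1 F2 G1 G2 : has_grad F1 G1 -> has_grad F2 G2 ->
  has_grad (fun a => F1 a + F2 a) (fun a => G1 a + G2 a).
Proof.
move=> h1 h2 a v; rewrite dotpDl.
exact: (@is_deriveD _ _ _ F1 F2 a v _ _ (h1 a v) (h2 a v)).
Qed.

Lemma has_gradM F1 F2 G1 G2 : has_grad F1 G1 -> has_grad F2 G2 ->
  has_grad (fun a => F1 a * F2 a) (fun a => F1 a *: G2 a + F2 a *: G1 a).
Proof.
move=> h1 h2 a v; rewrite dotpDl !dotpZl.
exact: (@is_deriveM _ _ F1 F2 a v _ _ (h1 a v) (h2 a v)).
Qed.

Lemma has_grad_cst (c : R) : has_grad (fun=> c) (fun=> 0).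
Proof. by move=> a v; rewrite dotp0l; exact: is_derive_cst. Qed.

Lemma has_hessD F1 F2 G1 G2 K1 K2 : has_hess F1 G1 K1 -> has_hess F2 G2 K2 ->
  has_hess (fun a => F1 a + F2 a) (fun a => G1 a + G2 a) (fun a => K1 a + K2 a).
Proof.
move=> [h1 k1] [h2 k2]; split; first exact: has_gradD.
move=> i; have := has_gradD (k1 i) (k2 i); congr (has_grad _ _).
  by apply/funext => a; rewrite mxE.
by apply/funext => a; apply/matrixP => j k; rewrite !mxE.
Qed.

Lemma has_hessM F1 F2 G1 G2 K1 K2 : has_hess F1 G1 K1 -> has_hess F2 G2 K2 ->
  has_hess (fun a => F1 a * F2 a) (fun a => F1 a *: G2 a + F2 a *: G1 a)
    (fun a => F1 a *: K2 a + F2 a *: K1 a + G2 a *m (G1 a)^T + G1 a *m (G2 a)^T).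
Proof.
move=> [h1 k1] [h2 k2]; split; first exact: has_gradM.
move=> i; have := has_gradD (has_gradM h1 (k2 i)) (has_gradM h2 (k1 i)).
congr (has_grad _ _); first by apply/funext => a; rewrite !mxE.
apply/funext => a; apply/matrixP => j k; rewrite !mxE !big_ord1 !mxE ord1; ring.
Qed.

Lemma has_hess_cst (c : R) : has_hess (fun=> c) (fun=> 0) (fun=> 0).
Proof.
split; first exact: has_grad_cst.
move=> i; have := has_grad_cst 0; congr (has_grad _ _).
  by apply/funext => a; rewrite mxE.
by apply/funext => a; apply/matrixP => j k; rewrite !mxE.
Qed.

Lemma has_hessZ (c : R) F G K : has_hess F G K ->
  has_hess (fun a => c * F a) (fun a => c *: G a) (fun a => c *: K a).
Proof.
move=> h; have := has_hessM (has_hess_cst c) h; congr (has_hess _ _ _).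
  by apply/funext => a; rewrite scaler0 addr0.
by apply/funext => a; rewrite scaler0 trmx0 mulmx0 mul0mx !addr0.
Qed.

Lemma has_hess_sum (I : Type) (r : seq I) (F : I -> 'cV[R]_n -> R)
    (G : I -> 'cV[R]_n -> 'cV[R]_n) (K : I -> 'cV[R]_n -> 'M[R]_n) :
  (forall i, has_hess (F i) (G i) (K i)) ->
  has_hess (fun a => \sum_(i <- r) F i a) (fun a => \sum_(i <- r) G i a)
    (fun a => \sum_(i <- r) K i a).
Proof.
move=> h; elim: r => [|i r IH].
  have := has_hess_cst 0; congr (has_hess _ _ _);
    by apply/funext => a; rewrite big_nil.
have := has_hessD (h i) IH; congr (has_hess _ _ _);
  by apply/funext => a; rewrite big_cons.
Qed.

(* Young's theorem: a second difference quotient is a value of either mixed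
   derivative, by two applications of the mean value theorem. *)
Lemma second_difference F G K x i j (h : R) : has_hess F G K -> 0 < h ->
  exists s t, [/\ 0 < s < h, 0 < t < h &
    F (x + h *: delta_mx i 0 + h *: delta_mx j 0) - F (x + h *: delta_mx i 0)
    - F (x + h *: delta_mx j 0) + F x
    = h ^+ 2 * K (x + s *: delta_mx i 0 + t *: delta_mx j 0) i j].
Proof.
move=> [hG hK] h0; set ei := delta_mx i 0; set ej := delta_mx j 0.
pose phi (s : R) := F (x + h *: ej + s *: ei) - F (x + s *: ei).
have dphi (t : R) : is_derive t 1 phi
    (dotp (G (x + h *: ej + t *: ei)) ei - dotp (G (x + t *: ei)) ei).
  by apply: is_deriveB; exact: has_grad_line.
have [s [sh es]] := MVT_everywhere h0 dphi.
have dpsi (t : R) : is_derive t 1 (fun t => G (x + s *: ei + t *: ej) i 0)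
    (K (x + s *: ei + t *: ej) i j).
  have := has_grad_line (x + s *: ei) ej t (hK i).
  by rewrite dotpC dotp_delta !mxE.
have [t [th et]] := MVT_everywhere h0 dpsi.
exists s, t; split=> //.
move: es; rewrite /phi !scale0r !addr0 !(dotpC _ ei) !dotp_delta subr0.
move: et; rewrite scale0r addr0 subr0.
rewrite (addrAC x (h *: ej)) (addrAC x (h *: ej)) => ->.
by move=> e; rewrite expr2 mulrC mulrA -e; ring.
Qed.

Lemma delta_mx_norm i : `|(delta_mx i 0 : 'cV[R]_n)| <= 1.
Proof.
change (mx_norm (delta_mx i 0 : 'cV[R]_n) <= 1); rewrite mx_normrE.
apply: bigmax_le => //= k _.
by rewrite mxE; case: (_ && _); rewrite ?normr1 ?normr0.
Qed.

(** The second difference is symmetric in i and j, so the entries (i, j) and (j, i) of K agree at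
    two points arbitrarily close to x. *)
Lemma has_hess_sym F G K : has_hess F G K -> continuous K ->
  forall x, (K x)^T = K x.
Proof.
move=> hF cH x.
apply/matrixP => i j; rewrite mxE; apply/eqP; rewrite -subr_eq0 -normr_le0.
apply/ler_addgt0Pr => e e0; rewrite add0r.
have cij k l : \forall y \near x, `|K x k l - K y k l| < e / 2.
  have := @continuous_comp _ _ _ K (fun M : 'M[R]_n => M k l) x (cH x)
    (@coord_continuous _ _ _ _ _ _).
  by move/cvgrPdist_lt; apply; rewrite divr_gt0.
have /nbhs_ballP[r /= r0 hr] : nbhs x [set y | `|K x i j - K y i j| < e / 2 /\
    `|K x j i - K y j i| < e / 2] by exact: filterI (cij i j) (cij j i).
have h0 : 0 < r / 4 by rewrite divr_gt0.
have inb k l (s t : R) : 0 < s < r / 4 -> 0 < t < r / 4 ->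
    ball x r (x + s *: delta_mx k 0 + t *: delta_mx l 0).
  move=> /andP[s0 s1] /andP[t0 t1]; rewrite -ball_normE /ball_ /=.
  rewrite -addrA opprD addNKr normrN.
  apply: le_lt_trans (ler_normD _ _) _; rewrite !normrZ !gtr0_norm//.
  have : s * `|(delta_mx k 0 : 'cV[R]_n)| <= s by rewrite ler_piMr ?delta_mx_norm// ltW.
  have : t * `|(delta_mx l 0 : 'cV[R]_n)| <= t by rewrite ler_piMr ?delta_mx_norm// ltW.
  lra.
have [s1 [t1 [s1h t1h e1]]] := second_difference x i j hF h0.
have [s2 [t2 [s2h t2h e2]]] := second_difference x j i hF h0.
have : (r / 4) ^+ 2 * K (x + s1 *: delta_mx i 0 + t1 *: delta_mx j 0) i j =
       (r / 4) ^+ 2 * K (x + s2 *: delta_mx j 0 + t2 *: delta_mx i 0) j i.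
  by rewrite -e1 -e2 [x + (r / 4) *: delta_mx j 0 + _]addrAC; ring.
have r2 : (r / 4) ^+ 2 != 0 by rewrite expf_neq0// gt_eqF.
move/(mulfI r2) => eK.
have [/ltW a1 _] := hr _ (inb i j s1 t1 s1h t1h).
have [_ /ltW a2] := hr _ (inb j i s2 t2 s2h t2h).
rewrite -eK in a2.
apply: le_trans (ler_distD (K (x + s1 *: delta_mx i 0 + t1 *: delta_mx j 0) i j) _ _) _.
by rewrite distrC [leRHS]splitr lerD// distrC.
Qed.

Lemma hess_sym F : C2 F -> forall x, (hess F x)^T = hess F x.
Proof. by move=> cF; have [_ _ cH] := cF; exact: has_hess_sym (C2_has_hess cF) cH. Qed.

Section Taylor.
Variables (F : 'cV[R]_n -> R) (G : 'cV[R]_n -> 'cV[R]_n) (K : 'cV[R]_n -> 'M[R]_n).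
Hypothesis hF : has_hess F G K.

(** Two applications of the mean value theorem, first to the remainder and then to its derivative;
    they give the cubic term the constant 1 in place of 1/6. *)
Lemma taylor_upper x d (L a : R) : 0 < a -> 0 <= L ->
  (forall t, 0 < t < a -> specnorm (K (x + t *: d) - K x) <= L * (t * l2norm d)) ->
  F (x + a *: d) <= F x + a * dotp (G x) d + a ^+ 2 / 2 * qform (K x) d
                    + L * (a * l2norm d) ^+ 3.
Proof.
move=> a0 L0 hL.
pose psi (t : R) := F (x + t *: d) - (t * dotp (G x) d + t ^+ 2 / 2 * qform (K x) d).
have dpsi (t : R) : is_derive t 1 psi
    (dotp (G (x + t *: d)) d - (dotp (G x) d + t * qform (K x) d)).
  apply: is_deriveB; first exact: (has_grad_line x d t hF.1).
  exact: is_derive_quadratic.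
have [s [/andP[s0 sa] es]] := MVT_everywhere a0 dpsi.
have [u [/andP[u0 us] eu]] := MVT_everywhere s0 (fun t => has_hess_line x d d t hF).
have : qform (K (x + u *: d) - K x) d <= L * (a * l2norm d) * l2norm d ^+ 2.
  apply: le_trans (ler_norm _) _; apply: le_trans (qform_norm _ _) _.
  rewrite ler_wpM2r ?sqr_ge0//; apply: le_trans (hL u _) _; first by lra.
  by rewrite ler_wpM2l// ler_wpM2r ?l2norm_ge0//; lra.
rewrite /qform mulmxBl dotpBr.
move: es eu; rewrite /psi /qform scale0r addr0 !(dotpC _ d) !subr0 expr0n /=.
move: (l2norm_ge0 d).
move: (F (x + a *: d)) (F x) (dotp d (G (x + s *: d))) (dotp d (G x)) (dotp d (K x *m d))
   (dotp d (K (x + u *: d) *m d)) (l2norm d) => Fa Fx gs gx kx ku D D0 es eu hk.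
have : s * a * (ku - kx) <= a * a * (L * (a * D) * D ^+ 2).
  apply: (@le_trans _ _ (s * a * (L * (a * D) * D ^+ 2))).
    by rewrite ler_wpM2l// mulr_ge0// ltW.
  rewrite ler_wpM2r//; last by rewrite ler_wpM2r// ltW.
  by rewrite !mulr_ge0// ltW.
have -> : L * (a * D) ^+ 3 = a * a * (L * (a * D) * D ^+ 2) by ring.
have : (gs - (gx + s * kx)) * a = s * a * (ku - kx).
  by rewrite opprD addrA eu; ring.
lra.
Qed.

(** The mean value theorem fails for vector-valued maps, so it is applied to the product of the
    gradient with the error vector w itself; then one factor [l2norm w] cancels. *)
Lemma grad_taylor x d (L : R) : 0 <= L ->
  (forall t, 0 < t < 1 -> specnorm (K (x + t *: d) - K x) <= L * (t * l2norm d)) ->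
  l2norm (G (x + d) - G x - K x *m d) <= L * l2norm d ^+ 2.
Proof.
move=> L0 hL; set w := G (x + d) - G x - K x *m d.
have [t [/andP[t0 t1]]] := MVT_everywhere ltr01 (fun t => has_hess_line x d w t hF).
rewrite scale0r scale1r addr0 subr0 mulr1 => et.
have : dotp w w <= l2norm w * (L * l2norm d ^+ 2).
  have -> : dotp w w = dotp w ((K (x + t *: d) - K x) *m d).
    by rewrite {2}/w !dotpBr et mulmxBl dotpBr.
  apply: le_trans (dotp_le _ _) _; rewrite ler_wpM2l ?l2norm_ge0//.
  apply: le_trans (l2norm_mul _ _) _; rewrite expr2 mulrA ler_wpM2r ?l2norm_ge0//.
  apply: le_trans (hL t _) _; first by lra.
  by rewrite ler_wpM2l// ler_piMl ?l2norm_ge0// ltW.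
rewrite -sqr_l2norm expr2; have [->|w0] := eqVneq (l2norm w) 0.
  by rewrite mulr_ge0// sqr_ge0.
by rewrite ler_pM2l// lt_def w0 l2norm_ge0.
Qed.

Lemma grad_lipschitz_segment x d (M : R) :
  (forall t, 0 < t < 1 -> specnorm (K (x + t *: d)) <= M) ->
  l2norm (G (x + d) - G x) <= M * l2norm d.
Proof.
move=> hM; set v := G (x + d) - G x.
have [t [t01]] := MVT_everywhere ltr01 (fun t => has_hess_line x d v t hF).
rewrite scale0r scale1r addr0 subr0 mulr1 => et.
have M0 : 0 <= M by exact: le_trans (specnorm_ge0 _) (hM t t01).
have : dotp v v <= l2norm v * (M * l2norm d).
  rewrite {2}/v dotpBr et; apply: le_trans (dotp_le _ _) _.
  rewrite ler_wpM2l ?l2norm_ge0//; apply: le_trans (l2norm_mul _ _) _.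
  by rewrite ler_wpM2r ?l2norm_ge0// hM.
rewrite -sqr_l2norm expr2; have [->|w0] := eqVneq (l2norm v) 0.
  by rewrite mulr_ge0// l2norm_ge0.
by rewrite ler_pM2l// lt_def w0 l2norm_ge0.
Qed.

End Taylor.
End Gradients.

(** * One Newton-CG iteration *)

Lemma is_derive_neg_near {R : realType} (phi : R -> R) (l a : R) :
  is_derive (0 : R) 1 phi l -> l < 0 -> phi 0 <= 0 -> 0 < a ->
  exists2 b, 0 < b < a & forall t, 0 < t <= b -> phi t < 0.
Proof.
move=> [dphi phil] l0 phi0 a0.
have : (fun h : R => h^-1 *: ((phi \o shift 0) (h *: (1 : R)) - phi 0)) @ 0^' --> l.
  by rewrite -phil; exact: dphi.
move/cvgrPdist_lt => /(_ (- l)); rewrite oppr_gt0 => /(_ l0).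
rewrite near_withinE /= => /nbhs_ballP[r /= r0 hr].
exists (Num.min (r / 2) (a / 2)).
  rewrite lt_min !divr_gt0//= gt_min; apply/orP; right; lra.
move=> t /andP[t0]; rewrite le_min => /andP[tr _].
have tr' : ball (0 : R) r t by rewrite /ball /= sub0r normrN gtr0_norm//; lra.
have t0' : t != 0 by rewrite gt_eqF.
have := hr t tr' t0'.
rewrite addr0 [t%:A]mulr1 /GRing.scale /= distrC => /ltr_normlW h.
have : t^-1 * (phi t - phi 0) < 0 by lra.
rewrite pmulr_rlt0 ?invr_gt0//; lra.
Qed.

(** * Decrease achieved by the line search *)

Section DescentStep.
Context {R : realType} {n : nat}.
Variable F : 'cV[R]_n -> R.
Hypothesis hF : has_hess F (grad F) (hess F).
Implicit Types (x d : 'cV[R]_n).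

(** Just after 0 the ray runs below the parabola [F x - c * t ^+ 2], by its slope or by its
    curvature. At a it is not below, so the intermediate value theorem gives a point of equality,
    where F does not exceed [F x] if c is nonnegative. *)
Lemma first_crossing x d (c a : R) : 0 < a -> 
  dotp (grad F x) d < 0 \/
    (dotp (grad F x) d <= 0 /\ qform (hess F x) d + 2 * c < 0) ->
  F x - c * a ^+ 2 <= F (x + a *: d) ->
  exists2 b, 0 < b <= a & F (x + b *: d) = F x - c * b ^+ 2.
Proof.
move=> a0 hd ha.
pose phi (t : R) := F (x + t *: d) + t ^+ 2 / 2 * (2 * c) - F x.
pose dphi (t : R) := dotp d (grad F (x + t *: d)) + t * (2 * c).
have hphi t : is_derive t (1 : R) phi (dphi t).
  have := @is_deriveB _ _ _ _ _ _ _ _ _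
    (@is_deriveD _ _ _ _ _ _ _ _ _ (has_grad_line x d t hF.1)
      (is_derive_quadratic 0 (2 * c) t)) (is_derive_cst (F x) t (1 : R)).
  congr is_derive; last by rewrite /dphi dotpC; ring.
  apply/funext => s.
  change (F (x + s *: d) + (s * 0 + s ^+ 2 / 2 * (2 * c)) - F x = phi s).
  by rewrite /phi mulr0 add0r.
have hdphi t : is_derive t (1 : R) dphi (dotp d (hess F (x + t *: d) *m d) + 2 * c).
  have := @is_deriveD _ _ _ _ _ _ _ _ _ (has_hess_line x d d t hF)
      (is_derive_quadratic (2 * c) 0 t).
  congr is_derive; last by rewrite mulr0 addr0.
  apply/funext => s; rewrite /dphi.
  change (dotp d (grad F (x + s *: d)) + (s * (2 * c) + s ^+ 2 / 2 * 0)
    = dotp d (grad F (x + s *: d)) + s * (2 * c)).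
  by rewrite mulr0 addr0.
have phi0 : phi 0 = 0 by rewrite /phi scale0r addr0 expr0n /= !mul0r addr0 subrr.
have dphi0 : dphi 0 = dotp (grad F x) d by rewrite /dphi scale0r addr0 mul0r addr0 dotpC.
have [b /andP[b0 ba] pb] : exists2 b, 0 < b < a & phi b < 0.
  case: hd => [g0|[g0 q0]].
    have h0 := hphi 0; rewrite dphi0 in h0.
    have [|b b1 hb] := is_derive_neg_near h0 g0 _ a0; first by rewrite phi0.
    by exists b => //; apply: hb; have [-> _] := andP b1; rewrite lexx.
  have h0 := hdphi 0; rewrite scale0r addr0 -/(qform _ _) in h0.
  have [|b /andP[b0 ba] hb] := is_derive_neg_near h0 q0 _ a0; first by rewrite dphi0.
  exists b; first by rewrite b0.
  have [s [/andP[s0 sb] es]] := MVT_everywhere b0 hphi.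
  move: es; rewrite phi0 !subr0 => ->; rewrite pmulr_llt0//.
  by apply: hb; rewrite s0 ltW.
have cphi : {within `[b, a], continuous phi}.
  by apply: derivable_within_continuous => y _; exact: ex_derive.
have pa : 0 <= phi a by rewrite /phi; move: ha; lra.
have [|s sab es] := @IVT _ phi b a 0 (ltW ba) cphi.
  by rewrite ge_min le_max (ltW pb) pa orbT.
exists s; move: sab; rewrite in_itv /= => /andP[bs sa].
  by rewrite sa andbT; exact: lt_le_trans bs.
by move: es; rewrite /phi; lra.
Qed.

Variables (fz L : R).
Hypothesis L_ge1 : 1 <= L.
Hypothesis lipF : forall x d a, 0 < a -> F x <= fz -> F (x + a *: d) <= fz ->
  a * l2norm d <= 1 -> forall t, 0 < t < a ->
  specnorm (hess F (x + t *: d) - hess F x) <= L * (t * l2norm d).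

Let Lp : 0 < L := lt_le_trans ltr01 L_ge1.
Let L0 : 0 <= L := ltW Lp.

Variables (epsH theta eta : R).
Hypothesis epsH01 : 0 < epsH <= 1.
Hypothesis theta01 : 0 < theta < 1.
Hypothesis eta01 : 0 < eta < 1.

Lemma rejected_SOL x d a : F x <= fz -> 0 < l2norm d ->
  epsH * l2norm d ^+ 2 <= qform (Hbar (hess F x) epsH) d ->
  dotp d (grad F x) = - qform (Hbar (hess F x) epsH) d ->
  0 < a <= 1 -> F x - eta * epsH * a ^+ 2 * l2norm d ^+ 2 <= F (x + a *: d) ->
  1 <= a * l2norm d \/ epsH <= 2 * L * a ^+ 2 * l2norm d.
Proof.
move=> Fx d0 hq hg /andP[a0 a1] hfail.
have [e0 e1] := andP epsH01; have [eta0 eta1] := andP eta01.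
have D2 : 0 < l2norm d ^+ 2 by rewrite exprn_gt0.
have Q0 : 0 < epsH * l2norm d ^+ 2 by rewrite mulr_gt0.
have [||b /andP[b0 ba] eb] := @first_crossing x d (eta * epsH * l2norm d ^+ 2) a a0.
- by left; rewrite dotpC hg; lra.
- by move: hfail; lra.
(* The Hessian is Lipschitz only on segments of length at most 1; a longer one already gives the
   first alternative. *)
have [bD|bD] := leP (b * l2norm d) 1; last first.
  by left; apply: le_trans (ltW bD) _; rewrite ler_pM2r.
right; have Fb : F (x + b *: d) <= fz.
  by rewrite eb; apply: le_trans Fx; rewrite gerBl !mulr_ge0// ?sqr_ge0// ltW.
have := taylor_upper hF b0 L0 (lipF b0 Fx Fb bD).
move: hq hg; rewrite qform_Hbar [dotp (grad F x) d]dotpC eb => hq ->.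
have hL : L * b ^+ 2 * l2norm d <= L * a ^+ 2 * l2norm d.
  by rewrite ler_pM2r// ler_wpM2l// lerXn2r ?nnegrE// ltW.
move=> ht; have b1 : b <= 1 by exact: le_trans a1.
suff : epsH / 2 <= L * b ^+ 2 * l2norm d by lra.
rewrite -(ler_pM2r (mulr_gt0 b0 D2)).
move: (qform (hess F x) d) (l2norm d) d0 D2 hq ht Q0 => q D D0 D2 hq ht Q0.
have h1 : 0 <= (q + epsH * D ^+ 2) * (b * (1 - b / 2)).
  by rewrite mulr_ge0//; [lra|rewrite mulr_ge0//; lra].
have h2 : 0 <= epsH * D ^+ 2 * (b * b) * (1 - eta).
  by rewrite !mulr_ge0//; lra.
have h3 : 0 <= epsH * D ^+ 2 * b * (1 - b).
  by rewrite !mulr_ge0//; lra.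
have -> : L * b ^+ 2 * D * (b * D ^+ 2) = L * (b * D) ^+ 3 by ring.
nra.
Qed.

Lemma rejected_NC x d a : F x <= fz -> 0 < l2norm d ->
  qform (hess F x) d = - l2norm d ^+ 3 -> dotp d (grad F x) <= 0 ->
  0 < a -> F x - eta * a ^+ 2 * l2norm d ^+ 3 / 2 <= F (x + a *: d) ->
  1 <= a * l2norm d \/ 1 - eta <= 2 * L * a.
Proof.
move=> Fx d0 hq hg a0 hfail.
have [eta0 eta1] := andP eta01.
have D3 : 0 < l2norm d ^+ 3 by rewrite exprn_gt0.
have [||b /andP[b0 ba] eb] := @first_crossing x d (eta * l2norm d ^+ 3 / 2) a a0.
- right; rewrite dotpC; split=> //; rewrite hq.
  have : eta * l2norm d ^+ 3 < l2norm d ^+ 3 by rewrite gtr_pMl.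
  lra.
- by move: hfail; lra.
have [bD|bD] := leP (b * l2norm d) 1; last first.
  by left; apply: le_trans (ltW bD) _; rewrite ler_pM2r.
right; have Fb : F (x + b *: d) <= fz.
  by rewrite eb; apply: le_trans Fx; rewrite gerBl !mulr_ge0// ?sqr_ge0// ltW.
have := taylor_upper hF b0 L0 (lipF b0 Fx Fb bD).
rewrite [dotp (grad F x) d]dotpC eb hq => ht.
apply: (@le_trans _ _ (2 * L * b)); last by rewrite ler_wpM2l// mulr_ge0.
rewrite -(ler_pM2r (mulr_gt0 (mulr_gt0 b0 b0) D3)).
have h1 : 0 <= b * - dotp d (grad F x) by rewrite mulr_ge0 ?oppr_ge0// ltW.
move: (dotp d _) (l2norm d) ht h1 => g D ht h1.
have -> : 2 * L * b * (b * b * D ^+ 3) = 2 * (L * (b * D) ^+ 3) by ring.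
lra.
Qed.

Lemma exprn_small (e : R) : 0 < e -> exists j, theta ^+ j < e.
Proof.
move=> e0; have [t0 t1] := andP theta01.
have : `|theta| < 1 by rewrite gtr0_norm.
move/cvg_expr/cvgrPdist_lt => /(_ e e0) [N _ hN].
exists N; have := hN N (leqnn N).
by rewrite /= sub0r normrN gtr0_norm// exprn_gt0.
Qed.

Lemma line_search_exists x t d : (exists j, suff_decrease F epsH theta eta x t d j) ->
  exists x', line_search F epsH theta eta x t d x'.
Proof.
move=> ex; case: (ex_minnP ex) => j sj mj; exists (x + theta ^+ j *: d), j.
split=> // i ij; apply/negP => si; have := mj i si; rewrite leqNgt ij //.
Qed.

Lemma theta_expr01 j : 0 < theta ^+ j <= 1.
Proof.
have [t0 t1] := andP theta01.
by rewrite exprn_gt0//= exprn_ile1// ltW.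
Qed.

(** What the analysis of the line search retains of a SOL output of capped CG. *)
Definition SOL_like x d := [/\ 0 < l2norm d,
  epsH * l2norm d ^+ 2 <= qform (Hbar (hess F x) epsH) d,
  dotp d (grad F x) = - qform (Hbar (hess F x) epsH) d &
  l2norm (grad F x + Hbar (hess F x) epsH *m d) <= epsH / 2 * l2norm d].

(** The common properties of the scaled negative curvature directions, whether they come from capped
    CG or from the oracle. *)
Definition NC_like x d := [/\ epsH / 2 <= l2norm d,
  qform (hess F x) d = - l2norm d ^+ 3 & dotp d (grad F x) <= 0].

Lemma rejected_SOL_j x d j : F x <= fz -> SOL_like x d ->
  ~~ suff_decrease F epsH theta eta x SOL d j ->
  1 <= theta ^+ j * l2norm d \/ epsH <= 2 * L * (theta ^+ j) ^+ 2 * l2norm d.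
Proof.
move=> Fx [d0 hq hg _] /=; rewrite -leNgt mulnC exprM => h.
exact: (rejected_SOL Fx d0 hq hg (theta_expr01 j) h).
Qed.

Lemma rejected_NC_j x d j : F x <= fz -> NC_like x d ->
  ~~ suff_decrease F epsH theta eta x NC d j ->
  1 <= theta ^+ j * l2norm d \/ 1 - eta <= 2 * L * theta ^+ j.
Proof.
move=> Fx [d0 hq hg] /=; rewrite -leNgt mulnC exprM => h.
have [t0 _] := andP (theta_expr01 j); have [e0 _] := andP epsH01.
by apply: (rejected_NC Fx _ hq hg t0 h); lra.
Qed.

Lemma line_search_SOL_exists x d : F x <= fz -> SOL_like x d ->
  exists x', line_search F epsH theta eta x SOL d x'.
Proof.
move=> Fx sd; apply: line_search_exists; apply: contrapT => ne.
have [d0 _ _ _] := sd; have [e0 e1] := andP epsH01.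
have [|j hj] := @exprn_small (Num.min (l2norm d)^-1 (epsH / (2 * L * l2norm d))).
  by rewrite lt_min invr_gt0 d0 divr_gt0// !mulr_gt0.
have [t0 t1] := andP (theta_expr01 j).
move: hj; rewrite lt_min => /andP[h1 h2].
have ns : ~~ suff_decrease F epsH theta eta x SOL d j.
  by apply/negP => sj; apply: ne; exists j.
have [|] := rejected_SOL_j Fx sd ns; apply/negP; rewrite -ltNge.
  by rewrite -ltr_pdivlMr// div1r.
move: h2; rewrite ltr_pdivlMr ?mulr_gt0//.
apply: le_lt_trans; rewrite mulrAC expr2 mulrA mulrC.
have : 0 <= 2 * L * l2norm d * theta ^+ j by rewrite !mulr_ge0// ltW.
move=> h; have -> : theta ^+ j * (2 * L * l2norm d * theta ^+ j) = 
  2 * L * l2norm d * theta ^+ j * theta ^+ j by ring.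
by rewrite [leRHS]mulrC ler_piMr.
Qed.

Lemma line_search_NC_exists x d : F x <= fz -> NC_like x d ->
  exists x', line_search F epsH theta eta x NC d x'.
Proof.
move=> Fx sd; apply: line_search_exists; apply: contrapT => ne.
have [d0 _ _] := sd; have [e0 e1] := andP epsH01.
have [eta0 eta1] := andP eta01.
have dp : 0 < l2norm d by lra.
have [|j hj] := @exprn_small (Num.min (l2norm d)^-1 ((1 - eta) / (2 * L))).
  by rewrite lt_min invr_gt0 dp divr_gt0 ?subr_gt0// mulr_gt0.
move: hj; rewrite lt_min => /andP[h1 h2].
have ns : ~~ suff_decrease F epsH theta eta x NC d j.
  by apply/negP => sj; apply: ne; exists j.
have [|] := rejected_NC_j Fx sd ns; apply/negP; rewrite -ltNge.
  by rewrite -ltr_pdivlMr// div1r.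
by rewrite mulrC -ltr_pdivlMr// mulr_gt0.
Qed.

(** Read off from a backtracked NC step. The trial before the accepted one was longer by the factor
    [1 / theta] and at least [(1 - eta) / (2 * L)], and [l2norm d ^+ 3] is at least [epsH ^+ 3 / 8];
    with the final division by 2 this makes 64. *)
Definition decrease_const := eta * theta ^+ 2 * (1 - eta) ^+ 2 / 64.

Let etath : 0 < eta * theta ^+ 2 <= eta.
Proof.
have [eta0 eta1] := andP eta01; have [t0 t1] := andP (theta_expr01 2).
by rewrite mulr_gt0//= ger_pMr.
Qed.

Lemma decrease_const_bound : 0 < decrease_const <= eta * theta ^+ 2 / 64.
Proof.
have [eta0 eta1] := andP eta01; have [e0 _] := andP etath.
have h : 0 < (1 - eta) ^+ 2 by rewrite exprn_gt0// subr_gt0.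
have h1 : (1 - eta) ^+ 2 <= 1 by rewrite expr_le1//; lra.
by rewrite /decrease_const (divr_gt0 (mulr_gt0 e0 h))//= ler_pM2r// ger_pMr.
Qed.

Let epsHL : epsH ^+ 3 / L ^+ 2 <= epsH ^+ 3 <= epsH.
Proof.
have [e0 e1] := andP epsH01; apply/andP; split.
  rewrite ler_pdivrMr; last by rewrite exprn_gt0.
  by rewrite ler_peMr ?exprn_ege1// exprn_ge0// ltW.
by rewrite exprSr ger_pMl// expr_le1// ltW.
Qed.

Lemma line_search_NC_decrease x d x' : F x <= fz -> NC_like x d ->
  line_search F epsH theta eta x NC d x' ->
  decrease_const * (epsH ^+ 3 / L ^+ 2) <= F x - F x'.
Proof.
move=> Fx nd [j [sj nj ->]]; have [d0 _ _] := nd.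
have [e0 e1] := andP epsH01; have [eta0 eta1] := andP eta01.
have [c0 c1] := andP decrease_const_bound; have [l1 l2] := andP epsHL.
have [et0 et1] := andP etath.
have L2 : 0 < L ^+ 2 by rewrite exprn_gt0.
have w0 : 0 < epsH ^+ 3 / L ^+ 2 by rewrite divr_gt0 ?exprn_gt0.
have D3 : epsH ^+ 3 / 8 <= l2norm d ^+ 3.
  have -> : epsH ^+ 3 / 8 = (epsH / 2) ^+ 3 by field.
  by rewrite lerXn2r ?nnegrE//; lra.
move: sj; rewrite /= mulnC exprM => sj.
suff : decrease_const * (epsH ^+ 3 / L ^+ 2) <=
  eta * (theta ^+ j) ^+ 2 * l2norm d ^+ 3 / 2 by lra.
(* Either the full step was accepted, or the trial with exponent j was rejected and bounds the
   accepted step from below. *)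
case: j nj {sj} => [_|j nj].
  rewrite expr0 expr1n mulr1.
  apply: (@le_trans _ _ (eta / 64 * epsH ^+ 3)); last first.
    have : eta * (epsH ^+ 3 / 8) <= eta * l2norm d ^+ 3 by rewrite ler_pM2l.
    have : 0 <= eta * epsH ^+ 3 by rewrite mulr_ge0 ?exprn_ge0// ltW.
    lra.
  by apply: ler_pM => //; lra.
have [t0 t1] := andP (theta_expr01 j).
have := rejected_NC_j Fx nd (nj j (ltnSn j)); rewrite [theta ^+ j.+1]exprS exprMn.
move: (theta ^+ j) t0 t1 => a a0 a1 [h|h].
  have aD : 1 <= (a * l2norm d) ^+ 2 by rewrite exprn_ege1.
  have : eta * theta ^+ 2 * (epsH / 2) <= eta * (theta ^+ 2 * a ^+ 2) * l2norm d ^+ 3.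
    have -> : eta * (theta ^+ 2 * a ^+ 2) * l2norm d ^+ 3 =
       eta * theta ^+ 2 * ((a * l2norm d) ^+ 2 * l2norm d) by ring.
    rewrite ler_pM2l//; apply: le_trans d0 _; rewrite ler_peMl ?l2norm_ge0//.
  have : decrease_const * (epsH ^+ 3 / L ^+ 2) <= eta * theta ^+ 2 / 64 * epsH.
    by apply: ler_pM => //; lra.
  have : 0 <= eta * theta ^+ 2 * epsH by rewrite mulr_ge0 ?ltW.
  lra.
have s0 : 0 <= 1 - eta by rewrite subr_ge0 ltW.
have La0 : 0 <= 2 * L * a by rewrite !mulr_ge0// ltW.
have : (1 - eta) ^+ 2 <= (2 * L * a) ^+ 2 by apply: lerXn2r; rewrite ?nnegrE.
rewrite !exprMn => h2.
have h3 : (1 - eta) ^+ 2 / (4 * L ^+ 2) <= a ^+ 2.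
  by rewrite ler_pdivrMr ?mulr_gt0//; lra.
have h4 : (1 - eta) ^+ 2 / (4 * L ^+ 2) * (epsH ^+ 3 / 8) <= a ^+ 2 * l2norm d ^+ 3.
  apply: ler_pM => //; first by rewrite divr_ge0 ?sqr_ge0// mulr_ge0// ltW.
  by rewrite divr_ge0// exprn_ge0// ltW.
have := ler_wpM2l (ltW et0) h4.
have -> : eta * theta ^+ 2 * ((1 - eta) ^+ 2 / (4 * L ^+ 2) * (epsH ^+ 3 / 8))
  = 2 * (decrease_const * (epsH ^+ 3 / L ^+ 2)).
  by rewrite /decrease_const; field; rewrite gt_eqF.
lra.
Qed.

Lemma line_search_SOL_decrease (epsg : R) x d x' : 0 < epsg -> F x <= fz -> SOL_like x d ->
  line_search F epsH theta eta x SOL d x' ->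
  F x' < F x /\
  (decrease_const * (Num.min (epsg ^+ 2 / epsH) (epsH ^+ 3) / L ^+ 2) <= F x - F x'
   \/ l2norm (grad F x') <= epsg).
Proof.
move=> eg0 Fx sd [j [sj nj ->]]; have [d0 hq hg hr] := sd.
have [e0 e1] := andP epsH01; have [eta0 eta1] := andP eta01.
have [c0 c1] := andP decrease_const_bound; have [l1 l2] := andP epsHL.
have [et0 et1] := andP etath.
have L2 : 0 < L ^+ 2 by rewrite exprn_gt0.
have L21 : 1 <= L ^+ 2 by rewrite exprn_ege1.
set w := Num.min _ _.
have w1 : w <= epsg ^+ 2 / epsH by rewrite ge_min lexx.
have w2 : w <= epsH ^+ 3 by rewrite ge_min lexx orbT.
have w0 : 0 < w by rewrite lt_min divr_gt0 ?exprn_gt0.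
have wL : w / L ^+ 2 <= w by rewrite ler_pdivrMr// ler_peMr// ltW.
have w0L : 0 < w / L ^+ 2 by rewrite divr_gt0.
move: sj; rewrite /= mulnC exprM => sj.
have dec0 : 0 <= eta * epsH * (theta ^+ j) ^+ 2 * l2norm d ^+ 2.
  by have [tj0 _] := andP (theta_expr01 j); rewrite !mulr_ge0// ltW.
split; first by lra.
suff : decrease_const * (w / L ^+ 2) <= eta * epsH * (theta ^+ j) ^+ 2 * l2norm d ^+ 2
   \/ l2norm (grad F (x + theta ^+ j *: d)) <= epsg.
  by case=> h; [left|right] => //; lra.
have small : decrease_const * (w / L ^+ 2) <= eta * theta ^+ 2 / 64 * epsH.
  by apply: ler_pM => //; lra.
have etaepsH : 0 <= eta * theta ^+ 2 * epsH by rewrite mulr_ge0 ?ltW.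
case: j nj sj dec0 => [_ sj _|j nj _ _].
  move: sj; rewrite expr0 expr1n mulr1 scale1r => sj.
  have [D1|D1] := leP 1 (l2norm d).
    left; have D2 : 1 <= l2norm d ^+ 2 by rewrite exprn_ege1.
    have : eta * epsH <= eta * epsH * l2norm d ^+ 2 by rewrite ler_peMr// mulr_ge0// ltW.
    have : eta * theta ^+ 2 * epsH <= eta * epsH by rewrite ler_pM2r.
    lra.
  have Fd : F (x + d) <= fz.
    have h0 : 0 <= eta * epsH * l2norm d ^+ 2 by rewrite !mulr_ge0// ltW.
    lra.
  have lip1 : forall t, 0 < t < 1 ->
      specnorm (hess F (x + t *: d) - hess F x) <= L * (t * l2norm d).
    by apply: lipF => //; rewrite ?scale1r// mul1r ltW.
  have gt := grad_taylor hF L0 lip1.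
  (* The three contributions are the Taylor error, the CG residual (at most [epsH / 2 * l2norm d])
     and the damping [2 * epsH]; the sum 5/2 is rounded up to 3. *)
  have gle : l2norm (grad F (x + d)) <= L * l2norm d ^+ 2 + 3 * epsH * l2norm d.
    have -> : grad F (x + d) = (grad F (x + d) - grad F x - hess F x *m d)
        + (grad F x + Hbar (hess F x) epsH *m d) - (2 * epsH) *: d.
      rewrite /Hbar mulmxDl mul_scalar_mx; apply/matrixP => i k; rewrite !mxE; ring.
    apply: le_trans (l2normB _ _) _; rewrite l2normZ gtr0_norm ?mulr_gt0//.
    have := l2normD (grad F (x + d) - grad F x - hess F x *m d)
       (grad F x + Hbar (hess F x) epsH *m d).
    have : 0 <= epsH * l2norm d by rewrite mulr_ge0 ?ltW.
    lra.
  have [gs|gs] := leP (l2norm (grad F (x + d))) epsg; [by right|left].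
  move: (l2norm d) d0 D1 gle => D D0 D1 gle.
  (* The product of the two entries of the minimum is [(epsg * epsH) ^+ 2], so the smaller one is at
     most the square root. *)
  have w3 : w <= epsH * epsg.
    have [h|h] := leP (epsH ^+ 2) epsg.
      by apply: le_trans w2 _; rewrite exprS ler_pM2l.
    apply: le_trans w1 _; rewrite ler_pdivrMr//.
    have -> : epsg ^+ 2 = epsg * epsg by rewrite expr2.
    have -> : epsH * epsg * epsH = epsg * epsH ^+ 2 by ring.
    by rewrite ler_pM2l// ltW.
  have [h|h] : epsg <= 6 * epsH * D \/ epsg <= 2 * L * D ^+ 2.
    have [h|h] := leP epsg (6 * epsH * D); [by left|right; lra].
    have h2 : epsg ^+ 2 <= (6 * epsH * D) ^+ 2.
      by apply: lerXn2r => //; rewrite nnegrE; [exact: ltW | rewrite !mulr_ge0// ltW].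
    have h3 : epsg ^+ 2 / epsH <= 36 * epsH * D ^+ 2.
      rewrite ler_pdivrMr//; apply: le_trans h2 _.
      by rewrite le_eqVlt; apply/orP; left; apply/eqP; ring.
    have : decrease_const * (w / L ^+ 2) <= eta / 64 * (36 * epsH * D ^+ 2).
      by apply: ler_pM; lra.
    have : 0 <= eta * epsH * D ^+ 2 by rewrite !mulr_ge0// ltW.
    lra.
  have h3 : w / L ^+ 2 <= epsH * (2 * D ^+ 2).
    rewrite ler_pdivrMr//; apply: le_trans w3 _.
    rewrite -mulrA ler_pM2l//; apply: le_trans h _.
    have : 2 * D ^+ 2 * L <= 2 * D ^+ 2 * L ^+ 2.
      by apply: ler_wpM2l; [rewrite mulr_ge0// sqr_ge0 | rewrite expr2 ler_peMr].
    lra.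
  have : decrease_const * (w / L ^+ 2) <= eta / 64 * (epsH * (2 * D ^+ 2)).
    by apply: ler_pM; lra.
  have : 0 <= eta * epsH * D ^+ 2 by rewrite !mulr_ge0// ltW.
  lra.
left; have [t0 t1] := andP (theta_expr01 j).
have := rejected_SOL_j Fx sd (nj j (ltnSn j)); rewrite [theta ^+ j.+1]exprS exprMn.
move: (theta ^+ j) t0 t1 => a a0 a1 [h|h].
  have aD : 1 <= (a * l2norm d) ^+ 2 by rewrite exprn_ege1.
  have -> : eta * epsH * (theta ^+ 2 * a ^+ 2) * l2norm d ^+ 2 =
       eta * theta ^+ 2 * epsH * (a * l2norm d) ^+ 2 by ring.
  have : eta * theta ^+ 2 * epsH <= eta * theta ^+ 2 * epsH * (a * l2norm d) ^+ 2.
    by rewrite ler_peMr.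
  lra.
have L20 : 0 < 2 * L by rewrite mulr_gt0.
have Dlow : epsH / (2 * L) <= l2norm d.
  rewrite ler_pdivrMr//; apply: le_trans h _.
  rewrite mulrAC mulrC [leRHS]mulrC ler_piMl ?expr_le1 ?(ltW a0)//.
  by rewrite mulr_ge0// ltW.
have aDlow : epsH / (2 * L) <= a ^+ 2 * l2norm d.
  by rewrite ler_pdivrMr//; lra.
have h2 : epsH / (2 * L) * (epsH / (2 * L)) <= a ^+ 2 * l2norm d * l2norm d.
  by apply: ler_pM => //; rewrite divr_ge0// ltW.
have h3 : w / L ^+ 2 <= epsH * (4 * (a ^+ 2 * l2norm d * l2norm d)).
  rewrite ler_pdivrMr//; apply: le_trans w2 _.
  have := ler_wpM2l (ltW e0) h2.
  rewrite -(ler_pM2r (mulr_gt0 (ltr0Sn _ 3) L2)).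
  have -> : epsH * (epsH / (2 * L) * (epsH / (2 * L))) * (4%:R * L ^+ 2) = epsH ^+ 3.
    by field; rewrite gt_eqF.
  lra.
have h4 : decrease_const * (w / L ^+ 2) <=
    eta * theta ^+ 2 / 64 * (epsH * (4 * (a ^+ 2 * l2norm d * l2norm d))).
  by apply: ler_pM => //; lra.
have : 0 <= eta * epsH * (theta ^+ 2 * a ^+ 2) * l2norm d ^+ 2.
  by have [th0 _] := andP theta01; rewrite !mulr_ge0// ltW.
lra.
Qed.

End DescentStep.

Lemma lanczos_N_gt0 {R : realType} n (H : 'M[R]_n) (eps delta : R) :
  (0 < n)%N -> (0 < lanczos_N H eps delta)%N.
Proof. by move=> n0; rewrite /lanczos_N leq_min n0. Qed.

Lemma min_eig_oracle_exists {R : realType} n (H : 'M[R]_n) (eps delta : R)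
    (q : 'cV[R]_n) : l2norm q = 1 ->
  exists o k, min_eig_oracle H eps delta q o k.
Proof.
move=> q1; have q0 : q != 0 by rewrite -l2norm_eq0 q1 oner_eq0.
have n0 : (0 < n)%N.
  case: n H q q1 q0 => // H q _ /eqP[]; apply/matrixP; case=> //.
pose stop k := (exists v, lanczos_found H eps q k v) \/
  (k = lanczos_N H eps delta \/ lanczos_vec H q k = 0).
have ex : exists k, (0 < k)%N && `[< stop k >].
  exists (lanczos_N H eps delta); rewrite lanczos_N_gt0//=.
  by apply/asboolP; right; left.
case: (ex_minnP ex) => k /andP[k0 /asboolP sk] mk.
have nstop l : (0 < l < k)%N -> ~ stop l.
  move=> /andP[l0 lk] sl; have := mk l; rewrite l0 => /(_ _)/wrap[]; first exact/asboolP.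
  by rewrite leqNgt lk.
have rk : lanczos_reached H eps delta q k.
  split.
  - rewrite k0 /=; apply: mk; rewrite lanczos_N_gt0//=.
    by apply/asboolP; right; left.
  - case: k k0 sk mk nstop => // -[|k] _ _ _ ns //=.
    by apply/eqP => e; apply: (ns k.+1); [rewrite /= ltnS leqnn | right; right].
  - by move=> l v lk fl; apply: (nstop l lk); left; exists v.
have [[v fv]|nf] := pselect (exists v, lanczos_found H eps q k v).
  by exists (Some v), k; exact: Oracle_found.
exists None, k; apply: Oracle_certify => //.
  by move=> v fv; apply: nf; exists v.
by case: sk.
Qed.

Section NewtonIteration.
Context {R : realType} {n : nat}.
Variable F : 'cV[R]_n -> R.
Hypothesis hF : has_hess F (grad F) (hess F).
Hypothesis symF : forall x, (hess F x)^T = hess F x.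
Implicit Types (x d : 'cV[R]_n).
Variables (fz L : R).
Hypothesis L_ge1 : 1 <= L.
Hypothesis lipF : forall x d a, 0 < a -> F x <= fz -> F (x + a *: d) <= fz ->
  a * l2norm d <= 1 -> forall t, 0 < t < a ->
  specnorm (hess F (x + t *: d) - hess F x) <= L * (t * l2norm d).
Variables (epsg epsH theta zeta eta delta : R).
Hypothesis epsg_gt0 : 0 < epsg.
Hypothesis epsH01 : 0 < epsH <= 1.
Hypothesis theta01 : 0 < theta < 1.
Hypothesis zeta01 : 0 < zeta < 1.
Hypothesis eta01 : 0 < eta < 1.

Let epsH_gt0 : 0 < epsH. Proof. by case/andP: epsH01. Qed.

(** The scaled direction has as its length the absolute value of the Rayleigh quotient, which makes
    its quadratic form minus the cube of its length. *)
Lemma NC_like_scale x d : 0 < l2norm d ->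
  qform (hess F x) d <= - epsH / 2 * l2norm d ^+ 2 ->
  NC_like F epsH x
    (- (sgn (dotp d (grad F x)) * (`|qform (hess F x) d| / l2norm d ^+ 3)) *: d).
Proof.
move=> d0 hq; have e0 := epsH_gt0.
have D2 : 0 < l2norm d ^+ 2 by rewrite exprn_gt0.
have D3 : 0 < l2norm d ^+ 3 by rewrite exprn_gt0.
have eD : 0 < epsH * l2norm d ^+ 2 by rewrite mulr_gt0.
have q0 : qform (hess F x) d < 0 by lra.
have sgn2 (s : R) : sgn s ^+ 2 = 1 by rewrite /sgn; case: ifP => _; rewrite ?sqrrN expr1n.
have nsgn (s : R) : `|sgn s| = 1 by rewrite /sgn; case: ifP => _; rewrite ?normrN normr1.
have sgns (s : R) : 0 <= sgn s * s.
  by rewrite /sgn; have [h|h] := leP 0 s; [rewrite mul1r | rewrite mulN1r oppr_ge0 ltW].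
have nv : l2norm (- (sgn (dotp d (grad F x)) * (`|qform (hess F x) d| / l2norm d ^+ 3)) *: d)
   = - qform (hess F x) d / l2norm d ^+ 2.
  rewrite l2normZ normrN !normrM nsgn mul1r normfV normr_id (gtr0_norm D3) ltr0_norm//.
  by field; rewrite gt_eqF.
split.
- by rewrite nv ler_pdivlMr//; lra.
- rewrite nv qformZ sqrrN exprMn sgn2 mul1r ltr0_norm//.
  by field; rewrite gt_eqF.
- rewrite dotpZl mulNr oppr_le0 mulrAC mulr_ge0 ?sgns// divr_ge0// ltW//.
Qed.

Lemma cg_direction_SOL_like x d k : epsg < l2norm (grad F x) ->
  capped_cg (hess F x) (grad F x) epsH zeta 0 SOL d k ->
  SOL_like F epsH x d.
Proof.
move=> hg h; have g0 : grad F x != 0 by rewrite -l2norm_gt0; exact: lt_trans hg.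
exact: (capped_cg_SOL (symF x) epsH_gt0 zeta01 g0 h).
Qed.

Lemma cg_direction_NC_like x d k : epsg < l2norm (grad F x) ->
  capped_cg (hess F x) (grad F x) epsH zeta 0 NC d k ->
  NC_like F epsH x (cg_direction F x NC d).
Proof.
move=> hg /capped_cg_NC lc; have e0 := epsH_gt0.
have d0 := lowcurv_neq0 lc.
apply: NC_like_scale; first by rewrite l2norm_gt0.
move: lc; rewrite /lowcurv qform_Hbar => lc.
have : 0 <= epsH * l2norm d ^+ 2 by rewrite mulr_ge0 ?sqr_ge0// ltW.
lra.
Qed.

Lemma eig_direction_NC_like x q v k :
  min_eig_oracle (hess F x) epsH delta q (Some v) k ->
  NC_like F epsH x (eig_direction F x v).
Proof.
move=> h; inversion h as [? ? _ [_ v1 hv]|]; subst.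
have := @NC_like_scale x v; rewrite /eig_direction v1 !expr1n mulr1 divr1.
exact.
Qed.

Lemma newton_cg_iter_exists x q : F x <= fz -> l2norm q = 1 ->
  exists o k, newton_cg_iter F epsg epsH theta zeta eta delta q x o k.
Proof.
move=> Fx q1; have [hg|hg] := ltP epsg (l2norm (grad F x)).
  have g0 : grad F x != 0 by rewrite -l2norm_gt0; exact: lt_trans hg.
  have [t [d [k h]]] := capped_cg_exists (symF x) epsH_gt0 zeta01 g0.
  suff [x' hx'] : exists x', line_search F epsH theta eta x t (cg_direction F x t d) x'.
    by do 2 eexists; exact: Newton_cg hg h hx'.
  case: t h => h.
    apply: (line_search_SOL_exists hF L_ge1 lipF epsH01 theta01 eta01 Fx).
    exact: cg_direction_SOL_like h.
  apply: (line_search_NC_exists hF L_ge1 lipF epsH01 theta01 eta01 Fx).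
  exact: cg_direction_NC_like h.
have [[v|] [k h]] := min_eig_oracle_exists (hess F x) epsH delta q1; last first.
  by do 2 eexists; exact: Newton_stop hg h.
have [x' hx'] := line_search_NC_exists hF L_ge1 lipF epsH01 theta01 eta01 Fx
  (eig_direction_NC_like h).
by do 2 eexists; exact: Newton_eig hg h hx'.
Qed.

Definition newton_decrease : R :=
  decrease_const theta eta * (Num.min (epsg ^+ 2 / epsH) (epsH ^+ 3) / L ^+ 2).

Lemma newton_decrease_gt0 : 0 < newton_decrease.
Proof.
have [c0 _] := andP (decrease_const_bound theta01 eta01).
apply: mulr_gt0 => //; apply: divr_gt0.
  by rewrite lt_min divr_gt0 ?exprn_gt0.
by rewrite exprn_gt0// (lt_le_trans _ L_ge1).
Qed.

Lemma newton_decrease_le : newton_decrease <=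
  decrease_const theta eta * (epsH ^+ 3 / L ^+ 2).
Proof.
have [c0 _] := andP (decrease_const_bound theta01 eta01).
rewrite ler_pM2l// ler_pM2r ?invr_gt0 ?exprn_gt0//; last exact: lt_le_trans L_ge1.
by rewrite ge_min lexx orbT.
Qed.

(* A full SOL step may decrease F by too little, but then it reaches a small
   gradient, so the next iteration calls the oracle. *)
Lemma newton_cg_iter_progress q x x' k : F x <= fz ->
  newton_cg_iter F epsg epsH theta zeta eta delta q x (Some x') k ->
  F x' < F x /\ (newton_decrease <= F x - F x' \/
    (epsg < l2norm (grad F x) /\ l2norm (grad F x') <= epsg)).
Proof.
move=> Fx h; have n0 := newton_decrease_gt0; have nle := newton_decrease_le.
inversion h as [t d k' y hg hcg hls|v k' y hg ho hls|]; subst.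
  case: t hcg hls {h} => hcg hls.
    have [lt [h1|h1]] := line_search_SOL_decrease hF L_ge1 lipF epsH01 theta01 eta01
      epsg_gt0 Fx (cg_direction_SOL_like hg hcg) hls; split=> //; first by left.
    by right.
  have := line_search_NC_decrease hF L_ge1 lipF epsH01 theta01 eta01
      Fx (cg_direction_NC_like hg hcg) hls.
  by move=> h1; split; [lra | left; lra].
have := line_search_NC_decrease hF L_ge1 lipF epsH01 theta01 eta01
      Fx (eig_direction_NC_like ho) hls.
by move=> h1; split; [lra | left; lra].
Qed.

(* The second summand pays for the SOL steps that decrease F by less than D. *)
Definition newton_potential (D : R) x : R :=
  2 * (fz - F x) / D + (l2norm (grad F x) <= epsg)%R%:R.

(** A decrease by D adds 2 to the first summand and costs at most 1 in the second. A step without it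
    switches the second summand from 0 to 1. *)
Lemma newton_potential_incr (D : R) q x x' k : 0 < D <= newton_decrease -> F x <= fz ->
  newton_cg_iter F epsg epsH theta zeta eta delta q x (Some x') k ->
  newton_potential D x + 1 <= newton_potential D x'.
Proof.
move=> /andP[D0 Dn] Fx h; rewrite /newton_potential.
have [lt [h1|[h1 h2]]] := newton_cg_iter_progress Fx h.
  have : 2 * (fz - F x) / D + 2 <= 2 * (fz - F x') / D.
    rewrite -lerBrDl -mulrBl ler_pdivlMr//; lra.
  case: (_ <= epsg)%R => /=; case: (_ <= epsg)%R => /=; lra.
rewrite h2 [l2norm (grad F x) <= _]leNgt h1 /= addr0 lerD2r ler_pM2r ?invr_gt0//; lra.
Qed.

End NewtonIteration.

Lemma newton_cg_iter_cost {R : realType} n (F : 'cV[R]_n -> R)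
    (epsg epsH theta zeta eta delta : R) q x o k :
  (forall x, (hess F x)^T = hess F x) -> 0 < epsg -> 0 < epsH -> 0 < zeta < 1 ->
  newton_cg_iter F epsg epsH theta zeta eta delta q x o k ->
  (k <= lanczos_N (hess F x) epsH delta + 1)%N \/
  exists j : nat, [/\ (k <= 3 * j.+1)%N, (j <= n)%N &
    j%:R <= 1 + 4 * Num.sqrt (cg_kappa epsH (specnorm (hess F x)))
              * ln (24 * cg_kappa epsH (specnorm (hess F x)) ^+ 4 / zeta)].
Proof.
move=> symF epsg_gt0 epsH_gt0 zeta01.
have orc o' k' : min_eig_oracle (hess F x) epsH delta q o' k' ->
    (k' <= lanczos_N (hess F x) epsH delta)%N.
  by move=> h; inversion h as [k1 v1 rk fk|k1 rk fk ek]; subst; case: rk => /andP[].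
move=> h; inversion h as [t d k' y hg hcg hls|v k' y hg ho hls|k' hg ho]; subst.
- right; have g0 : grad F x != 0 by rewrite -l2norm_gt0; exact: lt_trans hg.
  have [j [kj jn jb]] := capped_cg_cost (symF x) epsH_gt0 zeta01 g0 hcg.
  exists j; split=> //; case: t {hcg hls h}; lia.
- by left; rewrite leq_add2r; exact: orc ho.
- by left; rewrite addn1 leqW// (orc _ _ ho).
Qed.

(** * The augmented Lagrangian *)

Lemma value_lipschitz_segment {R : realType} n (F : 'cV[R]_n -> R) G x d (M : R) :
  has_grad F G -> (forall t, 0 < t < 1 -> l2norm (G (x + t *: d)) <= M) ->
  `|F (x + d) - F x| <= M * l2norm d.
Proof.
move=> hF hM; have [t [t01]] := MVT_everywhere ltr01 (fun t => has_grad_line x d t hF).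
rewrite scale0r scale1r addr0 subr0 mulr1 => ->.
apply: le_trans (CauchySchwarz _ _) _.
by rewrite ler_wpM2r ?l2norm_ge0// hM.
Qed.

Lemma affine_has_hess {R : realType} n m (c : 'cV[R]_n -> 'cV[R]_m) (A : 'M[R]_(m, n)) b i :
  (forall x, c x = A *m x + b) ->
  has_hess (coordf c i) (fun=> (row i A)^T) (fun=> 0).
Proof.
move=> cE; split; last first.
  move=> j; have := @has_grad_cst R n ((row i A)^T j 0); congr (has_grad _ _).
  by apply/funext => a; apply/matrixP => k l; rewrite !mxE.
have lin j : has_grad (fun x : 'cV[R]_n => x j 0) (fun=> delta_mx j 0).
  move=> a v; rewrite dotp_delta; apply: DeriveDef.
    by apply: (derivable_mxP _ _ _).1.
  have := @derive_mx _ _ n 1 id a v (@derivable_id _ _ _ _).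
  rewrite (@derive_val _ _ _ _ _ _ _ (is_derive_id a v)) => /matrixP/(_ j 0).
  by rewrite mxE => <-.
move=> a v.
have -> : coordf c i = (\sum_(j < n) (A i j \*: (fun x : 'cV[R]_n => x j 0))) + cst (b i 0).
  by apply/funext => x; rewrite /coordf cE !mxE [in RHS]/GRing.add /= fct_sumE.
have -> : dotp (row i A)^T v = \sum_(j < n) A i j *: v j 0 + 0.
  by rewrite addr0 dotpE; apply: eq_bigr => j _; rewrite !mxE.
apply: is_deriveD; apply: is_derive_sum => j; apply: is_deriveZ.
by have := lin j a v; rewrite dotp_delta.
Qed.

(** A discrete product rule: each term on the right has exactly one factor that is a difference
    between the two points. *)
Lemma weighted_hess_diff {R : realType} n (Hy Hx : 'M[R]_n) (gy gx : 'cV[R]_n)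
    (ly lx s rho : R) : ly - lx = rho * s ->
  ly *: Hy + rho *: (gy *m gy^T) - (lx *: Hx + rho *: (gx *m gx^T)) =
  (ly *: (Hy - Hx) + (rho * s) *: Hx)
    + rho *: (gy *m (gy - gx)^T + (gy - gx) *m gx^T).
Proof.
move=> <-; apply/matrixP => k l; rewrite !mxE !big_ord1 !mxE; ring.
Qed.

Section AugLag.
Context {R : realType} {n m : nat}.
Variables (f : 'cV[R]_n -> R) (c : 'cV[R]_n -> 'cV[R]_m) (z : 'cV[R]_n).
Hypothesis C2f : C2 f.
Hypothesis C2c : forall i, C2 (coordf c i).
Implicit Types (lam : 'cV[R]_m) (rho : R) (x : 'cV[R]_n).

Local Notation ct := (ctilde c z).
Local Notation mult lam rho x := (lam + rho *: ct x).

Definition auglag_hess lam rho x : 'M[R]_n := hess f x +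
  \sum_i (mult lam rho x i 0 *: hess (coordf c i) x
          + rho *: (grad (coordf c i) x *m (grad (coordf c i) x)^T)).

Lemma auglag_has_hess lam rho : has_hess (auglag f c z lam rho)
  (fun x => grad f x + gradc c x *m mult lam rho x) (auglag_hess lam rho).
Proof.
pose g i x := coordf c i x + - c z i 0.
have hg i : has_hess (g i) (fun x => grad (coordf c i) x + 0) (fun x => hess (coordf c i) x + 0).
  exact: has_hessD (C2_has_hess (C2c i)) (has_hess_cst _).
have hh i := has_hessD (has_hessZ (lam i 0) (hg i)) (has_hessZ (rho / 2) (has_hessM (hg i) (hg i))).
have := has_hessD (C2_has_hess C2f) (has_hess_sum (index_enum 'I_m) hh).
congr (has_hess _ _ _); apply/funext => x.
- rewrite /auglag -addrA; congr (_ + _).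
  rewrite big_split /= -!mulr_sumr dotpE sqr_l2norm dotpE; congr (_ + _).
    by apply: eq_bigr => i _; rewrite !mxE.
  rewrite mulrAC; congr (_ * _ / _).
  by apply: eq_bigr => i _; rewrite !mxE.
- congr (_ + _); apply/matrixP => k l; rewrite ord1 summxE mxE; apply: eq_bigr => i _.
  rewrite !mxE /g /coordf; by field.
- congr (_ + _); apply: eq_bigr => i _; apply/matrixP => k l.
  rewrite !mxE /g /coordf !big_ord1 !mxE; by field.
Qed.

Lemma auglag_grad lam rho x :
  grad (auglag f c z lam rho) x = grad f x + gradc c x *m mult lam rho x.
Proof. by have [h _] := auglag_has_hess lam rho; rewrite (has_gradE h). Qed.

Lemma auglag_hessE lam rho x : hess (auglag f c z lam rho) x = auglag_hess lam rho x.
Proof. by rewrite (has_hessE (auglag_has_hess lam rho)). Qed.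

Lemma auglag_has_grad_hess lam rho : has_hess (auglag f c z lam rho)
  (grad (auglag f c z lam rho)) (hess (auglag f c z lam rho)).
Proof.
have h := auglag_has_hess lam rho.
by rewrite (has_hessE h) (has_gradE h.1).
Qed.

Lemma auglag_hess_sym lam rho x :
  (hess (auglag f c z lam rho) x)^T = hess (auglag f c z lam rho) x.
Proof.
rewrite auglag_hessE /auglag_hess linearD /= (hess_sym C2f) linear_sum /=.
congr (_ + _); apply: eq_bigr => i _.
by rewrite linearD !linearZ /= (hess_sym (C2c i)) trmx_mul trmxK.
Qed.

Section LevelSet.
Variables (Lam rho0 fhi flow gamma eps1 : R).
Hypothesis gamma_gt0 : 0 < gamma.
Hypothesis rho0_gt : 2 * gamma < rho0.
Hypothesis flow_le : forall x, flow <= f x + gamma * l2norm (c x) ^+ 2 / 2.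
Hypothesis eps1_01 : 0 < eps1 < 1.
Hypothesis cz_le : l2norm (c z) <= eps1 / 2.
Hypothesis fz_le : f z <= fhi.

Lemma auglag_lower lam rho x : l2norm lam <= Lam -> rho0 <= rho ->
  flow - gamma + (rho0 - 2 * gamma) / 2 * l2norm (ct x) ^+ 2 - Lam * l2norm (ct x)
    <= auglag f c z lam rho x.
Proof.
move=> hl hr; have [e0 e1] := andP eps1_01.
have cx : l2norm (c x) <= l2norm (ct x) + 1 / 2.
  have -> : c x = ct x + c z by rewrite /ctilde subrK.
  apply: le_trans (l2normD _ _) _; rewrite lerD2l; move: cz_le; lra.
have hf := flow_le x.
have D0 := l2norm_ge0 (ct x); have N0 := l2norm_ge0 (c x).
have hd := dotp_ge lam (ct x).
have h1 : l2norm lam * l2norm (ct x) <= Lam * l2norm (ct x) by rewrite ler_wpM2r.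
rewrite /auglag; move: cx hf hd h1 D0 N0 gamma_gt0.
move: (l2norm (c x)) (l2norm (ct x)) => N D cx hf hd h1 D0 N0 g0.
have h2 : N ^+ 2 <= (D + 1 / 2) ^+ 2 by rewrite lerXn2r ?nnegrE//; lra.
(* Halved, this is where the summand gamma and the shift [rho0 - 2 * gamma] in [delta_c1] come
   from. *)
have h3 : gamma * N ^+ 2 <= gamma * (2 * D ^+ 2 + 2).
  by rewrite ler_pM2l//; nra.
have h4 : rho0 * D ^+ 2 <= rho * D ^+ 2 by rewrite ler_wpM2r ?sqr_ge0.
lra.
Qed.

Lemma auglag_bounded_below lam rho x : l2norm lam <= Lam -> rho0 <= rho ->
  flow - gamma - Lam ^+ 2 / (2 * (rho0 - 2 * gamma)) <= auglag f c z lam rho x.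
Proof.
move=> hl hr; apply: le_trans (auglag_lower x hl hr).
have s0 : 0 < rho0 - 2 * gamma by rewrite subr_gt0.
move: (rho0 - 2 * gamma) (l2norm (ct x)) s0 => s D s0.
rewrite -!addrA 2!lerD2l.
have -> : s / 2 * D ^+ 2 - Lam * D = s / 2 * (D - Lam / s) ^+ 2 - Lam ^+ 2 / (2 * s).
  by field; rewrite gt_eqF.
by rewrite lerDr mulr_ge0 ?sqr_ge0// divr_ge0// ltW.
Qed.

(** [auglag_lower] is a quadratic inequality for [l2norm (ct x)]; completing the square solves
    it. *)
Lemma level_set_ctilde lam rho x : l2norm lam <= Lam -> rho0 <= rho ->
  auglag f c z lam rho x <= f z ->
  l2norm (ct x) <= Num.sqrt (2 * (fhi - flow + gamma) / (rho0 - 2 * gamma)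
            + Lam ^+ 2 / (rho0 - 2 * gamma) ^+ 2) + Lam / (rho0 - 2 * gamma).
Proof.
move=> hl hr hx; have := auglag_lower x hl hr.
have s0 : 0 < rho0 - 2 * gamma by rewrite subr_gt0.
move: (rho0 - 2 * gamma) (l2norm (ct x)) s0 => s D s0 h.
rewrite -lerBlDr; apply: le_trans (ler_norm _) _; rewrite -sqrtr_sqr ler_wsqrtr//.
have -> : 2 * (fhi - flow + gamma) / s + Lam ^+ 2 / s ^+ 2 =
   (2 * s * (fhi - flow + gamma) + Lam ^+ 2) / s ^+ 2.
  by field; rewrite gt_eqF.
have -> : D - Lam / s = (s * D - Lam) / s by field; rewrite gt_eqF.
rewrite expr_div_n ler_pM2r ?invr_gt0 ?exprn_gt0//.
have h1 : s / 2 * D ^+ 2 - Lam * D <= fhi - flow + gamma by move: fz_le; lra.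
have := ler_wpM2l (ltW s0) h1; nra.
Qed.

Lemma level_set_Sset lam rho x deltaf deltac : l2norm lam <= Lam -> rho0 <= rho ->
  Lam ^+ 2 / (2 * rho0) <= deltaf ->
  Num.sqrt (2 * (fhi - flow + gamma) / (rho0 - 2 * gamma)
            + Lam ^+ 2 / (rho0 - 2 * gamma) ^+ 2) + Lam / (rho0 - 2 * gamma) <= deltac ->
  auglag f c z lam rho x <= f z ->
  Sset f c fhi deltaf deltac x /\ l2norm (ct x) <= deltac.
Proof.
move=> hl hr hf hc hx; have ctx := le_trans (level_set_ctilde hl hr hx) hc.
have [e0 e1] := andP eps1_01.
split=> //; split; last first.
  have -> : c x = ct x + c z by rewrite /ctilde subrK.
  apply: le_trans (l2normD _ _) _; move: cz_le; lra.
have r0 : 0 < rho0 by move: gamma_gt0 rho0_gt; lra.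
have hd := dotp_ge lam (ct x).
have D0 := l2norm_ge0 (ct x).
have h1 : l2norm lam * l2norm (ct x) <= Lam * l2norm (ct x) by rewrite ler_wpM2r.
have h4 : rho0 * l2norm (ct x) ^+ 2 <= rho * l2norm (ct x) ^+ 2 by rewrite ler_wpM2r ?sqr_ge0.
have h5 : - (Lam ^+ 2 / (2 * rho0)) <= rho0 / 2 * l2norm (ct x) ^+ 2 - Lam * l2norm (ct x).
  have -> : rho0 / 2 * l2norm (ct x) ^+ 2 - Lam * l2norm (ct x) =
      rho0 / 2 * (l2norm (ct x) - Lam / rho0) ^+ 2 - Lam ^+ 2 / (2 * rho0).
    by field; rewrite gt_eqF.
  by rewrite lerDr mulr_ge0 ?sqr_ge0// divr_ge0// ltW.
move: hx fz_le; rewrite /auglag; lra.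
Qed.

End LevelSet.

Section Constants.
Variables (S Omega : set 'cV[R]_n) (M : R).
Hypothesis hM : problem_constant f c S Omega M.
Hypothesis segOmega : segments S `<=` Omega.

Lemma segment_sub x d a t : 0 < a -> S x -> S (x + a *: d) -> 0 <= t <= a ->
  segments S (x + t *: d).
Proof.
move=> a0 Sx Sy /andP[t0 ta]; exists x, (x + a *: d), (t / a); split=> //.
  by rewrite divr_ge0 ?(ltW a0)//= ler_pdivrMr// mul1r.
by rewrite [x + a *: d]addrC addrK scalerA divfK// gt_eqF.
Qed.

Lemma segment_self x : S x -> segments S x.
Proof. by move=> Sx; exists x, x, 0; rewrite lexx ler01 scale0r addr0. Qed.

(** Where the gradient of the augmented Lagrangian is at most 1, [gradc c x] maps the multiplier
    estimate to a vector of length at most [1 + M]. GLICQ inverts this, and [rho *: ct x] is the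
    estimate minus lam. *)
Lemma multiplier_bound lam rho x : S x -> 0 <= rho ->
  l2norm (grad (auglag f c z lam rho) x) <= 1 ->
  rho * l2norm (ct x) <= M * (1 + M) + l2norm lam.
Proof.
have [M0 hf _ _ hs] := hM => Sx r0; rewrite auglag_grad => hg.
have [gf _] := hf x (segment_self Sx).
have : l2norm (mult lam rho x) <= M * (1 + M).
  apply: le_trans (hs x _ Sx) _; rewrite ler_pM2l//.
  have -> : gradc c x *m mult lam rho x =
     (grad f x + gradc c x *m mult lam rho x) - grad f x by rewrite [X in _ = X - _]addrC addrK.
  by apply: le_trans (l2normB _ _) _; exact: lerD.
have -> : rho * l2norm (ct x) = l2norm (mult lam rho x - lam).
  by rewrite [lam + _]addrC addrK l2normZ ger0_norm.
by move=> h; apply: le_trans (l2normB _ _) _; rewrite lerD2r.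
Qed.

(** Bounds both the Hessian and its Lipschitz constant. Of the 4M, one M is the growth of [ct] along
    a short segment, one the change of the multipliers, and two come from the outer products. The
    leading 1 keeps the constant at least 1. *)
Definition lipschitz_const Lam deltac rho : R :=
  1 + M + m%:R * (M * (Lam + rho * (deltac + 4 * M))).

Variables (Lam deltac : R).

Lemma auglag_hess_bound lam rho x : S x -> 0 <= rho -> l2norm lam <= Lam ->
  l2norm (ct x) <= deltac ->
  specnorm (hess (auglag f c z lam rho) x) <= lipschitz_const Lam deltac rho.
Proof.
have [M0 hf hc _ _] := hM => Sx r0 hl hct; rewrite auglag_hessE.
have sx := segment_self Sx; have [_ bf] := hf x sx.
rewrite /auglag_hess /lipschitz_const; apply: le_trans (specnormD _ _) _.
have -> : m%:R * (M * (Lam + rho * (deltac + 4 * M))) =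
   \sum_(i < m) (M * (Lam + rho * (deltac + 4 * M))).
  by rewrite sumr_const card_ord mulr_natl.
apply: lerD; first by apply: le_trans bf _; rewrite lerDr.
apply: le_trans (specnorm_sum _ _ _) _; apply: ler_sum => i _.
have [gi hi] := hc i x sx.
apply: le_trans (specnormD _ _) _.
have h1 := specnormZ (mult lam rho x i 0) (hess (coordf c i) x).
have h2 := specnormZ rho (grad (coordf c i) x *m (grad (coordf c i) x)^T).
have h3 := specnorm_outer (grad (coordf c i) x) (grad (coordf c i) x).
rewrite (ger0_norm r0) in h2.
have h4 : l2norm (grad (coordf c i) x) * l2norm (grad (coordf c i) x) <= M * M.
  by apply: ler_pM => //; exact: l2norm_ge0.
have h5 : `|mult lam rho x i 0| <= Lam + rho * deltac.
  rewrite !mxE; apply: le_trans (ler_normD _ _) _; apply: lerD.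
    exact: le_trans (l2norm_coord _ _) hl.
  rewrite normrM (ger0_norm r0) ler_wpM2l//.
  by have := l2norm_coord (ct x) i; rewrite !mxE => /le_trans; apply.
have h6 : `|mult lam rho x i 0| * specnorm (hess (coordf c i) x) <= (Lam + rho * deltac) * M.
  by apply: ler_pM => //; exact: specnorm_ge0.
have h7 : rho * specnorm (grad (coordf c i) x *m (grad (coordf c i) x)^T) <= rho * (M * M).
  by rewrite ler_wpM2l//; exact: le_trans h3 h4.
have h8 : 0 <= rho * (M * M) by rewrite !mulr_ge0// ltW.
apply: le_trans (lerD (le_trans h1 h6) (le_trans h2 h7)) _.
have -> : M * (Lam + rho * (deltac + 4 * M)) =
  (Lam + rho * deltac) * M + rho * (M * M) + 3 * (rho * (M * M)) by ring.
by rewrite lerDl mulr_ge0.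
Qed.

(* c is controlled on S only, not on the segments joining points of S, so the
   Hessian is Lipschitz uniformly only on short segments. *)
Lemma auglag_hess_lipschitz lam rho x d a t : 0 <= rho -> l2norm lam <= Lam ->
  l2norm (ct x) <= deltac ->
  0 < a -> S x -> S (x + a *: d) -> a * l2norm d <= 1 -> 0 < t < a ->
  specnorm (hess (auglag f c z lam rho) (x + t *: d) - hess (auglag f c z lam rho) x)
    <= lipschitz_const Lam deltac rho * (t * l2norm d).
Proof.
have [M0 hf hc [lf lc] _] := hM => r0 hl hct a0 Sx Sy ad /andP[t0 ta].
have seg s : 0 <= s <= a -> segments S (x + s *: d) by exact: segment_sub.
have sx := segment_self Sx.
have sy : segments S (x + t *: d) by apply: seg; rewrite !ltW.
set y := x + t *: d; set D := t * l2norm d.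
have yx : y - x = t *: d by rewrite /y addrC addKr.
have D1 : D <= 1 by apply: le_trans ad; rewrite ler_wpM2r ?l2norm_ge0// ltW.
have D0 : 0 <= D by rewrite mulr_ge0 ?l2norm_ge0// ltW.
have Dn : l2norm (y - x) = D by rewrite yx l2normZ gtr0_norm.
have ysub s : 0 < s < 1 -> segments S (x + s *: (t *: d)).
  move=> /andP[s0 s1]; rewrite scalerA; apply: seg.
  rewrite mulr_ge0 ?(ltW s0) ?(ltW t0)//=; apply: le_trans (_ : t <= a); last exact: ltW.
  by rewrite ler_piMl// ltW.
have yE : y = x + t *: d by [].
have dn : l2norm (t *: d) = D by rewrite l2normZ gtr0_norm.
rewrite !auglag_hessE /auglag_hess /lipschitz_const.
rewrite [X in specnorm X](_ : _ = (hess f y - hess f x) + \sum_i (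
  (mult lam rho y i 0 *: (hess (coordf c i) y - hess (coordf c i) x)
   + (rho * (coordf c i y - coordf c i x)) *: hess (coordf c i) x) +
  rho *: (grad (coordf c i) y *m (grad (coordf c i) y - grad (coordf c i) x)^T
   + (grad (coordf c i) y - grad (coordf c i) x) *m (grad (coordf c i) x)^T))); last first.
  rewrite opprD addrACA -sumrB; congr (_ + _); apply: eq_bigr => i _.
  apply: weighted_hess_diff; rewrite !mxE /coordf; ring.
apply: le_trans (specnormD _ _) _; rewrite mulrDl.
apply: lerD.
  apply: le_trans (lf y x (segOmega sy) (segOmega sx)) _.
  by rewrite Dn ler_wpM2r// lerDr.
have -> : m%:R * (M * (Lam + rho * (deltac + 4 * M))) * D =
   \sum_(i < m) (M * (Lam + rho * (deltac + 4 * M)) * D).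
  by rewrite sumr_const card_ord -mulrA mulr_natl.
apply: le_trans (specnorm_sum _ _ _) _; apply: ler_sum => i _.
have [gx hx] := hc i x sx; have [gy _] := hc i y sy.
have hci := C2_has_hess (C2c i).
have cdiff : `|coordf c i y - coordf c i x| <= M * D.
  rewrite -dn; apply: (value_lipschitz_segment hci.1) => s s01.
  by case: (hc i _ (ysub s s01)).
have gdiff : l2norm (grad (coordf c i) y - grad (coordf c i) x) <= M * D.
  rewrite -dn; apply: (grad_lipschitz_segment hci) => s s01.
  by case: (hc i _ (ysub s s01)).
have hdiff : specnorm (hess (coordf c i) y - hess (coordf c i) x) <= M * D.
  by rewrite -Dn; exact: (lc i y x (segOmega sy) (segOmega sx)).
have o1 := specnorm_outer (grad (coordf c i) y) (grad (coordf c i) y - grad (coordf c i) x).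
have o2 := specnorm_outer (grad (coordf c i) y - grad (coordf c i) x) (grad (coordf c i) x).
have MD0 : 0 <= M * D by rewrite mulr_ge0// ltW.
have o3 : l2norm (grad (coordf c i) y) * l2norm (grad (coordf c i) y - grad (coordf c i) x)
    <= M * (M * D) by apply: ler_pM => //; exact: l2norm_ge0.
have o4 : l2norm (grad (coordf c i) y - grad (coordf c i) x) * l2norm (grad (coordf c i) x)
    <= M * D * M by apply: ler_pM => //; exact: l2norm_ge0.
(* [ct] is bounded by deltac at x; passing to y, at distance at most 1, adds at most M. *)
have ml : `|mult lam rho y i 0| <= Lam + rho * (deltac + M).
  have -> : mult lam rho y i 0 = lam i 0 + rho * (ct x i 0 + (coordf c i y - coordf c i x)).
    by rewrite !mxE /coordf; ring.
  apply: le_trans (ler_normD _ _) _; apply: lerD.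
    exact: le_trans (l2norm_coord _ _) hl.
  rewrite normrM (ger0_norm r0) ler_wpM2l//; apply: le_trans (ler_normD _ _) _.
  apply: lerD; first exact: le_trans (l2norm_coord _ _) hct.
  by apply: le_trans cdiff _; rewrite ler_piMr// ltW.
apply: le_trans (specnormD _ _) _.
have p1 := specnormD (mult lam rho y i 0 *: (hess (coordf c i) y - hess (coordf c i) x))
   ((rho * (coordf c i y - coordf c i x)) *: hess (coordf c i) x).
have p2 := specnormZ (mult lam rho y i 0) (hess (coordf c i) y - hess (coordf c i) x).
have p3 := specnormZ (rho * (coordf c i y - coordf c i x)) (hess (coordf c i) x).
have p4 := specnormZ rho (grad (coordf c i) y *m (grad (coordf c i) y - grad (coordf c i) x)^T
   + (grad (coordf c i) y - grad (coordf c i) x) *m (grad (coordf c i) x)^T).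
have p5 := specnormD (grad (coordf c i) y *m (grad (coordf c i) y - grad (coordf c i) x)^T)
   ((grad (coordf c i) y - grad (coordf c i) x) *m (grad (coordf c i) x)^T).
rewrite (ger0_norm r0) in p4; rewrite normrM (ger0_norm r0) in p3.
have q2 : `|mult lam rho y i 0| * specnorm (hess (coordf c i) y - hess (coordf c i) x)
    <= (Lam + rho * (deltac + M)) * (M * D).
  by apply: ler_pM => //; exact: specnorm_ge0.
have q3 : rho * `|coordf c i y - coordf c i x| * specnorm (hess (coordf c i) x)
    <= rho * (M * D) * M.
  apply: ler_pM => //; [by rewrite mulr_ge0|exact: specnorm_ge0|by rewrite ler_wpM2l].
have q4 := ler_wpM2l r0 (le_trans p5 (lerD (le_trans o1 o3) (le_trans o2 o4))).
apply: le_trans (lerD (le_trans p1 (lerD (le_trans p2 q2) (le_trans p3 q3))) (le_trans p4 q4)) _.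
by rewrite le_eqVlt; apply/orP; left; apply/eqP; ring.
Qed.

Lemma auglag_hess_lipschitz_affine lam rho x d a t : affine c ->
  0 < a -> S x -> S (x + a *: d) -> 0 < t < a ->
  specnorm (hess (auglag f c z lam rho) (x + t *: d) - hess (auglag f c z lam rho) x)
    <= (1 + M) * (t * l2norm d).
Proof.
move=> [A [b cE]] a0 Sx Sy /andP[t0 ta].
have [M0 _ _ [lf _] _] := hM.
have hi i := affine_has_hess i cE.
rewrite !auglag_hessE /auglag_hess.
rewrite [X in specnorm X](_ : _ = hess f (x + t *: d) - hess f x); last first.
  rewrite opprD addrACA -sumrB big1 ?addr0// => i _.
  by rewrite (has_gradE (hi i).1) (has_hessE (hi i)) !scaler0 subrr.
have sy : segments S (x + t *: d) by apply: (segment_sub a0) => //; rewrite !ltW.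
apply: le_trans (lf _ _ (segOmega sy) (segOmega (segment_self Sx))) _.
rewrite [x + _ - x]addrC addKr l2normZ gtr0_norm// ler_wpM2r ?lerDr//.
by rewrite mulr_ge0 ?l2norm_ge0// ltW.
Qed.

End Constants.
End AugLag.

(** * Counting along the AL method *)

Section Tolerances.
Context {R : realType} (P : al_params R).
Hypothesis ratio_gt1 : 1 < ratio P.

Definition tol_exponent (k : nat) : R := k%:R * ln (ratio P) / ln 2.

Let ln2_gt0 : 0 < ln 2 :> R. Proof. by rewrite ln_gt0// ltr1n. Qed.

(** With base and exponent exchanged, the two tolerances are powers with the same exponent. *)
Lemma tolE (eps : R) k : 0 < eps -> tol P eps k = Num.max eps (eps `^ tol_exponent k).
Proof.
move=> e0; rewrite /tol /powR (gt_eqF e0) (gt_eqF (lt_trans ltr01 ratio_gt1)).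
by congr (Num.max _ (expR _)); rewrite /tol_exponent; ring.
Qed.

Lemma tol_exponent_ge0 k : 0 <= tol_exponent k.
Proof.
rewrite /tol_exponent; apply: divr_ge0; last exact: ltW.
by rewrite mulr_ge0 ?ln_ge0// ltW.
Qed.

Lemma tol_ge (eps : R) k : eps <= tol P eps k.
Proof. by rewrite le_max lexx. Qed.

Lemma tol_le1 (eps : R) k : 0 < eps < 1 -> tol P eps k <= 1.
Proof.
move=> /andP[e0 e1]; rewrite tolE// ge_max (ltW e1)/= -(powRr0 eps).
by apply: ger_powR; [rewrite e0 ltW | exact: tol_exponent_ge0].
Qed.

(** The condition on k does not involve eps: it says that the exponent has reached 1. *)
Lemma tol_reached (eps : R) k : 0 < eps < 1 -> ln 2 <= k%:R * ln (ratio P) ->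
  tol P eps k <= eps.
Proof.
move=> /andP[e0 e1] hk; rewrite tolE// ge_max lexx /=.
apply: ge1r_powR; first by rewrite e0 ltW.
by rewrite /tol_exponent ler_pdivlMr ?mul1r.
Qed.

Lemma tol_min_ratio (eps1 eps2 : R) k : 0 < eps1 < 1 -> 0 < eps2 < 1 ->
  Num.min (eps1 ^+ 2 / eps2) (eps2 ^+ 3) <=
  Num.min (tol P eps1 k ^+ 2 / tol P eps2 k) (tol P eps2 k ^+ 3).
Proof.
move=> e1 e2; have [e10 e11] := andP e1; have [e20 e21] := andP e2.
have e23 : eps2 ^+ 3 <= tol P eps2 k ^+ 3.
  by apply: lerXn2r; rewrite ?nnegrE ?tol_ge ?ltW// (lt_le_trans e20 (tol_ge _ _)).
rewrite le_min; apply/andP; split; last by rewrite ge_min e23 orbT.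
have [s1|s1] := leP 1 (tol_exponent k).
  have h (e : R) : 0 < e < 1 -> tol P e k = e.
    move=> /andP[e_0 e_1]; rewrite tolE//; apply: max_l; apply: ge1r_powR => //.
    by rewrite e_0 ltW.
  by rewrite !h// ge_min lexx.
have h (e : R) : 0 < e < 1 -> tol P e k = e `^ tol_exponent k.
  move=> /andP[e_0 e_1]; rewrite tolE//; apply: max_r; apply: ger1_powR; last exact: ltW.
  by rewrite e_0 ltW.
rewrite !h//.
have -> : (eps1 `^ tol_exponent k) ^+ 2 / eps2 `^ tol_exponent k =
    (eps1 ^+ 2 / eps2) `^ tol_exponent k.
  rewrite powRM ?exprn_ge0 ?invr_ge0 ?(ltW e10) ?(ltW e20)//; congr (_ * _).
    by rewrite expr2 -powRM ?(ltW e10).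
  by rewrite -(powR_inv1 (ltW e20)) powRAC powR_inv1// powR_ge0.
have q0 : 0 < eps1 ^+ 2 / eps2 by rewrite divr_gt0 ?exprn_gt0.
have [q1|q1] := leP (eps1 ^+ 2 / eps2) 1.
  rewrite ge_min; apply/orP; left; apply: ger1_powR; last exact: ltW.
  by rewrite q0.
rewrite ge_min; apply/orP; right; apply: (@le_trans _ _ 1).
  by rewrite expr_le1 ?(ltW e21)// ltW.
by rewrite -(powRr0 (eps1 ^+ 2 / eps2)); apply: ler_powR; [exact: ltW | exact: tol_exponent_ge0].
Qed.

End Tolerances.

Lemma is_proj_l2ball_exists {R : realType} m (r : R) (v : 'cV[R]_m) : 0 < r ->
  exists w, is_proj (l2ball r) v w.
Proof.
move=> r0; have [hv|hv] := leP (l2norm v) r.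
  by exists v; split=> // u _; rewrite subrr l2norm0 l2norm_ge0.
have v0 : 0 < l2norm v by exact: lt_trans hv.
exists ((r / l2norm v) *: v); split.
  by rewrite /l2ball /= l2normZ ger0_norm ?divr_ge0 ?(ltW r0) ?(ltW v0)// divfK ?gt_eqF.
move=> u /= hu.
have -> : v - (r / l2norm v) *: v = (1 - r / l2norm v) *: v by rewrite scalerBl scale1r.
rewrite l2normZ ger0_norm; last by rewrite subr_ge0 ler_pdivrMr// mul1r ltW.
rewrite mulrBl mul1r divfK ?gt_eqF//.
have := l2normD (v - u) u; rewrite subrK; move: hu; rewrite /l2ball /=; lra.
Qed.

Section ALCount.
Context {R : realType} {n m : nat}.
Variables (P : al_params R) (f : 'cV[R]_n -> R) (c : 'cV[R]_n -> 'cV[R]_m).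
Variables (eps1 eps2 : R) (z x0 : 'cV[R]_n) (lam0 : 'cV[R]_m).
Hypothesis C2f : C2 f.
Hypothesis C2c : forall i, C2 (coordf c i).
Hypothesis Lambda_gt0 : 0 < Lambda P.
Hypothesis rho0_gt0 : 0 < rho0 P.
Hypothesis alpha01 : 0 < alpha P < 1.
Hypothesis ratio_gt1 : 1 < ratio P.
Hypothesis theta01 : 0 < theta P < 1.
Hypothesis zeta01 : 0 < zeta P < 1.
Hypothesis eta01 : 0 < eta P < 1.
Hypothesis eps1_01 : 0 < eps1 < 1.
Hypothesis eps2_01 : 0 < eps2 < 1.
Hypothesis cz_le : l2norm (c z) <= eps1 / 2.
Hypothesis lam0_le : l2norm lam0 <= Lambda P.

Local Notation ct := (ctilde c z).
Local Notation AL := (auglag f c z).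

(** The count is parametric in these constants, so that it serves general and affine c alike; the
    two differ only in L. A bounds a run of outer iterations without an increase of rho, E the
    number of increases, both counted once the tolerances are final. *)
Variables (deltac B Flow L rmax cost A E : R) (k0 : nat).
Hypothesis tol_k0 : ln 2 <= k0%:R * ln (ratio P).
Hypothesis L_ge1 : 1 <= L.
Hypothesis level_ct : forall lam rho x, l2norm lam <= Lambda P -> rho0 P <= rho ->
  AL lam rho x <= f z -> l2norm (ct x) <= deltac.
Hypothesis level_mult : forall lam rho x, l2norm lam <= Lambda P -> rho0 P <= rho ->
  AL lam rho x <= f z -> l2norm (grad (AL lam rho) x) <= 1 -> rho * l2norm (ct x) <= B.
Hypothesis level_low : forall lam rho x, l2norm lam <= Lambda P -> rho0 P <= rho ->
  Flow <= AL lam rho x.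
Hypothesis rmax_ge1 : rho0 P * ratio P ^+ k0 <= rmax.
Hypothesis rmax_ge2 : 2 * B * ratio P / eps1 <= rmax.
Hypothesis lipAL : forall lam rho, l2norm lam <= Lambda P -> rho0 P <= rho <= rmax ->
  forall x d a, 0 < a -> AL lam rho x <= f z -> AL lam rho (x + a *: d) <= f z ->
  a * l2norm d <= 1 -> forall t, 0 < t < a ->
  specnorm (hess (AL lam rho) (x + t *: d) - hess (AL lam rho) x) <= L * (t * l2norm d).
Hypothesis cost_le : forall k lam rho q u o mv, l2norm lam <= Lambda P ->
  rho0 P <= rho <= rmax -> AL lam rho u <= f z -> l2norm q = 1 ->
  inner_iter P f c eps1 eps2 z k lam rho q u o mv -> mv%:R <= cost.
Hypothesis A_bound : forall a : nat, eps1 / 2 < deltac * alpha P ^+ a -> a%:R <= A.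
Hypothesis E_bound : forall e : nat, rho0 P * ratio P ^+ e <= rmax -> e%:R <= E.
Hypothesis A_ge0 : 0 <= A.
Hypothesis E_ge0 : 0 <= E.

Definition call_decrease : R := decrease_const (theta P) (eta P) *
  (Num.min (eps1 ^+ 2 / eps2) (eps2 ^+ 3) / L ^+ 2).

(** Of the final 2, one pays for the gradient flag in the potential and one for the iteration that
    ends the call. *)
Definition call_iters : R := 2 * (f z - Flow) / call_decrease + 2.

Definition outer_iters : R := k0%:R + 1 + (E + 1) * (A + 1).

Let potential k lam rho u :=
  newton_potential (AL lam rho) (f z) (tol P eps1 k) call_decrease u.

(* After iteration k0 the tolerances are final, so a call that does not end the
   method leaves an infeasible x; e counts the increases of rho since then and a
   the iterations since the last of them. *)
Definition al_invariant (s : al_config R n m) : Prop :=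
  match s with
  | Running k x lam rho u it mv =>
    [/\ l2norm lam <= Lambda P, rho0 P <= rho <= rmax, AL lam rho u <= f z,
        (k <= k0)%N -> rho <= rho0 P * ratio P ^+ k &
     [/\ (k <= k0)%N \/ exists e a : nat,
          [/\ k%:R <= k0%:R + 1 + e%:R * (A + 1) + a%:R,
             rho0 P * ratio P ^+ e <= rho,
             l2norm (ct x) <= deltac * alpha P ^+ a & eps1 / 2 < l2norm (ct x)],
        it%:R <= k%:R * call_iters + potential k lam rho u &
        mv%:R <= it%:R * cost]]
  | Done _ _ it mv => it%:R <= (outer_iters + 1) * call_iters /\ mv%:R <= it%:R * cost
  end.

Let tol1 k : 0 < tol P eps1 k <= 1.
Proof.
have [e0 _] := andP eps1_01.
by rewrite (lt_le_trans e0 (tol_ge _ _ _)) tol_le1.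
Qed.

Let tol2 k : 0 < tol P eps2 k <= 1.
Proof.
have [e0 _] := andP eps2_01.
by rewrite (lt_le_trans e0 (tol_ge _ _ _)) tol_le1.
Qed.

Lemma call_decrease_gt0 : 0 < call_decrease.
Proof.
have [c0 _] := andP (decrease_const_bound theta01 eta01).
have [e10 _] := andP eps1_01; have [e20 _] := andP eps2_01.
apply: mulr_gt0 => //; apply: divr_gt0.
  by rewrite lt_min divr_gt0 ?exprn_gt0.
by rewrite exprn_gt0// (lt_le_trans _ L_ge1).
Qed.

Lemma call_decrease_le k : 0 < call_decrease <=
  newton_decrease L (tol P eps1 k) (tol P eps2 k) (theta P) (eta P).
Proof.
rewrite call_decrease_gt0 /=.
have [c0 _] := andP (decrease_const_bound theta01 eta01).
rewrite ler_pM2l// ler_pM2r ?invr_gt0 ?exprn_gt0//; first exact: tol_min_ratio.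
exact: lt_le_trans L_ge1.
Qed.

Lemma potential_ge0 k lam rho u : AL lam rho u <= f z -> 0 <= potential k lam rho u.
Proof.
move=> h; rewrite /potential /newton_potential addr_ge0 ?ler0n// divr_ge0 ?(ltW call_decrease_gt0)//.
by rewrite mulr_ge0// subr_ge0.
Qed.

Lemma potential_le k lam rho u : l2norm lam <= Lambda P -> rho0 P <= rho ->
  potential k lam rho u + 1 <= call_iters.
Proof.
move=> hl hr; rewrite /potential /newton_potential /call_iters.
have h : 2 * (f z - AL lam rho u) / call_decrease <= 2 * (f z - Flow) / call_decrease.
  rewrite ler_pM2r ?invr_gt0 ?call_decrease_gt0// ler_pM2l// lerD2l lerN2.
  exact: level_low.
by case: (_ <= tol P eps1 k)%R => /=; move: h; lra.
Qed.

Lemma auglag_z lam rho : AL lam rho z = f z.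
Proof.
by rewrite /auglag /ctilde subrr dotp0r l2norm0 expr0n /= mulr0 mul0r !addr0.
Qed.

Lemma x_init_level x lam rho : AL lam rho (x_init f c z x lam rho) <= f z.
Proof.
by rewrite /x_init; case: ltP => // _; rewrite auglag_z.
Qed.

Lemma tail_count (k e a : nat) rho (D : R) :
  k%:R <= k0%:R + 1 + e%:R * (A + 1) + a%:R -> rho0 P * ratio P ^+ e <= rho ->
  rho <= rmax -> D <= deltac * alpha P ^+ a -> eps1 / 2 < D ->
  a%:R <= A /\ k%:R <= outer_iters.
Proof.
move=> hk hr hm hD eD.
have hA : a%:R <= A by apply: A_bound; exact: lt_le_trans hD.
split=> //; have hE : e%:R <= E by apply: E_bound; exact: le_trans hm.
have : e%:R * (A + 1) <= E * (A + 1) by rewrite ler_wpM2r// addr_ge0.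
by rewrite /outer_iters; lra.
Qed.

Lemma invariant_k k x lam rho u it mv :
  al_invariant (Running k x lam rho u it mv) -> k%:R <= outer_iters.
Proof.
move=> [_ /andP[_ hm] _ _ [[kk|[e [a [hk hr hD eD]]]] _ _]]; last first.
  by have [] := tail_count hk hr hm hD eD.
have : k%:R <= k0%:R :> R by rewrite ler_nat.
have : 0 <= (E + 1) * (A + 1) by rewrite mulr_ge0// addr_ge0.
by rewrite /outer_iters; lra.
Qed.

Lemma invariant_iters s : al_invariant s ->
  (iters s)%:R <= (outer_iters + 1) * call_iters /\ (mvs s)%:R <= (iters s)%:R * cost.
Proof.
case: s => [k x lam rho u it mv|x lam it mv] //= inv; have kK := invariant_k inv.
case: inv => hl /andP[hr _] hu _ [_ hit hmv]; split=> //.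
have := @potential_le k lam rho u hl hr.
have p0 := potential_ge0 k hu.
have ci0 : 0 <= call_iters -> k%:R * call_iters <= outer_iters * call_iters.
  by move=> c0; rewrite ler_wpM2r.
move: p0 hit; move: (potential k lam rho u) => p p0 hit pc.
have c0 : 0 <= call_iters by lra.
have := ci0 c0; lra.
Qed.

Lemma invariant_start : al_invariant (al_start P f c z x0 lam0).
Proof.
rewrite /al_start /=; split=> //.
- rewrite lexx /=; apply: le_trans rmax_ge1; rewrite ler_peMr// ?(ltW rho0_gt0)//.
  by rewrite exprn_ege1// ltW.
- exact: x_init_level.
- by rewrite expr0 mulr1.
- split; [by left| |by rewrite mul0r].
  by rewrite mul0r add0r potential_ge0// x_init_level.
Qed.

Lemma cost_add it mv mv' : mv%:R <= it%:R * cost -> mv'%:R <= cost ->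
  (mv + mv')%:R <= it.+1%:R * cost.
Proof. by move=> h1 h2; rewrite natrD -natr1 mulrDl mul1r lerD. Qed.

(** With final tolerances only feasibility can fail, and shifting c by [c z] costs at most
    [eps1 / 2]. *)
Lemma not_stop_ct k u : (k0 <= k)%N -> ~~ al_stop P c eps1 eps2 k u ->
  eps1 / 2 < l2norm (ct u).
Proof.
move=> kk; have lnr : 0 <= ln (ratio P) by rewrite ln_ge0// ltW.
have hk : ln 2 <= k%:R * ln (ratio P).
  by apply: le_trans tol_k0 _; rewrite ler_wpM2r// ler_nat.
rewrite /al_stop (tol_reached ratio_gt1 eps1_01 hk) (tol_reached ratio_gt1 eps2_01 hk) /= -ltNge.
move=> hc; have : l2norm (c u) <= l2norm (ct u) + l2norm (c z).
  have {1}-> : c u = ct u + c z by rewrite /ctilde subrK.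
  exact: l2normD.
by move: cz_le hc; lra.
Qed.

Lemma next_rho_bounds k x u rho : rho0 P <= rho ->
  rho <= next_rho P c z k x u rho <= ratio P * rho.
Proof.
move=> hr; have r0 : 0 <= rho by exact: le_trans (ltW rho0_gt0) hr.
have h : rho <= ratio P * rho by rewrite ler_peMl// ltW.
by rewrite /next_rho; case: ifP => _; rewrite ?h lexx.
Qed.

Lemma invariant_outer k x lam rho u it mv q mv' lam' :
  al_invariant (Running k x lam rho u it mv) -> l2norm q = 1 ->
  inner_iter P f c eps1 eps2 z k lam rho q u None mv' ->
  ~~ al_stop P c eps1 eps2 k u ->
  is_proj (l2ball (Lambda P)) (lam + rho *: ct u) lam' ->
  al_invariant (Running k.+1 u lam' (next_rho P c z k x u rho)
                 (x_init f c z u lam' (next_rho P c z k x u rho)) it.+1 (mv + mv')).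
Proof.
move=> [hl hrho hu hk0 [hk hit hmv]] q1 hi hs [hl' _].
have [hr hm] := andP hrho; have [e10 e11] := andP eps1_01.
have mvc := cost_le hl hrho hu q1 hi.
have gu : l2norm (grad (AL lam rho) u) <= 1.
  inversion hi; subst; apply: le_trans H _; by have [_] := andP (tol1 k).
have hB := level_mult hl hr hu gu.
have hct := level_ct hl hr hu.
have [rn rr] := andP (next_rho_bounds k x u hr).
have r0 : 0 < ratio P by exact: lt_trans ratio_gt1.
have rho'k : (k.+1 <= k0)%N -> next_rho P c z k x u rho <= rho0 P * ratio P ^+ k.+1.
  move=> kk; apply: le_trans rr _; rewrite exprS mulrCA ler_pM2l//.
  by apply: hk0; exact: ltnW.
(* Up to k0 rho grows at most geometrically. Later u is infeasible, so the bound B on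
   [rho * l2norm (ct u)] gives [rho <= 2 * B / eps1] before the increase. *)
have rho'm : next_rho P c z k x u rho <= rmax.
  have [kk|kk] := ltnP k k0.
    apply: le_trans (rho'k kk) _; apply: le_trans rmax_ge1; rewrite ler_pM2l//.
    by apply: ler_weXn2l => //; exact: ltW.
  have ec := not_stop_ct kk hs.
  apply: le_trans rr _; apply: le_trans rmax_ge2.
  rewrite ler_pdivlMr//.
  have : rho * (eps1 / 2) <= B.
    apply: le_trans hB; rewrite ler_wpM2l//; last exact: ltW.
    exact: le_trans (ltW rho0_gt0) hr.
  move=> h; have := ler_wpM2l (ltW r0) h; lra.
split=> //; first by rewrite rho'm (le_trans hr rn).
  exact: x_init_level.
split.
- have [kk|kk] := ltnP k k0; [by left | right].
  have ec := not_stop_ct kk hs.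
  case: hk => [kk'|[e [a [hke hre hD eD]]]].
    (* The counters e and a start here. *)
    have ek : k = k0 by apply/eqP; rewrite eqn_leq kk kk'.
    exists 0%N, 0%N; split=> //.
    + by rewrite mul0r !addr0 ek natr1.
    + by rewrite expr0 mulr1 (le_trans hr rn).
    + by rewrite expr0 mulr1.
  have [aA _] := tail_count hke hre hm hD eD.
  move: (hre); rewrite /next_rho; case: ifP => [_|/negbT]; last first.
    rewrite negb_or -leNgt => /andP[_ ha] _.
    exists e, a.+1; split=> //; first by rewrite -!natr1; lra.
    apply: le_trans ha _; rewrite exprS mulrCA ler_wpM2l//.
    by have [/ltW] := andP alpha01.
  (* After an increase the finished run, of length at most A, is booked under the new e. *)
  move=> _; exists e.+1, 0%N; split=> //.
  + by rewrite -!natr1 addr0 mulrDl mul1r; lra.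
  + by rewrite exprS mulrCA ler_pM2l.
  + by rewrite expr0 mulr1.
- have pc := @potential_le k lam rho u hl hr.
  have p0 := potential_ge0 k.+1 (x_init_level u lam' (next_rho P c z k x u rho)).
  rewrite -!natr1 mulrDl mul1r; move: p0 pc hit.
  move: (potential k lam rho u) (potential _ _ _ _) => p p' p0 pc hit; lra.
- exact: cost_add.
Qed.

Lemma al_reachable_invariant s :
  al_reachable P f c eps1 eps2 z x0 lam0 s -> al_invariant s.
Proof.
elim=> [|q {}s s' _ inv q1 st]; first exact: invariant_start.
inversion st as [k x lam rho u it mv u' mv' hi|k x lam rho u it mv mv' hi hs
  |k x lam rho u it mv mv' lam' hi hs hp]; subst.
- case: inv => hl hrho hu hk0 [hk hit hmv].
  have mvc := cost_le hl hrho hu q1 hi.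
  have lp := lipAL hl hrho; have hh := auglag_has_grad_hess z C2f C2c lam rho.
  have hsym := auglag_hess_sym z C2f C2c lam rho.
  have [t1 _] := andP (tol1 k).
  have [lt _] := newton_cg_iter_progress hh hsym L_ge1 lp t1 (tol2 k) theta01 zeta01 eta01 hu hi.
  have pot := newton_potential_incr hh hsym L_ge1 lp t1 (tol2 k) theta01 zeta01 eta01
    (call_decrease_le k) hu hi.
  split; [exact: hl|exact: hrho|exact: le_trans (ltW lt) hu|exact: hk0|].
  split; [exact: hk| |exact: cost_add].
  move: pot hit; rewrite -natr1 -/(potential k lam rho u) -/(potential k lam rho u').
  move: (potential k lam rho u) (potential k lam rho u') => p p' pot hit; lra.
- have kK := invariant_k inv; have [] := invariant_iters inv.
  case: inv => hl hrho hu hk0 [hk hit hmv] /= _ _.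
  have mvc := cost_le hl hrho hu q1 hi; split; last exact: cost_add.
  have [hr _] := andP hrho.
  have pc := @potential_le k lam rho u hl hr; have p0 := potential_ge0 k hu.
  rewrite -natr1; move: hit pc p0; move: (potential k lam rho u) => p hit pc p0.
  have c0 : 0 <= call_iters by lra.
  have := ler_wpM2r c0 kK; lra.
- exact: invariant_outer hi hs hp.
Qed.

Lemma al_step_exists s q : al_reachable P f c eps1 eps2 z x0 lam0 s ->
  ~ is_done s -> l2norm q = 1 -> exists s', al_step P f c eps1 eps2 z q s s'.
Proof.
move=> /al_reachable_invariant; case: s => [k x lam rho u it mv|? ? ? ?] //=.
move=> [hl hrho hu hk0 _] _ q1.
have lp := lipAL hl hrho; have hh := auglag_has_grad_hess z C2f C2c lam rho.
have hsym := auglag_hess_sym z C2f C2c lam rho.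
have [t1 _] := andP (tol1 k).
have [[u'|] [mv' hi]] : exists o mv', inner_iter P f c eps1 eps2 z k lam rho q u o mv'.
  by apply: (newton_cg_iter_exists hh hsym L_ge1 lp) => //; exact: tol2.
  by eexists; exact: (AL_inner x it mv hi).
have [hs|hs] := boolP (al_stop P c eps1 eps2 k u).
  by eexists; exact: (AL_output x it mv hi hs).
have [lam' hlam'] := is_proj_l2ball_exists (lam + rho *: ct u) Lambda_gt0.
by eexists; exact: (AL_outer x it mv hi hs hlam').
Qed.

End ALCount.

(** * Compactness and the problem constant *)

Section ProblemConstant.
Context {R : realType}.

(** Compactness in its covering form, with M tending to infinity. Since each local statement holds
    for all large M, the local bounds merge into one. *)
Lemma compact_uniform_bound (T : topologicalType) (K : set T) (Q : R -> T -> Prop) :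
  compact K ->
  (forall x, K x -> exists M0, \forall y \near x, forall M, M0 <= M -> Q M y) ->
  exists M, forall M', M <= M' -> forall x, K x -> Q M' x.
Proof.
move=> /compact_near_coveringP cK hQ.
have := cK R +oo (fun M y => forall M', M <= M' -> Q M' y) _.
case=> [x Kx|A [_ hA]].
  have [M0 hM0] := hQ x Kx.
  exists ([set y | forall M, M0 <= M -> Q M y], [set M | M0 < M]) => /=.
    by split=> //; exists M0; split; first exact: num_real.
  by move=> [y M] /= [hy /ltW M0M] M' MM'; apply: hy; exact: le_trans MM'.
exists (A + 1) => M' hM' x Kx; apply: (hA (A + 1)) => //.
by rewrite ltrDl.
Qed.

Lemma entries_near n p k (H : 'cV[R]_n -> 'M[R]_(p, k)) x (e : R) :
  {for x, continuous H} -> 0 < e ->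
  \forall y \near x, forall i j, `|H x i j - H y i j| <= e.
Proof.
move=> cH e0.
have h i j : \forall y \near x, `|H x i j - H y i j| <= e.
  have := @continuous_comp _ _ _ H (fun M : 'M[R]_(p, k) => M i j) x cH
    (@coord_continuous _ _ _ _ _ _).
  by move/cvgrPdist_le => /(_ e e0).
have hi i : \forall y \near x, forall j, `|H x i j - H y i j| <= e by apply: filter_forall (h i).
by have := filter_forall _ hi; exact.
Qed.

Lemma specnorm_near_bound n p k (H : 'cV[R]_n -> 'M[R]_(p, k)) x :
  {for x, continuous H} ->
  exists M, \forall y \near x, forall M', M <= M' -> specnorm (H y) <= M'.
Proof.
move=> cH; exists (\sum_i \sum_j (`|H x i j| + 1)).
apply: filterS (entries_near cH ltr01) => y hy M'; apply: le_trans.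
apply: le_trans (specnorm_frob _) _; apply: ler_sum => i _; apply: ler_sum => j _.
have := hy i j; rewrite distrC; have := ler_normD (H y i j - H x i j) (H x i j).
by rewrite subrK; lra.
Qed.

Lemma l2norm_near_bound n p (G : 'cV[R]_n -> 'cV[R]_p) x :
  {for x, continuous G} ->
  exists M, \forall y \near x, forall M', M <= M' -> l2norm (G y) <= M'.
Proof.
move=> cH; exists (\sum_i (`|G x i 0| + 1)).
apply: filterS (entries_near cH ltr01) => y hy M'; apply: le_trans.
apply: le_trans (l2norm_le_sum _) _; apply: ler_sum => i _.
have := hy i 0; rewrite distrC; have := ler_normD (G y i 0 - G x i 0) (G x i 0).
by rewrite subrK; lra.
Qed.

(** A left inverse of [A x] bounds u by [b * l2norm (A x *m u)]. Replacing x by a near y costs at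
    most half of [l2norm u], which is absorbed; hence the factor 2. *)
Lemma left_inverse_near n p k (A : 'cV[R]_n -> 'M[R]_(p, k)) x :
  {for x, continuous A} -> \rank (A x) = k ->
  exists M, \forall y \near x, forall M', M <= M' ->
    forall u : 'cV[R]_k, l2norm u <= M' * l2norm (A y *m u).
Proof.
move=> cA rA; have /row_fullP[B BA] : row_full (A x) by rewrite /row_full rA.
pose b := specnorm B + 1.
have b0 : 0 < b by rewrite ltr_wpDl// specnorm_ge0.
exists (2 * b).
(* The p * k entries then add up to at most [(2 * b)^-1]; the extra 1 keeps the denominator positive
   for empty matrices. *)
pose e := (2 * b * (p * k + 1)%:R)^-1.
have pk0 : 0 < (p * k + 1)%:R :> R by rewrite ltr0n addn1.
have e0 : 0 < e by rewrite invr_gt0 !mulr_gt0.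
apply: filterS (entries_near cA e0) => y hy M' hM' u.
have dA : specnorm (A x - A y) <= (2 * b)^-1.
  apply: le_trans (specnorm_frob _) _.
  apply: (@le_trans _ _ (\sum_(i < p) \sum_(j < k) e)).
    by apply: ler_sum => i _; apply: ler_sum => j _; have := hy i j; rewrite !mxE.
  rewrite !sumr_const !card_ord -mulrnA -[e *+ _]mulr_natr /e invfM -mulrA ler_piMr//.
    by rewrite invr_ge0 mulr_ge0// ltW.
  by rewrite mulrC ler_pdivrMr// mul1r ler_nat mulnC addn1 leqnSn.
have h1 : l2norm u <= b * l2norm (A x *m u).
  rewrite -{1}[u]mul1mx -BA -mulmxA; apply: le_trans (l2norm_mul _ _) _.
  by rewrite ler_wpM2r ?l2norm_ge0// lerDl.
have h2 : l2norm (A x *m u) <= l2norm (A y *m u) + (2 * b)^-1 * l2norm u.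
  have -> : A x *m u = A y *m u + (A x - A y) *m u by rewrite mulmxBl addrC subrK.
  apply: le_trans (l2normD _ _) _; rewrite lerD2l; apply: le_trans (l2norm_mul _ _) _.
  by rewrite ler_wpM2r ?l2norm_ge0.
have h3 := ler_wpM2l (ltW b0) h2.
have h4 : b * ((2 * b)^-1 * l2norm u) = l2norm u / 2 by field; rewrite gt_eqF.
have h5 : 2 * b * l2norm (A y *m u) <= M' * l2norm (A y *m u).
  by rewrite ler_wpM2r ?l2norm_ge0.
move: h3 h5; rewrite mulrDr h4; lra.
Qed.

(** The union of the segments is a continuous image of S x S x [0, 1]. *)
Lemma compact_segments n (S : set 'cV[R]_n) : compact S -> compact (segments S).
Proof.
move=> cS; have cI := @segment_compact R 0 1.
have := compact_setX (compact_setX cS cS) cI.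
pose g (w : ('cV[R]_n * 'cV[R]_n) * R) := w.1.1 + w.2 *: (w.1.2 - w.1.1).
move=> cP; have -> : segments S = g @` ((S `*` S) `*` `[0, 1]).
  apply/seteqP; split=> [w [x [y [t [Sx Sy t01 ->]]]]|w [[[x y] t] /= [[Sx Sy] t01] <-]].
    by exists ((x, y), t) => //=; split=> //; rewrite in_itv.
  by exists x, y, t; split=> //; move: t01; rewrite in_itv.
apply: continuous_compact => //; apply: continuous_subspaceT => w.
have c11 : {for w, continuous (fun w : ('cV[R]_n * 'cV[R]_n) * R => w.1.1)}.
  by apply: (@cvg_comp _ _ _ fst fst); [exact: cvg_fst | exact: cvg_fst].
have c12 : {for w, continuous (fun w : ('cV[R]_n * 'cV[R]_n) * R => w.1.2)}.
  by apply: (@cvg_comp _ _ _ fst snd); [exact: cvg_fst | exact: cvg_snd].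
apply: cvgD => //; apply: cvgZ; first exact: cvg_snd.
exact: cvgB.
Qed.

Lemma segments_sub_convex n (S Omega : set 'cV[R]_n) :
  convex_set Omega -> S `<=` Omega -> segments S `<=` Omega.
Proof.
move=> cO SO w [x [y [t [Sx Sy /andP[t0 t1] ->]]]].
have := cO y x (Itv01 t0 t1) (mem_set (SO _ Sy)) (mem_set (SO _ Sx)).
rewrite inE; congr (Omega _).
change (t *: y + (1 - t) *: x = x + t *: (y - x)).
by rewrite scalerBl scale1r scalerBr addrCA.
Qed.

Lemma gradc_continuous n m (c : 'cV[R]_n -> 'cV[R]_m) (x : 'cV[R]_n) :
  (forall i, C2 (coordf c i)) -> {for x, continuous (gradc c)}.
Proof.
move=> cC; apply: (@cvgrPdist_le _ _ _ (nbhs x) (nbhs_filter x) _ _).2 => e e0.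
have h j : \forall y \near x, forall i k,
    `|grad (coordf c j) x i k - grad (coordf c j) y i k| <= e.
  by have [_ dG _] := cC j; apply: entries_near => //; exact: differentiable_continuous.
have {}h : \forall y \near x, forall j i k,
    `|grad (coordf c j) x i k - grad (coordf c j) y i k| <= e.
  by have := filter_forall _ h; exact.
apply: filterS h => y hy.
change (mx_norm (gradc c x - gradc c y) <= e); rewrite mx_normrE.
apply: bigmax_le => [|[i j] _]; first exact: ltW.
by have := hy j i 0; rewrite !mxE.
Qed.

Lemma finite_uniform_bound m (Q : R -> 'I_m -> Prop) :
  (forall i, exists M, forall M', M <= M' -> Q M' i) ->
  exists M, forall M', M <= M' -> forall i, Q M' i.
Proof.
move=> /choice[g hg]; exists (\sum_i `|g i|) => M' hM' i; apply: hg.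
apply: le_trans (ler_norm _) _; apply: le_trans hM'.
by rewrite (bigD1 i)//= lerDl sumr_ge0.
Qed.

Lemma C2_segment_bounds n (F : 'cV[R]_n -> R) (K : set 'cV[R]_n) : C2 F -> compact K ->
  exists M, forall M', M <= M' -> forall w, K w ->
    l2norm (grad F w) <= M' /\ specnorm (hess F w) <= M'.
Proof.
move=> [_ dG cH] cK.
have [M1 h1] : exists M, forall M', M <= M' -> forall w, K w -> l2norm (grad F w) <= M'.
  apply: (compact_uniform_bound (Q := fun M w => l2norm (grad F w) <= M)) => // x _.
  by apply: l2norm_near_bound; exact: differentiable_continuous.
have [M2 h2] : exists M, forall M', M <= M' -> forall w, K w -> specnorm (hess F w) <= M'.
  apply: (compact_uniform_bound (Q := fun M w => specnorm (hess F w) <= M)) => // x _.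
  by apply: specnorm_near_bound; exact: cH.
exists (Num.max M1 M2) => M'; rewrite ge_max => /andP[l1 l2] w Kw.
by split; [exact: h1 | exact: h2].
Qed.

Lemma lipschitz_hess_le n (F : 'cV[R]_n -> R) Omega L L' : L <= L' ->
  lipschitz_hess L Omega F -> lipschitz_hess L' Omega F.
Proof.
move=> LL' h x y Ox Oy; apply: le_trans (h x y Ox Oy) _.
by rewrite ler_wpM2r ?l2norm_ge0.
Qed.

Lemma problem_constant_exists n m (f : 'cV[R]_n -> R) (c : 'cV[R]_n -> 'cV[R]_m)
    (S Omega : set 'cV[R]_n) :
  C2 f -> (forall i, C2 (coordf c i)) -> compact S ->
  (exists L, lipschitz_hess L Omega f) ->
  (forall i, exists L, lipschitz_hess L Omega (coordf c i)) ->
  (forall x, S x -> \rank (gradc c x) = m) ->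
  exists M, problem_constant f c S Omega M.
Proof.
move=> C2f C2c cS [Lf hLf] hLc hr; have cseg := compact_segments cS.
have [M1 h1] := C2_segment_bounds C2f cseg.
have [M2 h2] := finite_uniform_bound (fun i => C2_segment_bounds (C2c i) cseg).
have [M3 h3] : exists M, forall M', M <= M' -> forall i, lipschitz_hess M' Omega (coordf c i).
  apply: (finite_uniform_bound (Q := fun M i => lipschitz_hess M Omega (coordf c i))) => i.
  by have [L hL] := hLc i; exists L => M' LM; exact: lipschitz_hess_le hL.
have [M4 h4] : exists M, forall M', M <= M' -> forall x, S x ->
    forall u : 'cV[R]_m, l2norm u <= M' * l2norm (gradc c x *m u).
  apply: (compact_uniform_bound (Q := fun M x => forall u : 'cV[R]_m,
    l2norm u <= M * l2norm (gradc c x *m u))) => // x Sx.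
  by apply: left_inverse_near; [exact: gradc_continuous | exact: hr].
pose M := `|M1| + `|M2| + `|M3| + `|M4| + `|Lf| + 1.
have [a1 a2 a3 a4 a5] : [/\ M1 <= M, M2 <= M, M3 <= M, M4 <= M & Lf <= M].
  have := ler_norm M1; have := ler_norm M2; have := ler_norm M3; have := ler_norm M4.
  have := ler_norm Lf; have := normr_ge0 M1; have := normr_ge0 M2; have := normr_ge0 M3.
  have := normr_ge0 M4; have := normr_ge0 Lf.
  by rewrite /M; split; lra.
exists M; split.
- by rewrite /M ltr_wpDl// !addr_ge0.
- exact: h1.
- by move=> i; exact: h2.
- by split; [exact: lipschitz_hess_le hLf | exact: h3].
- by move=> x u Sx; exact: h4.
Qed.

End ProblemConstant.

(** * Explicit constants *)

Section Cost.
Context {R : realType}.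

Definition cost_bound (n : nat) (delta zeta kappa : R) : R :=
  2 + 4 * Num.sqrt kappa * ln (24 * kappa ^+ 4 / zeta)
  + ln (11 / 4 * n%:R / delta ^+ 2) / 2 * Num.sqrt kappa.

Lemma ln_lanczos_ge0 (n : nat) (delta : R) : (0 < n)%N -> 0 < delta < 1 ->
  0 <= ln (11 / 4 * n%:R / delta ^+ 2).
Proof.
move=> n0 /andP[d0 d1]; have n1 : 1 <= n%:R :> R by rewrite ler1n.
have d2 : 0 < delta ^+ 2 by rewrite exprn_gt0.
have d21 : delta ^+ 2 <= 1 by rewrite expr_le1// ltW.
by rewrite ln_ge0// ler_pdivlMr//; lra.
Qed.

Lemma lanczos_N_le n (H : 'M[R]_n) (tau delta kappa : R) : (0 < n)%N ->
  0 < tau -> 0 < delta < 1 -> specnorm H / tau <= kappa ->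
  (lanczos_N H tau delta)%:R <=
    2 + ln (11 / 4 * n%:R / delta ^+ 2) / 2 * Num.sqrt kappa.
Proof.
move=> n0 t0 d01 hk; have l0 := ln_lanczos_ge0 n0 d01.
pose y := ln (11 / 4 * n%:R / delta ^+ 2) / 2 * Num.sqrt (specnorm H / tau).
have y0 : 0 <= y by rewrite mulr_ge0 ?sqrtr_ge0// divr_ge0.
have hy : y <= ln (11 / 4 * n%:R / delta ^+ 2) / 2 * Num.sqrt kappa.
  by rewrite ler_wpM2l ?ler_wsqrtr// divr_ge0.
apply: (@le_trans _ _ (1 + `|Num.ceil y|)%N%:R).
  by rewrite ler_nat geq_minr.
rewrite natrD natr_absz ger0_norm; last by rewrite ceil_ge0; lra.
have /andP[+ _] := ceil_itv y; rewrite rmorphB /=; lra.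
Qed.

(** The minimum is at least 1, so [3 * (j + 1)] products of a CG call and N + 1 of an oracle call
    are both covered by the factor 6. *)
Lemma newton_cg_iter_cost_le n (F : 'cV[R]_n -> R)
    (tg tau theta zeta eta delta kappa : R) q x o k :
  (forall x, (hess F x)^T = hess F x) -> 0 < tg -> 0 < tau <= 1 -> 0 < zeta < 1 ->
  0 < delta < 1 -> l2norm q = 1 -> specnorm (hess F x) / tau + 2 <= kappa ->
  newton_cg_iter F tg tau theta zeta eta delta q x o k ->
  k%:R <= 6 * Num.min n%:R (cost_bound n delta zeta kappa).
Proof.
move=> sF tg0 t01 z01 d01 q1 hk hi; have [t0 t1] := andP t01; have [z0 z1] := andP z01.
have n0 : (0 < n)%N.
  rewrite lt0n; apply/eqP => n0; move: q1; suff -> : q = 0.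
    by rewrite l2norm0 => /esym/eqP; rewrite oner_eq0.
  by apply/matrixP => i; have := ltn_ord i; rewrite {2}n0.
have s0 := specnorm_ge0 (hess F x).
have st0 : 0 <= specnorm (hess F x) / tau by rewrite divr_ge0// ltW.
have l0 := ln_lanczos_ge0 n0 d01.
have K2 : 2 <= kappa by lra.
have K4 : 1 <= kappa ^+ 4 by rewrite exprn_ege1//; lra.
have lK : 0 <= ln (24 * kappa ^+ 4 / zeta) by rewrite ln_ge0// ler_pdivlMr//; lra.
have sK := sqrtr_ge0 kappa.
have b1 : 0 <= 4 * Num.sqrt kappa * ln (24 * kappa ^+ 4 / zeta) by rewrite !mulr_ge0.
have b2 : 0 <= ln (11 / 4 * n%:R / delta ^+ 2) / 2 * Num.sqrt kappa.
  by rewrite mulr_ge0// divr_ge0.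
have n1 : 1 <= n%:R :> R by rewrite ler1n.
have m1 : 1 <= Num.min n%:R (cost_bound n delta zeta kappa).
  by rewrite le_min n1 /cost_bound; lra.
have [hN|[j [kj jn jb]]] := newton_cg_iter_cost sF tg0 t0 z01 hi.
  have h1 : (lanczos_N (hess F x) tau delta)%:R <= Num.min n%:R (cost_bound n delta zeta kappa).
    rewrite le_min ler_nat geq_minl /=.
    apply: le_trans (lanczos_N_le n0 t0 d01 (_ : _ <= kappa)) _; first by lra.
    by rewrite /cost_bound; lra.
  have : k%:R <= (lanczos_N (hess F x) tau delta + 1)%:R :> R by rewrite ler_nat.
  by rewrite natrD; lra.
have h1 : j%:R <= Num.min n%:R (cost_bound n delta zeta kappa).
  rewrite le_min ler_nat jn /=; apply: le_trans jb _.
  have kE : cg_kappa tau (specnorm (hess F x)) = specnorm (hess F x) / tau + 2.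
    by rewrite /cg_kappa; field; rewrite gt_eqF.
  have k0 : 2 <= cg_kappa tau (specnorm (hess F x)) by rewrite kE; lra.
  have kk : cg_kappa tau (specnorm (hess F x)) <= kappa by rewrite kE.
  move: (cg_kappa _ _) k0 kk => k' k0 kk.
  have k4 : 1 <= k' ^+ 4 by rewrite exprn_ege1//; lra.
  have h : 4 * Num.sqrt k' * ln (24 * k' ^+ 4 / zeta)
      <= 4 * Num.sqrt kappa * ln (24 * kappa ^+ 4 / zeta).
    apply: ler_pM.
    - by rewrite mulr_ge0 ?sqrtr_ge0.
    - by rewrite ln_ge0// ler_pdivlMr//; lra.
    - by rewrite ler_wpM2l// ler_wsqrtr.
    - rewrite ler_ln ?posrE ?divr_gt0//; try lra.
      rewrite ler_pM2r ?invr_gt0// ler_wpM2l//.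
      by apply: lerXn2r => //; rewrite nnegrE; lra.
  by rewrite /cost_bound; lra.
have : k%:R <= (3 * j.+1)%:R :> R by rewrite ler_nat.
by rewrite natrM -natr1; lra.
Qed.

Definition cost_const (delta zeta K : R) : R :=
  2 + 4 * Num.sqrt K * (ln (24 / zeta) + 4 * ln K + 4)
  + (ln (11 / 4 / delta ^+ 2) + 1) / 2 * Num.sqrt K.

Lemma cost_const_ge2 (delta zeta K : R) : 0 < delta < 1 -> 0 < zeta < 1 -> 1 <= K ->
  2 <= cost_const delta zeta K.
Proof.
move=> /andP[d0 d1] /andP[z0 z1] K1.
have lK : 0 <= ln K by rewrite ln_ge0.
have lz : 0 <= ln (24 / zeta) by rewrite ln_ge0// ler_pdivlMr//; lra.
have d2 : 0 < delta ^+ 2 by rewrite exprn_gt0.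
have d21 : delta ^+ 2 <= 1 by rewrite expr_le1// ltW.
have ld : 0 <= ln (11 / 4 / delta ^+ 2) by rewrite ln_ge0// ler_pdivlMr//; lra.
have sK := sqrtr_ge0 K.
have h1 : 0 <= 4 * Num.sqrt K * (ln (24 / zeta) + 4 * ln K + 4).
  by rewrite !mulr_ge0//; lra.
have h2 : 0 <= (ln (11 / 4 / delta ^+ 2) + 1) / 2 * Num.sqrt K.
  by rewrite mulr_ge0//; lra.
by rewrite /cost_const; lra.
Qed.

Lemma cost_bound_le n (delta zeta K eps1 eps2 : R) : (0 < n)%N ->
  0 < delta < 1 -> 0 < zeta < 1 -> 1 <= K -> 0 < eps1 < 1 -> 0 < eps2 < 1 ->
  Num.min n%:R (cost_bound n delta zeta (K / (eps1 * eps2))) <=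
    cost_const delta zeta K * (1 + ln eps1^-1 + ln eps2^-1 + ln n%:R)
    * Num.min n%:R (eps1 `^ (- (1 / 2)) * eps2 `^ (- (1 / 2))).
Proof.
move=> n0 d01 z01 K1 e1 e2; set logs := 1 + ln eps1^-1 + ln eps2^-1.
have [d0 d1] := andP d01; have [z0 z1] := andP z01.
have [e10 e11] := andP e1; have [e20 e21] := andP e2.
have C2 := cost_const_ge2 d01 z01 K1.
have n1 : 1 <= n%:R :> R by rewrite ler1n.
have ln0 : 0 <= ln n%:R :> R by rewrite ln_ge0.
have l1 : 0 <= ln eps1^-1 by rewrite ln_ge0// invf_ge1// ltW.
have l2 : 0 <= ln eps2^-1 by rewrite ln_ge0// invf_ge1// ltW.
have lg1 : 1 <= logs + ln n%:R by rewrite /logs; lra.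
have lK : 0 <= ln K by rewrite ln_ge0.
have lz : 0 <= ln (24 / zeta) by rewrite ln_ge0// ler_pdivlMr//; lra.
have d2 : 0 < delta ^+ 2 by rewrite exprn_gt0.
have d21 : delta ^+ 2 <= 1 by rewrite expr_le1// ltW.
have ld : 0 <= ln (11 / 4 / delta ^+ 2) by rewrite ln_ge0// ler_pdivlMr//; lra.
have K0 : 0 < K by lra.
set h := eps1 `^ (- (1 / 2)) * eps2 `^ (- (1 / 2)).
have pw (e : R) : 0 < e -> e `^ (- (1 / 2)) = Num.sqrt e^-1.
  by move=> e0; rewrite mul1r powRN powR12_sqrt ?ltW// sqrtrV// ltW.
have hE : Num.sqrt (K / (eps1 * eps2)) = Num.sqrt K * h.
  rewrite /h !pw// invfM !sqrtrM ?invr_ge0 ?(ltW e10) ?(ltW K0)//.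
have h1 : 1 <= h.
  rewrite /h !pw//; have s1 (e : R) : 0 < e < 1 -> 1 <= Num.sqrt e^-1.
    move=> /andP[e0 ee1]; rewrite -{1}sqrtr1 ler_wsqrtr// invf_ge1// ltW//.
  by rewrite mulr_ege1 ?s1.
have CL1 : 1 <= cost_const delta zeta K * (logs + ln n%:R).
  by rewrite mulr_ege1//; lra.
suff hX : cost_bound n delta zeta (K / (eps1 * eps2)) <=
    cost_const delta zeta K * (logs + ln n%:R) * h.
  (* If n is the smaller entry on the right, the bound n on the left suffices, as the prefactor is
     at least 1. *)
  have [nh|hn] := leP n%:R h.
    rewrite ge_min; apply/orP; left; rewrite ler_peMl//; lra.
  by rewrite ge_min hX orbT.
have lnk : ln (24 * (K / (eps1 * eps2)) ^+ 4 / zeta) =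
    ln (24 / zeta) + 4 * (ln K + ln eps1^-1 + ln eps2^-1).
  have -> : 24 * (K / (eps1 * eps2)) ^+ 4 / zeta = 24 / zeta * (K * eps1^-1 * eps2^-1) ^+ 4.
    by field; rewrite !gt_eqF.
  rewrite lnM ?posrE ?exprn_gt0 ?mulr_gt0 ?invr_gt0 ?divr_gt0//.
  rewrite lnXn ?mulr_gt0 ?invr_gt0// !lnM ?posrE ?mulr_gt0 ?invr_gt0//.
  by rewrite -[(_ + _) *+ 4]mulr_natl.
have lnn : ln (11 / 4 * n%:R / delta ^+ 2) = ln (11 / 4 / delta ^+ 2) + ln n%:R.
  have -> : 11 / 4 * n%:R / delta ^+ 2 = 11 / 4 / delta ^+ 2 * n%:R by rewrite mulrAC.
  by rewrite lnM// posrE ?divr_gt0//; lra.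
rewrite /cost_bound lnk lnn hE /cost_const.
have sK := sqrtr_ge0 K; have h0 : 0 <= h by lra.
set lg := logs + ln n%:R.
have lg1' : 1 <= lg by [].
have t1 : ln (24 / zeta) + 4 * (ln K + ln eps1^-1 + ln eps2^-1) <=
    (ln (24 / zeta) + 4 * ln K + 4) * lg.
  have a1 : 0 <= (ln (24 / zeta) + 4 * ln K) * (lg - 1) by rewrite mulr_ge0//; lra.
  have a2 : ln eps1^-1 + ln eps2^-1 <= lg by rewrite /lg /logs; lra.
  lra.
have t2 : ln (11 / 4 / delta ^+ 2) + ln n%:R <= (ln (11 / 4 / delta ^+ 2) + 1) * lg.
  have a1 : 0 <= ln (11 / 4 / delta ^+ 2) * (lg - 1) by rewrite mulr_ge0//; lra.
  have a2 : ln n%:R <= lg by rewrite /lg /logs; lra.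
  lra.
have sKh : 0 <= Num.sqrt K * h by rewrite mulr_ge0.
have u1 := ler_wpM2l sKh t1; have u2 := ler_wpM2l sKh t2.
have u3 : 1 <= lg * h by rewrite mulr_ege1.
nra.
Qed.

End Cost.

(** * Assembly of the constants *)

Section Complexity.
Context {R : realType} (m : nat) (P : al_params R).
Variables (fhi flow gamma deltaf deltac : R) (k0 : nat).
Hypothesis Lambda_gt0 : 0 < Lambda P.
Hypothesis gamma_gt0 : 0 < gamma.
Hypothesis rho0_gt : 2 * gamma < rho0 P.
Hypothesis alpha01 : 0 < alpha P < 1.
Hypothesis ratio_gt1 : 1 < ratio P.
Hypothesis delta01 : 0 < delta P < 1.
Hypothesis theta01 : 0 < theta P < 1.
Hypothesis zeta01 : 0 < zeta P < 1.
Hypothesis eta01 : 0 < eta P < 1.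
Hypothesis deltac_gt0 : 0 < deltac.
Hypothesis deltaf_large : delta_f1 P <= deltaf.
Hypothesis deltac_large : delta_c1 P fhi flow gamma <= deltac.
Hypothesis tol_k0 : ln 2 <= k0%:R * ln (ratio P).

Definition al_low : R := flow - gamma - Lambda P ^+ 2 / (2 * (rho0 P - 2 * gamma)).

Definition mult_const (M : R) : R := M * (1 + M) + Lambda P.

(** rho stays below this divided by eps1: the first summand covers the outer iterations up to k0,
    the second those after it. *)
Definition penalty_const (M : R) : R :=
  rho0 P * ratio P ^+ k0 + 2 * mult_const M * ratio P.

Definition smooth_const (M : R) : R :=
  @lipschitz_const R m M (Lambda P) deltac (penalty_const M).

(** This and [growth_const] are what remains of A + 1 and E + 1, defined below, once a factor [logs]
    is taken out. *)
Definition decay_const : R := (`|ln (2 * deltac)| + 1) / - ln (alpha P) + 1.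

Definition growth_const (M : R) : R :=
  (`|ln (penalty_const M / rho0 P)| + 1) / ln (ratio P) + 1.

Definition outer_const (M : R) : R := k0%:R + 2 + growth_const M * decay_const.

Definition call_const : R :=
  2 * `|fhi - al_low| / decrease_const (theta P) (eta P) + 2.

Definition iter_const (M : R) : R :=
  outer_const M * call_const * smooth_const M ^+ 2.

Definition mv_const (M : R) : R :=
  6 * cost_const (delta P) (zeta P) (smooth_const M + 2).

Let rho0_gt0 : 0 < rho0 P.
Proof. by apply: lt_trans rho0_gt; rewrite mulr_gt0. Qed.

Let lnr0 : 0 < ln (ratio P). Proof. by rewrite ln_gt0. Qed.

Let lna0 : 0 < - ln (alpha P). Proof. by rewrite oppr_gt0 ln_lt0. Qed.

Section Instance.
Variables (n : nat) (f : 'cV[R]_n -> R) (c : 'cV[R]_n -> 'cV[R]_m).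
Variables (Omega : set 'cV[R]_n) (M : R).
Hypothesis C2f : C2 f.
Hypothesis C2c : forall i, C2 (coordf c i).
Hypothesis flow_le : forall x, flow <= f x + gamma * l2norm (c x) ^+ 2 / 2.
Let S := Sset f c fhi deltaf deltac.
Hypothesis segO : segments S `<=` Omega.
Hypothesis hM : problem_constant f c S Omega M.
Variables (eps1 eps2 : R) (z x0 : 'cV[R]_n) (lam0 : 'cV[R]_m).
Hypothesis eps1_01 : 0 < eps1 < 1.
Hypothesis eps2_01 : 0 < eps2 < 1.
Hypothesis cz_le : l2norm (c z) <= eps1 / 2.
Hypothesis fz_le : f z <= fhi.
Hypothesis lam0_le : l2norm lam0 <= Lambda P.

Let M_gt0 : 0 < M. Proof. by case: hM. Qed.
Let e10 : 0 < eps1. Proof. by case/andP: eps1_01. Qed.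
Let e20 : 0 < eps2. Proof. by case/andP: eps2_01. Qed.
Let inv1 : 1 <= eps1^-1.
Proof. by have [_ h] := andP eps1_01; rewrite invf_ge1// ltW. Qed.
Let inv2 : 1 <= eps2^-1.
Proof. by have [_ h] := andP eps2_01; rewrite invf_ge1// ltW. Qed.

Let rmax := penalty_const M / eps1.
Let A := (`|ln (2 * deltac)| + ln eps1^-1) / - ln (alpha P).
Let E := (`|ln (penalty_const M / rho0 P)| + ln eps1^-1) / ln (ratio P).
Let logs := 1 + ln eps1^-1 + ln eps2^-1.
Let base := Num.max (eps1 ^- 2 * eps2) (eps2 ^- 3).
Let kappa := (smooth_const M + 2) / (eps1 * eps2).
Let cost := 6 * Num.min n%:R (cost_bound n (delta P) (zeta P) kappa).

Let l1 : 0 <= ln eps1^-1. Proof. by rewrite ln_ge0. Qed.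
Let l2 : 0 <= ln eps2^-1. Proof. by rewrite ln_ge0. Qed.
Let logs_ge1 : 1 <= logs. Proof. by rewrite /logs -addrA lerDl addr_ge0. Qed.

Let mult_const_gt0 : 0 < mult_const M.
Proof. by rewrite addr_gt0// mulr_gt0// addr_gt0. Qed.

Let pen1 : 0 < rho0 P * ratio P ^+ k0.
Proof. by rewrite mulr_gt0// exprn_gt0// (lt_trans ltr01). Qed.

Let pen2 : 0 < 2 * mult_const M * ratio P.
Proof. by rewrite !mulr_gt0// (lt_trans ltr01). Qed.

Let pen0 : 0 < penalty_const M. Proof. exact: addr_gt0. Qed.

Let rmax_ge1 : rho0 P * ratio P ^+ k0 <= rmax.
Proof.
apply: (@le_trans _ _ (penalty_const M)); first by rewrite lerDl ltW.
by rewrite /rmax ler_peMr// ltW.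
Qed.

Let rmax_ge2 : 2 * mult_const M * ratio P / eps1 <= rmax.
Proof. by rewrite /rmax ler_pM2r ?invr_gt0// lerDr ltW. Qed.

Let A_ge0 : 0 <= A.
Proof. by rewrite divr_ge0 ?addr_ge0// ltW. Qed.

Let E_ge0 : 0 <= E.
Proof. by rewrite divr_ge0 ?addr_ge0// ltW. Qed.

Let A_bound (a : nat) : eps1 / 2 < deltac * alpha P ^+ a -> a%:R <= A.
Proof.
move=> h; have [a0 _] := andP alpha01; rewrite /A ler_pdivlMr//.
have e2 : 0 < eps1 / 2 by rewrite divr_gt0.
have : ln (eps1 / 2) < ln (deltac * alpha P ^+ a).
  by rewrite ltr_ln ?posrE// mulr_gt0// exprn_gt0.
rewrite [ln (deltac * _)]lnM ?posrE ?exprn_gt0// lnXn// -[ln (alpha P) *+ a]mulr_natl ln_div ?posrE//.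
have hd : ln (2 * deltac) = ln 2 + ln deltac by rewrite lnM ?posrE.
have he : ln eps1^-1 = - ln eps1 by rewrite lnV ?posrE.
have := ler_norm (ln (2 * deltac)); rewrite {1}hd he; lra.
Qed.

Let E_bound (e : nat) : rho0 P * ratio P ^+ e <= rmax -> e%:R <= E.
Proof.
move=> h; have r0 : 0 < ratio P by exact: lt_trans ratio_gt1.
rewrite /E ler_pdivlMr//.
have : ln (rho0 P * ratio P ^+ e) <= ln rmax.
  have rm0 : 0 < rmax by exact: divr_gt0.
  by rewrite ler_ln ?posrE//; apply: mulr_gt0; rewrite ?exprn_gt0.
rewrite lnM ?posrE ?exprn_gt0// lnXn// -[ln (ratio P) *+ e]mulr_natl /rmax lnM ?posrE ?invr_gt0//.
have hd : ln (penalty_const M / rho0 P) = ln (penalty_const M) - ln (rho0 P).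
  by rewrite ln_div ?posrE.
have := ler_norm (ln (penalty_const M / rho0 P)); rewrite {1}hd; lra.
Qed.

Let level lam rho x (hl : l2norm lam <= Lambda P) (hr : rho0 P <= rho)
    (h : auglag f c z lam rho x <= f z) :=
  level_set_Sset gamma_gt0 rho0_gt flow_le eps1_01 cz_le fz_le hl hr
    deltaf_large deltac_large h.

(** The constant is affine in rho with nonnegative coefficients, and dividing by eps1 < 1 only
    enlarges its rho-free part. *)
Let lipschitz_const_mono rho : 0 <= rho <= rmax ->
  @lipschitz_const R m M (Lambda P) deltac rho <= smooth_const M / eps1.
Proof.
move=> /andP[r0 hr]; rewrite /smooth_const /lipschitz_const.
have d4 : 0 <= deltac + 4 * M by rewrite addr_ge0 ?mulr_ge0// ltW.
have h1 : rho * (deltac + 4 * M) <= penalty_const M * (deltac + 4 * M) / eps1.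
  by rewrite mulrAC ler_wpM2r.
have h2 : Lambda P <= Lambda P / eps1 by rewrite ler_peMr// ltW.
have h3 : 1 + M <= (1 + M) / eps1 by rewrite ler_peMr// addr_ge0// ltW.
rewrite [_ / eps1]mulrDl lerD// -[leRHS]mulrA ler_wpM2l// -[leRHS]mulrA ler_wpM2l ?(ltW M_gt0)//.
by rewrite [_ / eps1]mulrDl lerD.
Qed.

Let smooth_const_ge1 : 1 + M <= smooth_const M.
Proof.
rewrite /smooth_const /lipschitz_const lerDl mulr_ge0// mulr_ge0 ?(ltW M_gt0)//.
rewrite addr_ge0 ?(ltW Lambda_gt0)// mulr_ge0 ?(ltW pen0)//.
by rewrite addr_ge0 ?mulr_ge0// ltW.
Qed.

Section Lipschitz.
Variable L : R.
Hypothesis L_ge1 : 1 <= L.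
Hypothesis lipAL : forall lam rho, l2norm lam <= Lambda P -> rho0 P <= rho <= rmax ->
  forall x d a, 0 < a -> auglag f c z lam rho x <= f z ->
  auglag f c z lam rho (x + a *: d) <= f z ->
  a * l2norm d <= 1 -> forall t, 0 < t < a ->
  specnorm (hess (auglag f c z lam rho) (x + t *: d) - hess (auglag f c z lam rho) x)
    <= L * (t * l2norm d).

Let level_ct lam rho x (hl : l2norm lam <= Lambda P) (hr : rho0 P <= rho)
  (h : auglag f c z lam rho x <= f z) : l2norm (ctilde c z x) <= deltac :=
  (level hl hr h).2.

Let level_mult lam rho x : l2norm lam <= Lambda P -> rho0 P <= rho ->
  auglag f c z lam rho x <= f z -> l2norm (grad (auglag f c z lam rho) x) <= 1 ->
  rho * l2norm (ctilde c z x) <= mult_const M.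
Proof.
move=> hl hr h hg; have [Sx _] := level hl hr h.
apply: le_trans (multiplier_bound C2f C2c hM Sx _ hg) _.
  exact: le_trans (ltW rho0_gt0) hr.
by rewrite lerD2l.
Qed.

Let level_low lam rho x : l2norm lam <= Lambda P -> rho0 P <= rho ->
  al_low <= auglag f c z lam rho x.
Proof.
by move=> hl hr; exact: (auglag_bounded_below gamma_gt0 rho0_gt flow_le eps1_01 cz_le).
Qed.

Let cost_le k lam rho q u o mv : l2norm lam <= Lambda P ->
  rho0 P <= rho <= rmax -> auglag f c z lam rho u <= f z -> l2norm q = 1 ->
  inner_iter P f c eps1 eps2 z k lam rho q u o mv -> mv%:R <= cost.
Proof.
move=> hl /andP[hr hm] hu q1 hi; have [Su ctu] := level hl hr hu.
have r0 : 0 <= rho by exact: le_trans (ltW rho0_gt0) hr.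
have t1 : 0 < tol P eps1 k by exact: lt_le_trans e10 (tol_ge _ _ _).
have t20 : eps2 <= tol P eps2 k by exact: tol_ge.
have t2 : 0 < tol P eps2 k <= 1.
  by rewrite (lt_le_trans e20 t20) tol_le1.
have [t2p _] := andP t2.
have hH : specnorm (hess (auglag f c z lam rho) u) <= smooth_const M / eps1.
  have hb := auglag_hess_bound C2f C2c hM Su r0 hl ctu; apply: (le_trans hb).
  by apply: lipschitz_const_mono; rewrite r0.
apply: (newton_cg_iter_cost_le (auglag_hess_sym z C2f C2c lam rho) t1 t2 zeta01 delta01
  q1 _ hi).
rewrite /kappa mulrDl; apply: lerD.
  rewrite invfM mulrA; apply: ler_pM => //; first exact: specnorm_ge0.
    by rewrite invr_ge0 ltW.
  by rewrite lef_pV2 ?posrE.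
by rewrite invfM ler_peMr// mulr_ege1.
Qed.

Let step_exists s q := al_step_exists C2f C2c Lambda_gt0 rho0_gt0 alpha01 ratio_gt1
  theta01 zeta01 eta01 eps1_01 eps2_01 cz_le lam0_le tol_k0 L_ge1 level_ct level_mult
  level_low rmax_ge1 rmax_ge2 lipAL cost_le A_bound E_bound A_ge0 E_ge0 (s := s) (q := q)
  (x0 := x0).

Let reach_inv s (h : al_reachable P f c eps1 eps2 z x0 lam0 s) :=
  invariant_iters theta01 eta01 eps1_01 eps2_01 L_ge1 level_low A_bound E_bound A_ge0 E_ge0
   (al_reachable_invariant C2f C2c rho0_gt0 alpha01 ratio_gt1
  theta01 zeta01 eta01 eps1_01 eps2_01 cz_le lam0_le tol_k0 L_ge1 level_ct level_mult
  level_low rmax_ge1 rmax_ge2 lipAL cost_le A_bound E_bound A_ge0 E_ge0 h).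

Lemma outer_iters_le : outer_iters A E k0 + 1 <= outer_const M * logs ^+ 2.
Proof.
have hA : A + 1 <= decay_const * logs.
  rewrite /A /decay_const [leRHS]mulrDl mul1r lerD// mulrAC ler_pM2r ?invr_gt0//.
  have := normr_ge0 (ln (2 * deltac)); move: (`|_|) l1 l2 => a p1 p2 a0.
  by rewrite /logs; have := mulr_ge0 a0 p1; have := mulr_ge0 a0 p2; lra.
have hE : E + 1 <= growth_const M * logs.
  rewrite /E /growth_const [leRHS]mulrDl mul1r lerD// mulrAC ler_pM2r ?invr_gt0//.
  have := normr_ge0 (ln (penalty_const M / rho0 P)); move: (`|_|) l1 l2 => a p1 p2 a0.
  by rewrite /logs; have := mulr_ge0 a0 p1; have := mulr_ge0 a0 p2; lra.
have hp : (E + 1) * (A + 1) <= growth_const M * logs * (decay_const * logs).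
  by apply: ler_pM => //; rewrite addr_ge0.
have lg2 : 1 <= logs ^+ 2 by rewrite exprn_ege1.
rewrite /outer_iters /outer_const.
have h2 : k0%:R + 2 <= (k0%:R + 2) * logs ^+ 2 :> R by rewrite ler_peMr// addr_ge0.
have -> : (k0%:R + 2 + growth_const M * decay_const) * logs ^+ 2 =
  (k0%:R + 2) * logs ^+ 2 + growth_const M * logs * (decay_const * logs) by ring.
by move: h2 hp; move: (growth_const M * logs * _) ((_ + 2) * _) => a b; lra.
Qed.

Lemma base_ge1 : 1 <= base.
Proof.
rewrite le_max; apply/orP; right.
by rewrite -exprVn exprn_ege1.
Qed.

Lemma call_iters_le :
  call_iters P f eps1 eps2 z al_low L <= call_const * (base * L ^+ 2).
Proof.
have b1 := base_ge1; have L2 : 1 <= L ^+ 2 by rewrite exprn_ege1.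
have L2p : 0 < L ^+ 2 by exact: lt_le_trans L2.
have [c0 _] := andP (decrease_const_bound theta01 eta01).
have bp : 0 < base by exact: lt_le_trans b1.
have hb : base^-1 <= Num.min (eps1 ^+ 2 / eps2) (eps2 ^+ 3).
  have e12 : 0 < eps1 ^+ 2 by rewrite exprn_gt0.
  have e23 : 0 < eps2 ^+ 3 by rewrite exprn_gt0.
  rewrite le_min; apply/andP; split.
    rewrite -[leRHS]invrK lef_pV2 ?posrE ?invr_gt0 ?divr_gt0// invf_div.
    by rewrite /base le_max mulrC lexx.
  rewrite -[leRHS]invrK lef_pV2 ?posrE ?invr_gt0//.
  by rewrite /base le_max lexx orbT.
have D0 : 0 < call_decrease P eps1 eps2 L by exact: call_decrease_gt0.
have hD : decrease_const (theta P) (eta P) / (base * L ^+ 2) <= call_decrease P eps1 eps2 L.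
  by rewrite /call_decrease invfM ler_pM2l// ler_pM2r ?invr_gt0.
have hinv : (call_decrease P eps1 eps2 L)^-1 <=
    base * L ^+ 2 / decrease_const (theta P) (eta P).
  have X0 : 0 < base * L ^+ 2 / decrease_const (theta P) (eta P).
    by rewrite divr_gt0// mulr_gt0.
  rewrite -[leRHS]invrK lef_pV2 ?posrE ?invr_gt0// invf_div.
  exact: hD.
have hdf : 0 <= f z - al_low.
  rewrite subr_ge0 -(auglag_z f c z lam0 (rho0 P)); exact: level_low.
have hdf2 : f z - al_low <= `|fhi - al_low|.
  by apply: le_trans (ler_norm _); rewrite lerD2r.
have bL : 1 <= base * L ^+ 2 by rewrite mulr_ege1.
rewrite /call_iters /call_const [leRHS]mulrDl; apply: lerD; last first.
  by rewrite ler_peMr.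
have -> : 2 * `|fhi - al_low| / decrease_const (theta P) (eta P) * (base * L ^+ 2) =
  2 * `|fhi - al_low| * (base * L ^+ 2 / decrease_const (theta P) (eta P)) by rewrite mulrAC -!mulrA.
apply: ler_pM => //; [by rewrite mulr_ge0|by rewrite invr_ge0 ltW|by rewrite ler_pM2l].
Qed.

Lemma outer_const_ge0 : 0 <= outer_const M.
Proof.
have h1 : 0 <= growth_const M by rewrite addr_ge0// divr_ge0 ?addr_ge0// ltW.
have h2 : 0 <= decay_const by rewrite addr_ge0// divr_ge0 ?addr_ge0// ltW.
by apply: addr_ge0; [exact: addr_ge0 | exact: mulr_ge0].
Qed.

Lemma call_const_ge0 : 0 <= call_const.
Proof.
have [c0 _] := andP (decrease_const_bound theta01 eta01).
apply: addr_ge0 => //; apply: divr_ge0; last exact: ltW.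
exact: mulr_ge0.
Qed.

Lemma al_iters_le s : al_reachable P f c eps1 eps2 z x0 lam0 s ->
  (iters s)%:R <= outer_const M * logs ^+ 2 * (call_const * (base * L ^+ 2)).
Proof.
move=> h; have [hi _] := reach_inv h; apply: le_trans hi _.
have c0 : 0 <= call_iters P f eps1 eps2 z al_low L.
  have := potential_le theta01 eta01 eps1_01 eps2_01 L_ge1 level_low 0 z lam0_le (lexx _).
  have := potential_ge0 theta01 eta01 eps1_01 eps2_01 L_ge1 0
    (_ : auglag f c z lam0 (rho0 P) z <= f z).
  by rewrite auglag_z => /(_ (lexx _)); lra.
apply: ler_pM => //; [|exact: outer_iters_le|exact: call_iters_le].
by rewrite addr_ge0// /outer_iters !addr_ge0// mulr_ge0// addr_ge0.
Qed.

Lemma al_mvs_le s : al_reachable P f c eps1 eps2 z x0 lam0 s ->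
  (mvs s)%:R <= (iters s)%:R * cost.
Proof. by move=> h; have [_] := reach_inv h. Qed.

Lemma al_well_defined s q : al_reachable P f c eps1 eps2 z x0 lam0 s ->
  ~ is_done s -> l2norm q = 1 -> exists s', al_step P f c eps1 eps2 z q s s'.
Proof. exact: step_exists. Qed.

End Lipschitz.
Let hvp := Num.min n%:R (eps1 `^ (- (1 / 2)) * eps2 `^ (- (1 / 2))).
Let lg := logs + ln n%:R.

Let ln_n_ge0 : 0 <= ln n%:R :> R.
Proof.
by case: (n) => [|k]; [rewrite ln0 | rewrite ln_ge0// ler1n].
Qed.

Let lg_ge : logs <= lg. Proof. by rewrite /lg lerDl. Qed.

Let smooth_gt1 : 1 <= smooth_const M.
Proof. by apply: le_trans smooth_const_ge1; rewrite lerDl ltW. Qed.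

Let cost_const_ge2' : 2 <= cost_const (delta P) (zeta P) (smooth_const M + 2).
Proof. by apply: cost_const_ge2 => //; apply: le_trans smooth_gt1 _; rewrite lerDl. Qed.

Let mv_const_ge1 : 1 <= mv_const M.
Proof. by rewrite /mv_const; move: cost_const_ge2'; lra. Qed.

Let hvp_ge0 : 0 <= hvp.
Proof. by rewrite le_min ler0n mulr_ge0 ?powR_ge0. Qed.

Let cost_le_hvp : cost <= mv_const M * lg * hvp.
Proof.
have [n0|n0] := posnP n.
  (* In dimension 0, where [cost_bound_le] does not apply, the cost is at most 0. *)
  have lg0 : 0 <= lg by apply: le_trans lg_ge; exact: le_trans logs_ge1.
  have : 0 <= mv_const M * lg * hvp.
    by rewrite mulr_ge0// mulr_ge0//; exact: le_trans mv_const_ge1.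
  apply: le_trans; rewrite /cost n0 pmulr_rle0//.
  by rewrite ge_min lexx.
have K1 : 1 <= smooth_const M + 2 by apply: le_trans smooth_gt1 _; rewrite lerDl.
have := cost_bound_le n0 delta01 zeta01 K1 eps1_01 eps2_01.
by rewrite /cost /mv_const -!mulrA ler_pM2l// !mulrA.
Qed.

(** The outer count contributes [logs ^+ 2] and the cost of an iteration one more factor. The
    iteration bound is padded by [mv_const M * logs], which is at least 1, so that one constant and
    one exponent serve all bounds. *)
Let scale_bounds (L w : R) (it mv : nat) : 0 <= w -> base * L ^+ 2 <= smooth_const M ^+ 2 * w ->
  it%:R <= outer_const M * logs ^+ 2 * (call_const * (base * L ^+ 2)) ->
  mv%:R <= it%:R * cost ->
  it%:R <= iter_const M * mv_const M * logs ^+ 3 * w /\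
  mv%:R <= iter_const M * mv_const M * lg ^+ 3 * (w * hvp).
Proof.
move=> w0 hw hi hm; have o0 := outer_const_ge0; have c0 := call_const_ge0.
have lg0 : 0 <= logs by exact: le_trans logs_ge1.
have lg0' : 0 <= lg by exact: le_trans lg_ge.
have i0 : 0 <= iter_const M by rewrite !mulr_ge0// ?exprn_ge0//; exact: le_trans smooth_gt1.
have hi2 : it%:R <= iter_const M * w * logs ^+ 2.
  apply: le_trans hi _; rewrite /iter_const.
  have -> : outer_const M * call_const * smooth_const M ^+ 2 * w * logs ^+ 2 =
    outer_const M * logs ^+ 2 * (call_const * (smooth_const M ^+ 2 * w)) by ring.
  by rewrite ler_wpM2l ?mulr_ge0 ?exprn_ge0// ler_wpM2l.
have iw : 0 <= iter_const M * w by rewrite mulr_ge0.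
split.
  apply: le_trans hi2 _.
  have -> : iter_const M * mv_const M * logs ^+ 3 * w =
    iter_const M * w * logs ^+ 2 * (mv_const M * logs) by ring.
  have mvl : 1 <= mv_const M * logs by exact: mulr_ege1.
  by rewrite ler_peMr// mulr_ge0// exprn_ge0.
apply: le_trans hm _.
apply: (@le_trans _ _ (it%:R * (mv_const M * lg * hvp))).
  by rewrite ler_wpM2l.
have -> : iter_const M * mv_const M * lg ^+ 3 * (w * hvp) =
  iter_const M * w * lg ^+ 2 * (mv_const M * lg * hvp) by ring.
rewrite ler_wpM2r//; first by rewrite mulr_ge0// mulr_ge0//; exact: le_trans mv_const_ge1.
apply: le_trans hi2 _; rewrite ler_wpM2l//.
by apply: lerXn2r.
Qed.

Let base_ge0 : 0 <= base. Proof. exact: le_trans base_ge1. Qed.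

Let lip_general lam rho : l2norm lam <= Lambda P -> rho0 P <= rho <= rmax ->
  forall x d a, 0 < a -> auglag f c z lam rho x <= f z ->
  auglag f c z lam rho (x + a *: d) <= f z ->
  a * l2norm d <= 1 -> forall t, 0 < t < a ->
  specnorm (hess (auglag f c z lam rho) (x + t *: d) - hess (auglag f c z lam rho) x)
    <= smooth_const M / eps1 * (t * l2norm d).
Proof.
move=> hl /andP[hr hm] x d a a0 hx hy ad t t01; have [t0 _] := andP t01.
have r0 : 0 <= rho by exact: le_trans (ltW rho0_gt0) hr.
have [Sx ctx] := level hl hr hx; have [Sy _] := level hl hr hy.
have h := auglag_hess_lipschitz C2f C2c hM segO r0 hl ctx a0 Sx Sy ad t01.
apply: (le_trans h); rewrite ler_wpM2r ?mulr_ge0 ?l2norm_ge0 ?(ltW t0)//.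
by apply: lipschitz_const_mono; rewrite r0.
Qed.

Let lip_affine lam rho : affine c -> l2norm lam <= Lambda P -> rho0 P <= rho <= rmax ->
  forall x d a, 0 < a -> auglag f c z lam rho x <= f z ->
  auglag f c z lam rho (x + a *: d) <= f z ->
  a * l2norm d <= 1 -> forall t, 0 < t < a ->
  specnorm (hess (auglag f c z lam rho) (x + t *: d) - hess (auglag f c z lam rho) x)
    <= (1 + M) * (t * l2norm d).
Proof.
move=> ac hl /andP[hr hm] x d a a0 hx hy ad t t01.
have [Sx _] := level hl hr hx; have [Sy _] := level hl hr hy.
exact: (auglag_hess_lipschitz_affine z C2f C2c hM segO lam rho ac a0 Sx Sy t01).
Qed.

Let L_general : 1 <= smooth_const M / eps1. Proof. exact: mulr_ege1. Qed.

Let L_affine : 1 <= 1 + M. Proof. by rewrite lerDl ltW. Qed.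

(** In general [L = smooth_const M / eps1], whose square is the origin of [eps1 ^- 2]; for affine c,
    [L = 1 + M] leaves no such factor. *)
Lemma al_complexity :
  [/\ forall s q, al_reachable P f c eps1 eps2 z x0 lam0 s -> ~ is_done s ->
        l2norm q = 1 -> exists s', al_step P f c eps1 eps2 z q s s',
      forall s, al_reachable P f c eps1 eps2 z x0 lam0 s ->
        (iters s)%:R <= iter_const M * mv_const M * logs ^+ 3 * (eps1 ^- 2 * base) /\
        (mvs s)%:R <= iter_const M * mv_const M * lg ^+ 3 * (eps1 ^- 2 * base * hvp)
    & affine c -> forall s, al_reachable P f c eps1 eps2 z x0 lam0 s ->
        (iters s)%:R <= iter_const M * mv_const M * logs ^+ 3 * base /\
        (mvs s)%:R <= iter_const M * mv_const M * lg ^+ 3 * (base * hvp)].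
Proof.
split.
- by move=> s q; exact: (al_well_defined L_general lip_general).
- move=> s hs; have w0 : 0 <= eps1 ^- 2 * base.
    by rewrite mulr_ge0// invr_ge0 exprn_ge0// ltW.
  apply: (scale_bounds w0 _ (al_iters_le L_general lip_general hs)
    (al_mvs_le L_general lip_general hs)).
  by rewrite expr_div_n mulrCA [base * _]mulrC.
- move=> ac s hs.
  have lip lam rho := lip_affine (lam := lam) (rho := rho) ac.
  apply: (scale_bounds base_ge0 _ (al_iters_le L_affine lip hs) (al_mvs_le L_affine lip hs)).
  rewrite mulrC ler_wpM2r//; apply: lerXn2r; rewrite ?nnegrE//.
    by rewrite addr_ge0// ltW.
  exact: le_trans smooth_gt1.
Qed.

End Instance.
End Complexity.

Theorem theorem4p5 (R : realType) (m : nat) (P : al_params R)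
  (fhi flow gamma deltaf deltac : R)
  (Lambda_gt0 : 0 < Lambda P)
  (gamma_gt0 : 0 < gamma)
  (rho0_gt : 2 * gamma < rho0 P)
  (alpha01 : 0 < alpha P < 1)
  (ratio_gt1 : 1 < ratio P)
  (delta01 : 0 < delta P < 1)
  (theta01 : 0 < theta P < 1)
  (zeta01 : 0 < zeta P < 1)
  (eta01 : 0 < eta P < 1)
  (deltaf_gt0 : 0 < deltaf) (deltac_gt0 : 0 < deltac)
  (deltaf_large : delta_f1 P <= deltaf)
  (deltac_large : delta_c1 P fhi flow gamma <= deltac) :
  exists (C : R -> R) (p : nat),
  forall (n : nat) (f : 'cV[R]_n -> R) (c : 'cV[R]_n -> 'cV[R]_m)
    (Omega : set 'cV[R]_n),
  C2 f -> (forall i, C2 (coordf c i)) ->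
  (exists xopt, c xopt = 0 /\ forall x, c x = 0 -> f xopt <= f x) ->
  (forall x, flow <= f x + gamma * l2norm (c x) ^+ 2 / 2) ->
  let S := Sset f c fhi deltaf deltac in
  compact S ->
  open Omega -> convex_set Omega -> S `<=` Omega ->
  (exists L, lipschitz_hess L Omega f) ->
  (forall i, exists L, lipschitz_hess L Omega (coordf c i)) ->
  (forall x, S x -> \rank (gradc c x) = m) ->
  (exists M, problem_constant f c S Omega M) /\
  forall M, problem_constant f c S Omega M ->
  forall (eps1 eps2 : R) (z x0 : 'cV[R]_n) (lam0 : 'cV[R]_m),
  0 < eps1 < 1 -> 0 < eps2 < 1 ->
  l2norm (c z) <= eps1 / 2 -> f z <= fhi -> l2norm lam0 <= Lambda P ->
  let reachable := al_reachable P f c eps1 eps2 z x0 lam0 in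
  let logs := 1 + ln eps1^-1 + ln eps2^-1 in
  let base := Num.max (eps1 ^- 2 * eps2) (eps2 ^- 3) in
  let hvp := Num.min n%:R (eps1 `^ (- (1 / 2)) * eps2 `^ (- (1 / 2))) in
  [/\ (* The method is well defined: whichever start vector is drawn, it can
         be continued until it outputs a pair.  As every step performs one
         iteration, it terminates by the next bound. *)
      forall s q, reachable s -> ~ is_done s -> l2norm q = 1 ->
        exists s', al_step P f c eps1 eps2 z q s s',
      forall s, reachable s ->
        (iters s)%:R <= C M * logs ^+ p * (eps1 ^- 2 * base),
      affine c -> forall s, reachable s ->
        (iters s)%:R <= C M * logs ^+ p * base,
      forall s, reachable s ->
        (mvs s)%:R <= C M * (logs + ln n%:R) ^+ p * (eps1 ^- 2 * base * hvp)
    & affine c -> forall s, reachable s ->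
        (mvs s)%:R <= C M * (logs + ln n%:R) ^+ p * (base * hvp)].
Proof.
have lnr : 0 < ln (ratio P) by rewrite ln_gt0.
have [k0 hk0] : exists k0 : nat, ln 2 <= k0%:R * ln (ratio P).
  exists (Num.bound (ln 2 / ln (ratio P))); rewrite -ler_pdivrMr// ltW//.
  by rewrite archi_boundP// divr_ge0 ?ln_ge0 ?ler1n// ltW.
(* k0 is determined by [ratio P] alone, so nothing here depends on n, f, c or the tolerances except
   through M. *)
exists (fun M => iter_const m P fhi flow gamma deltac k0 M * mv_const m P deltac k0 M), 3%N.
move=> n f c Omega C2f C2c _ hflow S cS _ cO SO hLf hLc hr; split.
  exact: problem_constant_exists.
move=> M hM eps1 eps2 z x0 lam0 e1 e2 hz hfz hl reachable logs base hvp.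
have segO := segments_sub_convex cO SO.
have [h1 h2 h3] := al_complexity Lambda_gt0 gamma_gt0 rho0_gt alpha01 ratio_gt1
  delta01 theta01 zeta01 eta01 deltac_gt0 deltaf_large deltac_large hk0 C2f C2c hflow
  segO hM x0 e1 e2 hz hfz hl.
split=> //.
- by move=> s hs; have [] := h2 s hs.
- by move=> ac s hs; have [] := h3 ac s hs.
- by move=> s hs; have [] := h2 s hs.
- by move=> ac s hs; have [] := h3 ac s hs.
Qed.
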